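(* (i) Let $\mu$ be a finite nonnegative Borel measure in a separable metric space $\mathcal X$, and let $K(x,y)$ be an antisymmetric Calderón–Zygmund kernel on $\mathcal X$ with parameters $A,s,\delta$. Then $$\sup_{\varepsilon>0}\|\mathfrak R_{\mu,\varepsilon}^K\|_{L^2(\mu)\to L^2(\mu)}^2\le C\sup_{x\in\operatorname{supp}\mu}W_s^\mu(x),\qquad W_s^\mu(x)=\int_0^\infty\left[\frac{\mu(\mathcal B(x,r))}{r^s}\right]^2\frac{dr}r,$$ where $C$ depends only on the parameters $A,s,\delta$ of the kernel $K(x,y)$. (ii) On the other hand, let $\mu$ be a finite (nonzero) nonnegative Borel measure on $\mathbb R^d$. If $\mu(B(x,t))\to0$ as $t\to0$ for every $x\in\mathbb R^d$, and if $\varphi\in\Phi$, $\varphi$ is concave, and the doubling exponent of $\varphi$ satisfies $s\in(0,1)$, then $$\sup_{\varepsilon>0}\|\mathfrak R_{\mu,\varepsilon}^\varphi\|_{L^2(\mu)\to L^2(\mu)}^2\ge\frac{c}{\|\mu\|}\int_{\mathbb R^d}W_\varphi^\mu(x)\,d\mu(x),$$ where $c=c(s)>0$ depends only on $s$.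
   Context: In a metric space $\mathcal X$ with distance $\operatorname{dist}$, $\mathcal B(x,r)=\{y\in\mathcal X:\operatorname{dist}(x,y)<r\}$; in $\mathbb R^d$, $d\ge1$, $B(x,r)=\{y:|y-x|<r\}$. $\|\mu\|$ is the total mass of $\mu$. A function $K:\mathcal X\times\mathcal X\to\mathbb C$ is a Calderón–Zygmund (CZ) kernel with parameters $A>0$, $s>0$, $\delta\in(0,1]$ if $$|K(x,y)|\le\frac{A}{\operatorname{dist}(x,y)^s},\qquad |K(x,y)-K(x',y)|,\ |K(y,x)-K(y,x')|\le A\,\frac{\operatorname{dist}(x,x')^\delta}{\operatorname{dist}(x,y)^{s+\delta}}$$ whenever $x,x',y\in\mathcal X$ (with $x\neq y$) and $\operatorname{dist}(x,x')\le\frac12\operatorname{dist}(x,y)$. It is antisymmetric if $K(x,y)=-K(y,x)$. The truncated operators are $$\mathfrak R_{\mu,\varepsilon}^Kf(x)=\int_{\mathcal X\setminus\mathcal B(x,\varepsilon)}K(x,y)f(y)\,d\mu(y),\quad f\in L^2(\mu),\ \varepsilon>0.$$ The class $\Phi$ consists of the functions $\varphi(t)$, $t\ge0$, such that: (I) $\varphi(0)=0$, and $\varphi$ is increasing and differentiable for $t>0$; (II) $\varphi(t)\to\infty$ as $t\to\infty$; (III) $\varphi'(t)$, $t>0$, is monotonic (so $\varphi$ is either convex or concave); (IV) $\varphi(2t)\le2^s\varphi(t)$ for all $t\ge0$ and for some $s>0$ depending on $\varphi$ (the doubling exponent). On $\mathbb R^d$, $$\mathfrak R_{\mu,\varepsilon}^\varphi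 f(x)=\int_{|y-x|>\varepsilon}\frac{y-x}{|y-x|}\cdot\frac1{\varphi(|y-x|)}\,f(y)\,d\mu(y),\qquad W_\varphi^\mu(x)=\int_0^\infty\left(\frac{\mu(B(x,t))}{\varphi(t)}\right)^2\frac{d\varphi(t)}{\varphi(t)}.$$ *)

(* Defs.v *)
From HB Require Import structures.
From mathcomp Require Import all_boot all_order all_algebra.
From mathcomp Require Import all_classical all_reals all_analysis.
From mathcomp Require Import complex.

Set Implicit Arguments.
Unset Strict Implicit.
Unset Printing Implicit Defensive.

Import Order.TTheory GRing.Theory Num.Theory.
Import numFieldNormedType.Exports.

Local Open Scope classical_set_scope.
Local Open Scope complex_scope.
Local Open Scope ring_scope.

(* The library's measurable types are pointed, so metric spaces carrying a
   measure are taken pointed, i.e. nonempty. *)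
#[short(type="pmetricType")]
HB.structure Definition PointedMetric (K : numDomainType) :=
  {M of Pointed M & Metric K M}.

Notation borelType X := (g_sigma_algebraType (@open X)).

Definition separable_space (T : topologicalType) : Prop :=
  exists2 D : set T, countable D & dense D.

(* Supremum computed in [0, +oo]: the empty set has supremum 0, not -oo. This
   matters for the support of the zero measure. *)
Definition nneg_sup (R : realType) (A : set (\bar R)) : \bar R :=
  ereal_sup (0%E |` A).

Section L2.
Context d (T : measurableType d) (R : realType).
Variable mu : {measure set T -> \bar R}.

Definition cintegral (D : set T) (f : T -> R[i]) : R[i] :=
  (\int[mu]_(x in D) complex.Re (f x))%R +i*
  (\int[mu]_(x in D) complex.Im (f x))%R.

Definition L2norm (V : Type) (nrm : V -> R) (f : T -> V) : \bar R :=
  Lnorm mu 2%:E (fun x => (nrm (f x))%:E).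

Definition L2 (f : T -> R[i]) : Prop :=
  [/\ measurable_fun setT (fun x => complex.Re (f x)),
      measurable_fun setT (fun x => complex.Im (f x)) &
      (L2norm (@Normc.normc R) f < +oo)%E].

Definition L2opnorm (V : Type) (nrm : V -> R) (S : (T -> R[i]) -> T -> V)
    : \bar R :=
  ereal_sup [set L2norm nrm (S f)
            | f in [set f | L2 f /\ (L2norm (@Normc.normc R) f <= 1)%E]].

End L2.

Section MetricSpace.
Context (R : realType) (X : pmetricType R).

Definition CZ_kernel (A s delta : R) (K : X -> X -> R[i]) : Prop :=
  (forall x y, x != y -> Normc.normc (K x y) <= A / mdist x y `^ s) /\
  (forall x x' y, x != y -> mdist x x' <= 2^-1 * mdist x y ->
     Normc.normc (K x y - K x' y)
       <= A * (mdist x x' `^ delta / mdist x y `^ (s + delta)) /\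
     Normc.normc (K y x - K y x')
       <= A * (mdist x x' `^ delta / mdist x y `^ (s + delta))).

Definition antisymmetric_kernel (K : X -> X -> R[i]) : Prop :=
  forall x y, K x y = - K y x.

Variable mu : {measure set (borelType X) -> \bar R}.

Definition CZtrunc (K : X -> X -> R[i]) (eps : R) (f : X -> R[i]) (x : X)
    : R[i] :=
  cintegral mu (~` ball x eps) (fun y => K x y * f y).

Definition msupport : set X := [set x | forall r, 0 < r -> (0 < mu (ball x r))%E].

Definition Wpot (s : R) (x : X) : \bar R :=
  (\int[lebesgue_measure]_(r in `]0%R, +oo[)
     ((fine (mu (ball x r)) / r `^ s) ^+ 2 / r)%:E)%E.

End MetricSpace.

Section Phi.
Context (R : realType).
Implicit Types (phi : R -> R) (s : R).

(* phi is only relevant on [0, +oo[ *)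
Definition doubling s phi : Prop :=
  forall t, 0 <= t -> phi (2 * t) <= 2 `^ s * phi t.

Definition PhiClass phi : Prop :=
  [/\ [/\ phi 0 = 0, {in `[0, +oo[ &, {homo phi : x y / x < y}} &
          forall t, 0 < t -> derivable phi t 1],
      phi t @[t --> +oo] --> +oo,
      {in `]0, +oo[ &, {homo derive1 phi : x y / x <= y}} \/
      {in `]0, +oo[ &, {homo derive1 phi : x y /~ x <= y}} &
      exists2 s, 0 < s & doubling s phi].

Definition concave_halfline phi : Prop :=
  @convex_function R R^o `[0, +oo[%classic (fun t => - phi t).

End Phi.

Section Euclidean.
Context (R : realType) (d : nat).

(* The norm carried by 'rV[R]_d in the library is the sup norm; it has the
   same open sets as the Euclidean norm. *)
Definition enorm (x : 'rV[R]_d) : R := Num.sqrt (\sum_j (x ord0 j) ^+ 2).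

Definition eball (x : 'rV[R]_d) (r : R) : set 'rV[R]_d :=
  [set y | enorm (y - x) < r].

(* The functions in L2(mu) are complex-valued, so the operator with R^d-valued
   kernel takes values in C^d, with its Hermitian norm. *)
Definition hnorm (z : 'rV[R[i]]_d) : R :=
  Num.sqrt (\sum_j (Normc.normc (z ord0 j)) ^+ 2).

Variable mu : {measure set (borelType 'rV[R]_d) -> \bar R}.

Definition phi_trunc (phi : R -> R) (eps : R) (f : 'rV[R]_d -> R[i])
    (x : 'rV[R]_d) : 'rV[R[i]]_d :=
  \row_j cintegral mu [set y | eps < enorm (y - x)]
    (fun y => ((y - x) ord0 j / enorm (y - x) * (phi (enorm (y - x)))^-1)%:C
              * f y).

(* dphi(t) = phi'(t) dt *)
Definition Wphi (phi : R -> R) (x : 'rV[R]_d) : \bar R :=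
  (\int[lebesgue_measure]_(t in `]0%R, +oo[)
     ((fine (mu (eball x t)) / phi t) ^+ 2 * (derive1 phi t / phi t))%:E)%E.

End Euclidean.

(* Main.v *)
(* Part (i). For bounded antisymmetric [k] and [K f x = \int k(x,y) f(y)],
   antisymmetry gives Cotlar's identity [(K f)^2 = 2 K (f . K f) + S_f], where
   [S_f] integrates the symmetrization
   [k(x,y)k(x,z) + k(y,x)k(y,z) + k(z,x)k(z,y)]. For a truncated CZ kernel the
   symmetrization is dominated by a sum over the three vertices of
   [H_x(y,z) = min^(dl - s) max^(- s - dl)] of the two distances from [x], and
   [\int\int H_x(y,z)] is at most a multiple of [W(x)]. Cotlar's identity, used
   twice, yields [\int (K h)^4 h <= C M^2 \int h] for [0 <= h <= 1], with [M] a
   bound of [W]. Polarizing in [h] controls the bilinear form on functions of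
   two given heights with geometric decay in the ratio of the heights; summing
   over dyadic height levels gives the L^2 bound. The real and imaginary parts
   of a complex kernel are treated separately.

   Part (ii). Test on the constant function. Antisymmetry gives
   [3 \int |R 1|^2 = \int\int\int S], where [S] is a weighted sum of the cosines of
   the angles of the triangle [x, y, z]. From [cos C >= - cos A cos B] and the
   concavity bound [phi(a + b) - phi(b) <= (2^s - 1) phi(a)] for [a <= b], [S] is
   at least a multiple of [1 / phi(max(|y - x|, |z - x|))^2], whose integral in
   [y] and [z] is [2 W_phi(x)] by Tonelli, since there are no atoms. *)

Require Import Defs.
From HB Require Import structures.
From mathcomp Require Import all_boot all_order all_algebra.
From mathcomp Require Import all_classical all_reals all_analysis.
From mathcomp Require Import complex.
From mathcomp Require Import measurable_realfun ring lra.

Import Order.TTheory GRing.Theory Num.Theory.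
Import numFieldNormedType.Exports.

Local Open Scope classical_set_scope.
Local Open Scope complex_scope.
Local Open Scope ring_scope.

Set Implicit Arguments.
Unset Strict Implicit.
Unset Printing Implicit Defensive.

(** * Integrals of bounded measurable functions *)

(** The fourth power is what makes the sum over heights converge. Suppose the [p]-th moment of
    [K f], for [f] of height [a^2], is controlled against [g] of height [b^2 >= a^2]. Young's
    inequality with parameter [a b] then bounds the form by [a^(p-1) b^(3-p)] times the mass of [f]
    plus [a b] times the mass of [g]. Relative to [a^2] and [b^2] these are [(a/b)^(p-3)] and [a/b],
    so there is decay only for [p > 3]. The second obstacle is that, of the three terms bounding the
    symmetrization, only the one centred at [x] integrates to a multiple of [W(x)]. The other two
    are column sums of a kernel whose row sums are bounded; they have no pointwise bound, but the
    kernel may exchange a far point for a nearer one, and this bounds them in [L2]. An [L2] bound is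
    exactly what the fourth moment asks for. In part (ii) the one cosine that may be negative is
    paid for by the other two, and what remains is a multiple of [1 - (2^s - 1) = 2 - 2^s]: here
    [s < 1] enters. *)

Section BoundedMeasurable.
Context (R : realType).

(** The truncated kernels are bounded and [mu] is finite, so the Cotlar argument stays inside this
    class, where integrability and Fubini come for free. Unbounded [L2] functions enter only at the
    end, by cutting. *)
Definition bm d (T : measurableType d) (f : T -> R) : Prop :=
  measurable_fun setT f /\ exists C, forall x, `|f x| <= C.

Definition bm2 d1 d2 (T1 : measurableType d1) (T2 : measurableType d2)
    (F : T1 -> T2 -> R) : Prop :=
  bm (fun p : T1 * T2 => F p.1 p.2).

Context d (T : measurableType d).
Implicit Types f g : T -> R.

Lemma bm_cst (c : R) : bm (fun _ : T => c).
Proof. by split; [exact: measurable_cst | exists `|c|]. Qed.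

Lemma bmD f g : bm f -> bm g -> bm (fun x => f x + g x).
Proof.
move=> [mf [C fC]] [mg [D gD]]; split; first exact: measurable_funD.
exists (C + D) => x; exact: le_trans (ler_normD _ _) (lerD (fC x) (gD x)).
Qed.

Lemma bmM f g : bm f -> bm g -> bm (fun x => f x * g x).
Proof.
move=> [mf [C fC]] [mg [D gD]]; split; first exact: measurable_funM.
by exists (C * D) => x; rewrite normrM ler_pM.
Qed.

Lemma bmN f : bm f -> bm (fun x => - f x).
Proof.
move=> [mf [C fC]]; split; first exact: measurableT_comp.
by exists C => x; rewrite normrN.
Qed.

Lemma bm_norm f : bm f -> bm (fun x => `|f x|).
Proof.
move=> [mf [C fC]]; split; first exact: measurableT_comp.
by exists C => x; rewrite normr_id.
Qed.

Lemma bmX f n : bm f -> bm (fun x => f x ^+ n).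
Proof.
move=> [mf [C fC]]; split; first exact: measurable_funX.
exists (C ^+ n) => x; rewrite normrX lerXn2r ?nnegrE //.
exact: le_trans (fC x).
Qed.

Lemma bm_max f g : bm f -> bm g -> bm (fun x => Num.max (f x) (g x)).
Proof.
move=> [mf [C fC]] [mg [D gD]]; split; first exact: measurable_maxr.
exists (Num.max C D) => x; rewrite le_max /Num.max.
by case: ifP => _; rewrite ?fC ?gD ?orbT.
Qed.

Lemma bm_indic (A : set T) : measurable A -> bm (fun x => \1_A x : R).
Proof.
move=> mA; split; first exact: measurable_indic.
by exists 1 => x; rewrite indicE; case: (x \in A); rewrite ?normr1 ?normr0.
Qed.

Lemma bm_le (f : T -> R) (C : R) :
  measurable_fun setT f -> (forall x, `|f x| <= C) -> bm f.
Proof. by move=> mf fC; split=> //; exists C. Qed.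

Lemma bm_comp d' (T' : measurableType d') f (g : T' -> T) :
  bm f -> measurable_fun setT g -> bm (fun x => f (g x)).
Proof.
move=> [mf [C fC]] mg; split; first exact: measurableT_comp.
by exists C => x; exact: fC.
Qed.

Lemma bm_integrable (mu : {finite_measure set T -> \bar R}) f :
  bm f -> mu.-integrable setT (EFin \o f).
Proof.
move=> [mf [C fC]]; apply: measurable_bounded_integrable => //.
  by rewrite -ge0_fin_numE// fin_num_measure.
by exists C; split; [exact: num_real|move=> y Cy x _; exact: le_trans (fC x) (ltW Cy)].
Qed.

End BoundedMeasurable.

Lemma bm2_comp (R : realType) d d1 d2 (T : measurableType d)
  (T1 : measurableType d1) (T2 : measurableType d2) (F : T1 -> T2 -> R)
  (g1 : T -> T1) (g2 : T -> T2) :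
  bm2 F -> measurable_fun setT g1 -> measurable_fun setT g2 ->
  bm (fun x => F (g1 x) (g2 x)).
Proof.
move=> bF m1 m2.
by apply: (bm_comp (g := fun x => (g1 x, g2 x)) bF); exact: measurable_fun_pair.
Qed.

Definition bm3 (R : realType) d (T : measurableType d) (F : T -> T -> T -> R) :=
  bm (fun p : (T * T) * T => F p.1.1 p.1.2 p.2).

Lemma bm3_comp (R : realType) d d1 (T : measurableType d)
  (T1 : measurableType d1) (F : T1 -> T1 -> T1 -> R) (g1 g2 g3 : T -> T1) :
  bm3 F -> measurable_fun setT g1 -> measurable_fun setT g2 ->
  measurable_fun setT g3 -> bm (fun x => F (g1 x) (g2 x) (g3 x)).
Proof.
move=> bF m1 m2 m3; apply: (bm_comp (g := fun x => ((g1 x, g2 x), g3 x)) bF).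
by do 2?[apply: measurable_fun_pair => //].
Qed.

Ltac msr := solve [repeat first
  [ exact: measurable_id | exact: measurable_fst | exact: measurable_snd
  | exact: measurable_cst | assumption
  | apply: (measurableT_comp measurable_fst)
  | apply: (measurableT_comp measurable_snd) ]].

Section ParametricIntegral.
Context (R : realType) d (T : measurableType d).
Variable mu : {finite_measure set T -> \bar R}.

Lemma bm_Rintegral d' (T' : measurableType d') (F : T' -> T -> R) :
  bm2 F -> bm (fun x => \int[mu]_y F x y).
Proof.
move=> bF; have [mF [C FC]] := bF.
have bFx x : bm (F x) by apply: (bm2_comp (g1 := fun=> x) (g2 := id) bF); msr.
pose M := fine (mu setT).
apply: (@bm_le _ _ _ _ (C * M)) => [|x]; last first.
  rewrite (le_trans (le_normr_Rintegral measurableT (bm_integrable _ (bFx x))))//.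
  rewrite /M -Rintegral_cst//; apply: le_Rintegral => //.
  - exact: bm_integrable (bm_norm (bFx x)).
  - exact: bm_integrable (bm_cst _ _).
  - by move=> y _; exact: (FC (x, y)).
(* shifting by the bound makes the integrand nonnegative *)
have -> : (fun x => \int[mu]_y F x y) =
    (fun x => fine (fubini_F mu (fun p : T' * T => (F p.1 p.2 + C)%:E) x) - C * M).
  apply/funext => x; rewrite /fubini_F /= -Rintegral_cst//.
  rewrite -[fine _]/(\int[mu]_y (F x y + C)) RintegralD ?addrK//.
  - exact: bm_integrable.
  - exact: bm_integrable (bm_cst _ _).
apply: measurable_funB; last exact: measurable_cst.
apply: measurableT_comp; first exact: fine_measurable.
apply: measurable_fun_fubini_tonelli_F.
- by apply/measurable_EFinP; apply: measurable_funD => //; exact: measurable_cst.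
- move=> p /=; rewrite lee_fin -lerBlDr sub0r.
  by have := FC p; rewrite ler_norml => /andP[].
Qed.

Lemma Rintegral_swap (F : T -> T -> R) : bm2 F ->
  \int[mu]_x \int[mu]_y F x y = \int[mu]_y \int[mu]_x F x y.
Proof.
move=> bF; have [mF [C FC]] := bF.
have bFx x : bm (F x) by apply: (bm2_comp (g1 := fun=> x) (g2 := id) bF); msr.
have bFy y : bm (fun x => F x y)
  by apply: (bm2_comp (g2 := fun=> y) (g1 := id) bF); msr.
have bF' : bm2 (fun y x => F x y) by apply: (bm2_comp bF); msr.
have iF : (mu \x mu)%E.-integrable setT (fun p => (F p.1 p.2)%:E).
  apply/integrable12ltyP; first exact/measurable_EFinP.
  have -> : (\int[mu]_x \int[mu]_y `|(F x y)%:E| =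
      \int[mu]_x (\int[mu]_y `|F x y|)%:E)%E.
    apply: eq_integral => x _ /=; rewrite /Rintegral fineK//.
    exact: (integrable_fin_num measurableT (bm_integrable _ (bm_norm (bFx x)))).
  have bG : bm (fun x => \int[mu]_y `|F x y|)%R.
    by apply: bm_Rintegral; exact: bm_norm.
  have /fin_numPlt/andP[] // := integrable_fin_num measurableT (bm_integrable mu bG).
have := Fubini iF; rewrite /fubini_F /fubini_G /=.
rewrite {1}/Rintegral => e.
have -> : (\int[mu]_x (\int[mu]_y F x y)%:E = \int[mu]_x \int[mu]_y (F x y)%:E)%E.
  apply: eq_integral => x _; rewrite /Rintegral fineK//.
  exact: (integrable_fin_num measurableT (bm_integrable _ (bFx x))).
rewrite e; congr fine; apply: eq_integral => y _; rewrite /Rintegral fineK//.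
exact: (integrable_fin_num measurableT (bm_integrable _ (bFy y))).
Qed.

End ParametricIntegral.

Section WeightedIntegral.
Context (R : realType) d (T : measurableType d).
Variable mu : {finite_measure set T -> \bar R}.

(** The density stays an argument, instead of being built into a measure [h mu]: the fourth moment
    bound is proved for every [0 <= h <= 1], and then different [h] are compared. *)
Definition wint (h f : T -> R) : R := \int[mu]_x (f x * h x).

Context (h : T -> R).
Hypothesis bh : bm h.
Hypothesis h0 : forall x, 0 <= h x.

Let bmw f : bm f -> bm (fun x => f x * h x).
Proof. by move=> bf; exact: bmM. Qed.

Lemma eq_wint f g : f =1 g -> wint h f = wint h g.
Proof. by move=> /funext ->. Qed.

Lemma wintD f g : bm f -> bm g ->
  wint h (fun x => f x + g x) = wint h f + wint h g.
Proof.
move=> bf bg; rewrite /wint -RintegralD//; try exact/bm_integrable/bmw.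
by apply: eq_Rintegral => x _; rewrite mulrDl.
Qed.

Lemma wintZ c f : bm f -> wint h (fun x => c * f x) = c * wint h f.
Proof.
move=> bf; rewrite /wint -RintegralZl//; last exact/bm_integrable/bmw.
by apply: eq_Rintegral => x _; rewrite mulrA.
Qed.

Lemma wintN f : bm f -> wint h (fun x => - f x) = - wint h f.
Proof.
move=> bf; rewrite -mulN1r -wintZ//.
by apply: eq_wint => x; rewrite mulN1r.
Qed.

Lemma wint_ge0 f : (forall x, 0 <= f x) -> 0 <= wint h f.
Proof. by move=> f0; apply: Rintegral_ge0 => x _; rewrite mulr_ge0. Qed.

Lemma le_wint f g : bm f -> bm g -> (forall x, f x <= g x) ->
  wint h f <= wint h g.
Proof.
move=> bf bg fg; apply: le_Rintegral => //; try exact/bm_integrable/bmw.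
by move=> x _; rewrite ler_wpM2r.
Qed.

(** The Wolff potential is bounded on the support only, so the bounds drawn from it hold almost
    everywhere and are integrated in this form. *)
Lemma le_wint_ae f g : bm f -> bm g -> (forall x, 0 <= f x) ->
  (forall x, 0 <= g x) -> {ae mu, forall x, f x <= g x} ->
  wint h f <= wint h g.
Proof.
move=> bf bg f0 g0 fg; have [mf _] := bmw bf; have [mg _] := bmw bg.
rewrite /wint /Rintegral fine_le//.
- exact: (integrable_fin_num measurableT (bm_integrable mu (bmw bf))).
- exact: (integrable_fin_num measurableT (bm_integrable mu (bmw bg))).
apply: ae_ge0_le_integral => //.
- by move=> x _; rewrite lee_fin mulr_ge0.
- exact/measurable_EFinP.
- by move=> x _; rewrite lee_fin mulr_ge0.
- exact/measurable_EFinP.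
- by apply: filterS fg => x /= fx _; rewrite lee_fin ler_wpM2r.
Qed.

Lemma le_norm_wint f : bm f -> `|wint h f| <= wint h (fun x => `|f x|).
Proof.
move=> bf; rewrite /wint.
apply: (le_trans (le_normr_Rintegral measurableT (bm_integrable _ (bmw bf)))).
rewrite le_eqVlt; apply/orP; left; apply/eqP.
by apply: eq_Rintegral => x _; rewrite normrM (ger0_norm (h0 x)).
Qed.

Lemma bm_wint d' (T' : measurableType d') (F : T' -> T -> R) :
  bm2 F -> bm (fun x => wint h (F x)).
Proof.
move=> bF; apply: bm_Rintegral; apply: bmM => //.
by apply: (bm_comp bh); msr.
Qed.

Lemma wint_swap (F : T -> T -> R) : bm2 F ->
  wint h (fun x => wint h (F x)) = wint h (fun y => wint h (fun x => F x y)).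
Proof.
move=> bF; have bFx x : bm (F x).
  by apply: (bm2_comp (g1 := fun=> x) (g2 := id) bF); msr.
have bFy y : bm (fun x => F x y).
  by apply: (bm2_comp (g2 := fun=> y) (g1 := id) bF); msr.
transitivity (\int[mu]_x \int[mu]_y (F x y * h y * h x)).
  apply: eq_Rintegral => x _; rewrite /wint RintegralZr//.
  exact/bm_integrable/bmw.
rewrite Rintegral_swap; last first.
  by do 2?[apply: bmM => //]; apply: (bm_comp bh); msr.
apply: eq_Rintegral => y _.
rewrite /wint -RintegralZr//; last exact/bm_integrable/bmw.
by apply: eq_Rintegral => x _; rewrite mulrAC.
Qed.

Lemma wint_weight f : wint h f = wint (fun=> 1) (fun x => f x * h x).
Proof. by rewrite /wint; apply: eq_Rintegral => x _; rewrite mulr1. Qed.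

Lemma wint_indic (A : set T) : measurable A ->
  wint (fun=> 1) (\1_A) = fine (mu A).
Proof.
move=> mA; rewrite /wint /Rintegral; congr fine.
by under eq_integral do rewrite mulr1; rewrite integral_indic// setIT.
Qed.

Lemma wintE f : wint (fun=> 1) f = \int[mu]_x f x.
Proof. by apply: eq_Rintegral => x _; rewrite mulr1. Qed.

End WeightedIntegral.

Global Opaque wint.

Ltac bmt := cbv beta; lazymatch goal with
  | |- bm2 _ => rewrite /bm2; bmt
  | |- bm3 _ => rewrite /bm3; bmt
  | |- bm (fun _ => ?c) => exact: (bm_cst _ c)
  | |- bm (fun x => @?f x * @?g x) => apply: (@bmM _ _ _ f g); bmt
  | |- bm (fun x => @?f x + @?g x) => apply: (@bmD _ _ _ f g); bmt
  | |- bm (fun x => - @?f x) => apply: (@bmN _ _ _ f); bmt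
  | |- bm (fun x => @?f x ^+ ?n) => apply: (@bmX _ _ _ f n); bmt
  | |- bm (fun x => `|@?f x|) => apply: (@bm_norm _ _ _ f); bmt
  | |- bm (fun x => Num.max (@?f x) (@?g x)) => apply: (@bm_max _ _ _ f g); bmt
  | |- bm (fun x => wint _ _ (@?g x)) =>
      apply: (@bm_wint _ _ _ _ _ _ _ _ g); [bmt | rewrite /bm2; bmt]
  | |- _ => first
    [ match goal with H : bm ?f |- bm ?f => exact H end
    | match goal with H : bm2 ?k |- bm (?k ?a) =>
        apply: (bm2_comp (g1 := fun=> a) (g2 := id) H); msr end
    | match goal with H : bm3 ?k |- bm (?k ?a ?b) =>
        apply: (bm3_comp (g1 := fun=> a) (g2 := fun=> b) (g3 := id) H); msr end
    | match goal with H : bm2 ?k |- bm (fun x => ?k (@?a x) (@?b x)) =>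
        apply: (bm2_comp H); msr end
    | match goal with H : bm3 ?k |- bm (fun x => ?k (@?a x) (@?b x) (@?c x)) =>
        apply: (bm3_comp H); msr end
    | match goal with H : bm ?f |- bm (fun x => ?f (@?a x)) =>
        apply: (bm_comp H); msr end
    | match goal with H : forall a, _ -> bm _ |- _ => solve [apply: H; bmt] end
    | match goal with H : forall a, bm _ |- _ => exact: H end
    | assumption ] end.

Lemma bm2l (R : realType) d1 d2 (T1 : measurableType d1) (T2 : measurableType d2)
  (F : T1 -> T2 -> R) x : bm2 F -> bm (F x).
Proof. by move=> bF; apply: (bm2_comp (g1 := fun=> x) (g2 := id) bF); msr. Qed.

(** For the two real components of the Cauchy kernel [1 / (y - x)] these sums add up to half the
    squared Menger curvature of the triangle [x], [y], [z]. *)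
Definition ksym (R : realType) (T : Type) (k : T -> T -> R) (x y z : T) : R :=
  k x y * k x z + k y x * k y z + k z x * k z y.

(** * Antisymmetric kernels: from Cotlar's identity to the L^2 bound *)

Section AntisymmetricKernel.
Context (R : realType) d (T : measurableType d).
Variable mu : {finite_measure set T -> \bar R}.

Definition kop (k : T -> T -> R) (h f : T -> R) (x : T) : R :=
  wint mu h (fun y => k x y * f y).

Context (k : T -> T -> R) (h : T -> R).
Hypothesis bk : bm2 k.
Hypothesis ak : forall x y, k x y = - k y x.
Hypothesis bh : bm h.

Local Notation I := (wint mu h).
Local Notation K := (kop k h).
Local Notation S := (ksym k).

Lemma bm_kop f : bm f -> bm (K f).
Proof. by move=> bf; rewrite /kop; bmt. Qed.

Lemma kop_skew f g : bm f -> bm g ->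
  I (fun x => K f x * g x) = - I (fun x => f x * K g x).
Proof.
move=> bf bg; have bK := bm_kop.
transitivity (I (fun x => I (fun y => k x y * f y * g x))).
  apply: eq_wint => x; rewrite /kop mulrC -wintZ//; last by bmt.
  by apply: eq_wint => y; ring.
rewrite wint_swap//; last by rewrite /bm2; bmt.
rewrite -wintN//; last by bmt.
apply: eq_wint => y; rewrite /kop -mulNr -wintZ//; last by bmt.
by apply: eq_wint => x; rewrite (ak x y); ring.
Qed.

(* Cotlar's identity for an antisymmetric kernel. *)
Lemma kop_sqr f x : bm f ->
  K f x ^+ 2 = 2 * K (fun y => f y * K f y) x +
    I (fun y => I (fun z => S x y z * (f y * f z))).
Proof.
move=> bf; have bK := bm_kop.
have E y : I (fun z => S x y z * (f y * f z)) =
   (K f x * (k x y * f y) + - (k x y * (f y * K f y))) +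
   I (fun z => k z x * k z y * f y * f z).
  have -> : I (fun z => S x y z * (f y * f z)) =
    I (fun z => ((k x y * f y) * (k x z * f z) +
                 (k y x * f y) * (k y z * f z)) +
                 k z x * k z y * f y * f z).
    by apply: eq_wint => z; rewrite /ksym; ring.
  rewrite wintD//; [|by bmt|by bmt]; congr (_ + _).
  rewrite wintD//; [|by bmt|by bmt].
  rewrite !wintZ//; [|by bmt|by bmt]; rewrite -!/(kop _ _ _ _) (ak y x).
  by ring.
have -> : I (fun y => I (fun z => S x y z * (f y * f z))) =
  K f x ^+ 2 - K (fun y => f y * K f y) x
  + I (fun y => I (fun z => k z x * k z y * f y * f z)).
  rewrite (eq_wint mu h E) wintD//; [|by bmt|by bmt]; congr (_ + _).
  rewrite wintD//; [|by bmt|by bmt].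
  by rewrite wintZ//; [rewrite wintN//; bmt|by bmt].
(* The third product is centred at [z]: with [z] outermost the integral in [y] is [K f z], and
   skewness turns [k z x] into [- k x z]. *)
rewrite wint_swap//; last by rewrite /bm2; bmt.
have -> : I (fun z => I (fun y => k z x * k z y * f y * f z)) =
    - K (fun y => f y * K f y) x.
  rewrite /kop -wintN//; last by bmt.
  apply: eq_wint => z.
  have -> : (fun y => k z x * k z y * f y * f z) =
    fun y => (k z x * f z) * (k z y * f y) by apply/funext => y; ring.
  by rewrite wintZ; [rewrite -/(kop _ _ _ _) (ak z x); ring|bmt|bmt].
by ring.
Qed.

End AntisymmetricKernel.

(** * Row and column sums of a nonnegative kernel *)

Section RowColumnSums.
Context (R : realType) d (T : measurableType d).
Variable mu : {finite_measure set T -> \bar R}.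
Context (h : T -> R) (kap : T -> T -> R) (D M : R).
Hypothesis bh : bm h.
Hypothesis h0 : forall x, 0 <= h x.
Hypothesis bkap : bm2 kap.
Hypothesis kap0 : forall y x, 0 <= kap y x.
Hypothesis D0 : 0 <= D.
Hypothesis M0 : 0 <= M.

Local Notation I := (wint mu h).
Local Notation V := (fun x => I (fun y => kap x y)).
Local Notation W := (fun x => I (fun y => kap y x)).

Hypothesis VM : {ae mu, forall x, I (fun y => kap x y) <= M}.
Hypothesis kap_doubling : forall x y y',
  kap y' x <= D * kap y' y \/ kap y x <= D * kap y y'.

Let ID := @wintD R d T mu h bh.
Let IZ := @wintZ R d T mu h bh.
Let Isw := @wint_swap R d T mu h bh.
Let Ile := @le_wint R d T mu h bh h0.
Let Ile_ae := @le_wint_ae R d T mu h bh h0.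

Let V0 x : 0 <= V x. Proof. exact: wint_ge0. Qed.
Let W0 x : 0 <= W x. Proof. exact: wint_ge0. Qed.

Lemma row_sum_le : I V <= M * I (fun=> 1).
Proof.
rewrite -IZ; last by bmt.
apply: Ile_ae; [by bmt|by bmt|exact: V0| |].
- by move=> x; rewrite mulr1; exact: M0.
- by apply: filterS VM => x; rewrite mulr1.
Qed.

Lemma row_sum_sqr_le : I (fun x => V x ^+ 2) <= M ^+ 2 * I (fun=> 1).
Proof.
apply: (@le_trans _ _ (I (fun x => M * V x))).
  apply: Ile_ae; [by bmt|by bmt| | |].
  - move=> x; exact: sqr_ge0.
  - move=> x; apply: mulr_ge0; [exact: M0|exact: V0].
  - apply: filterS VM => x VMx; rewrite expr2.
    by apply: ler_wpM2r; [exact: V0|exact: VMx].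
rewrite IZ; last by bmt.
by rewrite expr2 -mulrA; apply: ler_wpM2l; [exact: M0|exact: row_sum_le].
Qed.

Lemma column_sum : I W = I V.
Proof. by rewrite Isw; [|by bmt]. Qed.

(* The nearer of [y], [y'] to [x] may be exchanged with [x] in the other factor. *)
Let W_sqr x : W x ^+ 2 <= 2 * D * I (fun y => kap y x * W y).
Proof.
have -> : W x ^+ 2 = I (fun y => I (fun y' => kap y x * kap y' x)).
  rewrite expr2 -IZ; last by bmt.
  by apply: eq_wint => y; rewrite mulrC -IZ; [|bmt].
have -> : 2 * D * I (fun y => kap y x * W y) =
  I (fun y => I (fun y' => D * (kap y x * kap y' y + kap y' x * kap y y'))).
  have e y : I (fun y' => D * (kap y x * kap y' y + kap y' x * kap y y')) =
     D * (kap y x * W y) + D * I (fun y' => kap y' x * kap y y').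
    rewrite IZ; last by bmt.
    rewrite ID; [|by bmt|by bmt]; rewrite mulrDr; congr (_ * _ + _).
    by rewrite IZ; [|bmt].
  rewrite (eq_wint mu h e) ID; [|by bmt|by bmt].
  rewrite !IZ; [|by bmt|by bmt]; rewrite [X in _ = _ + _ * X]Isw; last by bmt.
  have -> : I (fun y => I (fun z => kap y x * kap z y)) = I (fun y => kap y x * W y).
    by apply: eq_wint => y; rewrite IZ; [|bmt].
  by ring.
apply: Ile; [by bmt|by bmt|move=> y].
apply: Ile; [by bmt|by bmt|move=> y'].
case: (kap_doubling x y y') => le.
- apply: (@le_trans _ _ (D * (kap y x * kap y' y))).
    by rewrite mulrCA; apply: ler_wpM2l; [exact: kap0|exact: le].
  apply: ler_wpM2l; first exact: D0.
  by rewrite lerDl; apply: mulr_ge0; exact: kap0.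
- apply: (@le_trans _ _ (D * (kap y' x * kap y y'))).
    by rewrite mulrCA mulrC; apply: ler_wpM2l; [exact: kap0|exact: le].
  apply: ler_wpM2l; first exact: D0.
  by rewrite lerDr; apply: mulr_ge0; exact: kap0.
Qed.

(** Integrating [W_sqr] in [x] and swapping leaves [2 D] times the integral of [W y * V y]. The row
    bound [V <= M] takes out one factor [M], and the integral of [W], equal to that of [V], gives
    the other. *)
Lemma column_sum_sqr_le :
  I (fun x => W x ^+ 2) <= 2 * D * M ^+ 2 * I (fun=> 1).
Proof.
apply: (@le_trans _ _ (2 * D * (M * I W))); last first.
  rewrite column_sum -[leRHS]mulrA; apply: ler_wpM2l; first exact: mulr_ge0.
  by rewrite expr2 -mulrA; apply: ler_wpM2l; [exact: M0|exact: row_sum_le].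
apply: (@le_trans _ _ (I (fun x => 2 * D * I (fun y => kap y x * W y)))).
  by apply: Ile; [by bmt|by bmt|exact: W_sqr].
rewrite IZ; last by bmt.
apply: ler_wpM2l; first exact: mulr_ge0.
rewrite Isw; last by bmt.
rewrite -IZ; last by bmt.
apply: Ile_ae; [by bmt|by bmt| | |].
- move=> y; apply: wint_ge0; first exact: h0.
  by move=> x; apply: mulr_ge0; [exact: kap0|exact: W0].
- by move=> y; apply: mulr_ge0; [exact: M0|exact: W0].
- apply: filterS VM => y VMy.
  have -> : I (fun x => kap y x * W y) = W y * V y.
    by rewrite -IZ; [apply: eq_wint => x; rewrite mulrC | bmt].
  by rewrite mulrC; apply: ler_wpM2r; [exact: W0|exact: VMy].
Qed.

End RowColumnSums.

(** * Fourth moment of the operator applied to the constant *)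

Section FourthMoment.
Context (R : realType) d (T : measurableType d).
Variable mu : {finite_measure set T -> \bar R}.
Context (k : T -> T -> R) (h : T -> R) (Q : T -> T -> T -> R).
Hypothesis bk : bm2 k.
Hypothesis ak : forall x y, k x y = - k y x.
Hypothesis bh : bm h.
Hypothesis h0 : forall x, 0 <= h x.
Hypothesis bQ : bm3 Q.
Hypothesis Q0 : forall x y z, 0 <= Q x y z.
Hypothesis Qswap12 : forall x y z, Q x y z = Q y x z.
Hypothesis Qswap23 : forall x y z, Q x y z = Q x z y.
Hypothesis kQ : forall x y z, `|ksym k x y z| <= Q x y z.

Local Notation I := (wint mu h).
Local Notation K := (kop mu k h).
Local Notation S := (ksym k).
Local Notation E := (fun x => I (fun y => I (fun z => Q x y z))).

Let ID := @wintD R d T mu h bh.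
Let IZ := @wintZ R d T mu h bh.
Let IN := @wintN R d T mu h bh.
Let Isw := @wint_swap R d T mu h bh.
Let Ile := @le_wint R d T mu h bh h0.

Let bS : bm3 S. Proof. by rewrite /ksym; bmt. Qed.

Let E0 x : 0 <= E x.
Proof. by apply: wint_ge0 => [//|y]; apply: wint_ge0 => [//|z]; exact: Q0. Qed.

(** By [|S| <= Q] and [|u y * u z| <= (u y^2 + u z^2) / 2]. The symmetry of [Q] makes the two halves
    equal, and then carries the square to the outermost variable. *)
Lemma ksym_form_le u : bm u ->
  I (fun x => I (fun y => I (fun z => S x y z * (u y * u z)))) <=
  I (fun x => u x ^+ 2 * E x).
Proof.
move=> bu.
apply: (@le_trans _ _
    (I (fun x => I (fun y => u y ^+ 2 * I (fun z => Q x y z))))).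
  apply: Ile; [by bmt|by bmt|move=> x].
  have e1 : I (fun y => u y ^+ 2 * I (fun z => Q x y z)) =
      I (fun y => I (fun z => u y ^+ 2 * Q x y z)).
    by apply: eq_wint => y; rewrite IZ; [|bmt].
  have e2 : I (fun y => u y ^+ 2 * I (fun z => Q x y z)) =
      I (fun y => I (fun z => u z ^+ 2 * Q x y z)).
    rewrite e1 Isw; last by bmt.
    by apply: eq_wint => y; apply: eq_wint => z; rewrite Qswap23.
  have -> : I (fun y => u y ^+ 2 * I (fun z => Q x y z)) =
      I (fun y => I (fun z => 2^-1 * (u y ^+ 2 * Q x y z + u z ^+ 2 * Q x y z))).
    rewrite [LHS](_ : _ = 2^-1 * (I (fun y => u y ^+ 2 * I (fun z => Q x y z)) +
      I (fun y => u y ^+ 2 * I (fun z => Q x y z)))); last by field.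
    rewrite {1}e1 e2 -ID; [|by bmt|by bmt].
    rewrite -IZ; last by bmt.
    apply: eq_wint => y; rewrite [RHS]IZ; last by bmt.
    by rewrite ID; [|by bmt|by bmt].
  apply: Ile; [by bmt|by bmt|move=> y].
  apply: Ile; [by bmt|by bmt|move=> z].
  apply: (le_trans (ler_norm _)); rewrite normrM.
  apply: (@le_trans _ _ (Q x y z * `|u y * u z|)).
    by apply: ler_wpM2r; [exact: normr_ge0|exact: kQ].
  rewrite [leRHS](_ : _ = Q x y z * (2^-1 * (u y ^+ 2 + u z ^+ 2))); last by ring.
  apply: ler_wpM2l; first exact: Q0.
  rewrite normrM -(real_normK (num_real (u y))).
  rewrite -(real_normK (num_real (u z))).
  by have := sqr_ge0 (`|u y| - `|u z|); nra.
rewrite Isw; last by bmt.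
apply: Ile; [by bmt|by bmt|move=> y].
rewrite IZ; last by bmt.
apply: ler_wpM2l; first exact: sqr_ge0.
rewrite le_eqVlt; apply/orP; left; apply/eqP.
by apply: eq_wint => x; apply: eq_wint => z; exact: Qswap12.
Qed.

(* With [u = K 1] and [e] the symmetrization error, Cotlar's identity reads
   [u^2 = 2 K u + e]; integrating the identity for [f = u] and using skewness
   turns it into [5/4 |u|_4^4 + 1/4 |e|_2^2 = 3/2 <u^2, e> + <S u, u>]. *)
Lemma kop1_fourth_moment :
  I (fun x => K (fun=> 1) x ^+ 4) <= 4 * I (fun x => E x ^+ 2).
Proof.
have b1 : bm (fun _ : T => 1 : R) by exact: bm_cst.
have bK f : bm f -> bm (K f) by exact: bm_kop.
pose u := K (fun=> 1); have bu : bm u by exact: bK.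
pose e x := I (fun y => I (fun z => S x y z * (1 * 1))).
have be : bm e by rewrite /e; bmt.
have Ku x : K u x = (u x ^+ 2 - e x) / 2.
  have := kop_sqr mu bk ak bh x b1; rewrite -/(e x) -/(u x).
  have -> : (fun y => 1 * K (fun=> 1) y) = u.
    by apply/funext => y; rewrite mul1r.
  by move=> ->; field.
have e_le x : `|e x| <= E x.
  apply: (le_trans (le_norm_wint _ bh h0 _)); first by bmt.
  apply: Ile; [by bmt|by bmt|move=> y].
  apply: (le_trans (le_norm_wint _ bh h0 _)); first by bmt.
  apply: Ile; [by bmt|by bmt|move=> z].
  by rewrite !mulr1; exact: kQ.
have bKu : bm (K u) by exact: bK.
have Su := kop_sqr mu bk ak bh _ bu.
have ISu := ksym_form_le bu.
have skew := kop_skew mu bk ak bh.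
have Ku1 : K (fun=> 1) = u by [].
rewrite Ku1; move: Ku1; clearbody e u => Ku1.
pose a := I (fun x => u x ^+ 4).
pose b := I (fun x => u x ^+ 2 * e x).
pose g := I (fun x => e x ^+ 2).
have g0 : 0 <= g by apply: wint_ge0 => [//|x]; exact: sqr_ge0.
have eq1 : I (fun x => K u x ^+ 2) = (a - 2 * b + g) / 4.
  have -> : (fun x => K u x ^+ 2) = (fun x =>
      4^-1 * (u x ^+ 4 + (- (2 * (u x ^+ 2 * e x)) + e x ^+ 2))).
    by apply/funext => x; rewrite Ku; field.
  rewrite IZ; last by bmt.
  rewrite !ID; [|by bmt..]; rewrite IN; last by bmt.
  by rewrite IZ; [rewrite -/a -/b -/g; field|bmt].
have eq2 : I (fun x => u x * (u x * K u x)) = (a - b) / 2.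
  have -> : (fun x => u x * (u x * K u x)) = (fun x =>
      2^-1 * (u x ^+ 4 + - (u x ^+ 2 * e x))).
    by apply/funext => x; rewrite Ku; field.
  rewrite IZ; last by bmt.
  by rewrite !ID; [|by bmt..]; rewrite IN; [rewrite -/a -/b; field|bmt].
pose s' := I (fun x => I (fun y => I (fun z => S x y z * (u y * u z)))).
have eq3 : I (fun x => K u x ^+ 2) =
    - (2 * I (fun x => u x * (u x * K u x))) + s'.
  have bKK : bm (K (fun y => u y * K u y)) by apply: bK; bmt.
  rewrite (eq_wint mu h Su) ID; [|by bmt|by bmt].
  rewrite IZ; last by bmt.
  congr (_ + _); rewrite -mulrN; congr (_ * _).
  transitivity (I (fun x => K (fun y => u y * K u y) x * 1)).
    by apply: eq_wint => x; rewrite mulr1.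
  rewrite skew; [|by bmt|by bmt].
  have -> : I (fun x => u x * K u x * K (fun=> 1) x) =
     I (fun x => u x * (u x * K u x))
    by rewrite Ku1; apply: eq_wint => x; ring.
  by [].
pose s := I (fun x => u x ^+ 2 * E x).
have bs : b <= s.
  apply: Ile; [by bmt|by bmt|move=> x].
  by apply: ler_wpM2l; [exact: sqr_ge0|exact: le_trans (ler_norm _) (e_le x)].
have sE : s <= 4^-1 * a + I (fun x => E x ^+ 2).
  rewrite -IZ; last by bmt.
  rewrite -ID; [|by bmt|by bmt].
  apply: Ile; [by bmt|by bmt|move=> x].
  by have := sqr_ge0 (u x ^+ 2 / 2 - E x); nra.
have s0 : 0 <= s.
  by apply: wint_ge0 => [//|x]; apply: mulr_ge0; [exact: sqr_ge0|exact: E0].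
(* From [b <= s] and [s' <= s] the identity gives [5/4 a <= 5/2 s]. The weight [1/4] in [sE] leaves
   [5/8 a] on the left against [5/2] times the integral of [E^2], whence the constant [4]. *)
move: eq3; rewrite eq1 eq2; move: ISu bs sE g0 s0; rewrite -/a -/s -/s'.
lra.
Qed.

End FourthMoment.

(** * The bilinear form between two heights *)

Section Interpolation.
Context (R : realType) d (T : measurableType d).
Variable mu : {finite_measure set T -> \bar R}.
Context (k : T -> T -> R) (L : R).
Hypothesis bk : bm2 k.
Hypothesis ak : forall x y, k x y = - k y x.
Hypothesis L0 : 0 < L.

Let one := fun _ : T => 1 : R.
Let b1 : bm one. Proof. exact: bm_cst. Qed.
Let one0 x : 0 <= one x. Proof. exact: ler01. Qed.

Local Notation I := (wint mu one).
Local Notation K := (kop mu k one).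

Hypothesis fourth : forall h, bm h -> (forall x, 0 <= h x <= 1) ->
  I (fun x => K h x ^+ 4 * h x) <= L ^+ 4 * I h.

Let ID := @wintD R d T mu one b1.
Let IZ := @wintZ R d T mu one b1.
Let IN := @wintN R d T mu one b1.
Let Ile := @le_wint R d T mu one b1 one0.
Let Iabs := @le_norm_wint R d T mu one b1 one0.
Let bK := @bm_kop R d T mu k one bk b1.

Let KD f g x : bm f -> bm g -> K (fun y => f y + g y) x = K f x + K g x.
Proof.
move=> bf bg; rewrite /kop -ID; [|by bmt|by bmt].
by apply: eq_wint => y; rewrite mulrDr.
Qed.

Let KZ c f x : bm f -> K (fun y => c * f y) x = c * K f x.
Proof.
move=> bf; rewrite /kop -IZ; last by bmt.
by apply: eq_wint => y; rewrite mulrCA.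
Qed.

Lemma wint_sum n (F : 'I_n -> T -> R) : (forall i, bm (F i)) ->
  I (fun x => \sum_(i < n) F i x) = \sum_(i < n) I (F i).
Proof.
move=> bF; elim: n F bF => [|n IH] F bF.
  rewrite big_ord0 -[RHS](mul0r (I one)) -IZ//.
  by apply: eq_wint => x; rewrite big_ord0 mul0r.
rewrite big_ord_recl -IH//.
rewrite -ID.
- by apply: eq_wint => x; rewrite big_ord_recl.
- exact: bF.
- elim: {IH} n F bF => [|n IH] F bF.
    rewrite (_ : (fun x => _) = fun=> 0); first exact: bm_cst.
    by apply/funext => x; rewrite big_ord0.
  rewrite (_ : (fun x => _) = fun x => F (lift ord0 ord0) x +
      \sum_(i < n) F (lift ord0 (lift ord0 i)) x); last first.
    by apply/funext => x; rewrite big_ord_recl.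
  apply: bmD; first exact: bF.
  exact: (IH (fun i => F (lift ord0 i))).
Qed.

Lemma bm_sum n (F : 'I_n -> T -> R) : (forall i, bm (F i)) ->
  bm (fun x => \sum_(i < n) F i x).
Proof.
elim: n F => [|n IH] F bF.
  rewrite (_ : (fun x => _) = fun=> 0); first exact: bm_cst.
  by apply/funext => x; rewrite big_ord0.
rewrite (_ : (fun x => _) = fun x => F ord0 x + \sum_(i < n) F (lift ord0 i) x).
  by apply: bmD => //; exact: IH.
by apply/funext => x; rewrite big_ord_recl.
Qed.

Let quartic (a b : R) : (a + b) ^+ 4 <= 8 * a ^+ 4 + 8 * b ^+ 4.
Proof.
have h1 : (a + b) ^+ 2 <= 2 * (a ^+ 2 + b ^+ 2).
  by have := sqr_ge0 (a - b); nra.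
have h2 : (a ^+ 2 + b ^+ 2) ^+ 2 <= 2 * (a ^+ 4 + b ^+ 4).
  have := sqr_ge0 (a ^+ 2 - b ^+ 2); nra.
have h3 : ((a + b) ^+ 2) ^+ 2 <= (2 * (a ^+ 2 + b ^+ 2)) ^+ 2.
  by rewrite lerXn2r ?nnegrE ?sqr_ge0// mulr_ge0// addr_ge0// sqr_ge0.
rewrite -exprM exprMn in h3; nra.
Qed.

Let X4_ge0 (a : R) : 0 <= a ^+ 4.
Proof. by rewrite (exprM a 2 2) sqr_ge0. Qed.

(** The hypothesis is used for [g] and for the midpoint [s] of [f] and [g]: [K f = 2 K s - K g],
    while [g <= 2 s] lets [g] be replaced as a weight on [(K s)^4]. The midpoint contributes
    [8 * 16 * 2 / 2 = 128] and [g] contributes [8], hence [136]. *)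
Let polarized f g : bm f -> bm g ->
  (forall x, 0 <= f x <= 1) -> (forall x, 0 <= g x <= 1) ->
  I (fun x => K f x ^+ 4 * g x) <= 136 * L ^+ 4 * (I f + I g).
Proof.
move=> bf bg f01 g01.
pose s x := 2^-1 * (f x + g x); have bs : bm s by rewrite /s; bmt.
have s01 x : 0 <= s x <= 1 by rewrite /s; have := f01 x; have := g01 x; lra.
have bKf : bm (K f) by exact: bK.
have bKg : bm (K g) by exact: bK.
have bKs : bm (K s) by exact: bK.
have hs := fourth bs s01; have hg := fourth bg g01.
have Is : I s = 2^-1 * (I f + I g).
  by rewrite IZ; [rewrite ID; [|bmt|bmt]|bmt].
have Ks x : K f x = 2 * K s x + - K g x.
  rewrite /s KZ; last by bmt.
  by rewrite KD//; field.
apply: (@le_trans _ _ (I (fun x => 256 * (K s x ^+ 4 * s x) + 8 * (K g x ^+ 4 * g x)))).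
  apply: Ile; [by bmt|by bmt|move=> x].
  rewrite Ks; have := quartic (2 * K s x) (- K g x).
  rewrite exprMn (_ : (- K g x) ^+ 4 = K g x ^+ 4); last by ring.
  have gs : g x <= 2 * s x by rewrite /s; have := f01 x; lra.
  have g0 : 0 <= g x by have := g01 x; lra.
  move=> q; have := ler_wpM2r g0 q.
  have := ler_wpM2l (X4_ge0 (K s x)) gs; lra.
rewrite ID; [|by bmt|by bmt]; rewrite !IZ; [|by bmt|by bmt].
have If : 0 <= I f by apply: wint_ge0 => [//|x]; have := f01 x; lra.
have L4 := X4_ge0 L.
move: hs hg; rewrite Is => hs hg.
have := mulr_ge0 L4 If; lra.
Qed.

Let scaled f g a b : bm f -> bm g -> 0 < a -> 0 < b ->
  (forall x, 0 <= f x <= a) -> (forall x, 0 <= g x <= b) ->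
  I (fun x => K f x ^+ 4 * g x) <=
  136 * L ^+ 4 * (a ^+ 3 * b * I f + a ^+ 4 * I g).
Proof.
move=> bf bg a0 b0 f0 g0.
have bKf : bm (K f) by exact: bK.
have := @polarized (fun x => a^-1 * f x) (fun x => b^-1 * g x).
have {}f0 x : 0 <= a^-1 * f x <= 1.
  have /andP[fx fx'] := f0 x; apply/andP; split.
    by rewrite mulr_ge0// invr_ge0 ltW.
  by rewrite mulrC ler_pdivrMr// mul1r.
have {}g0 x : 0 <= b^-1 * g x <= 1.
  have /andP[gx gx'] := g0 x; apply/andP; split.
    by rewrite mulr_ge0// invr_ge0 ltW.
  by rewrite mulrC ler_pdivrMr// mul1r.
move=> /(_ _ _ f0 g0); rewrite !IZ; [|by bmt|by bmt].
have -> : (fun x => K (fun y => a^-1 * f y) x ^+ 4 * (b^-1 * g x)) =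
    fun x => (a ^- 4 * b^-1) * (K f x ^+ 4 * g x).
  by apply/funext => x; rewrite KZ// exprMn exprVn; ring.
rewrite IZ; last by bmt.
move=> /(_ ltac:(bmt) ltac:(bmt)) le.
have ab : 0 < a ^+ 4 * b by rewrite mulr_gt0// exprn_gt0.
have := ler_wpM2l (ltW ab) le.
have a0' : a != 0 by rewrite gt_eqF.
have b0' : b != 0 by rewrite gt_eqF.
rewrite [leLHS](_ : _ = I (fun x => K f x ^+ 4 * g x)); last by field; lra.
rewrite [leRHS](_ : _ = 136 * L ^+ 4 * (a ^+ 3 * b * I f + a ^+ 4 * I g)) //.
by field; lra.
Qed.

(** Positive and negative parts are treated separately, at the price of the factor [8] of [quartic];
    the mass of [g] is then counted twice, so [2176 = 2 * 8 * 136]. *)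
Let signed f g a b : bm f -> bm g -> 0 < a -> 0 < b ->
  (forall x, `|f x| <= a) -> (forall x, 0 <= g x <= b) ->
  I (fun x => K f x ^+ 4 * g x) <=
  2176 * L ^+ 4 * (a ^+ 3 * b * I (fun x => `|f x|) + a ^+ 4 * I g).
Proof.
move=> bf bg a0 b0 fa g0.
have [p [n [bp bn pn]]] : exists p n, [/\ bm p, bm n & forall x,
    [/\ 0 <= p x <= a, 0 <= n x <= a, f x = p x + (-1) * n x & `|f x| = p x + n x]].
  exists (fun x => 2^-1 * (`|f x| + f x)), (fun x => 2^-1 * (`|f x| + - f x)).
  split; [by bmt|by bmt|move=> x].
  have := fa x; have := ler_norm (f x); have := ler_norm (- f x).
  by rewrite normrN => h1 h2 h3; split; lra.
have g1 x : 0 <= g x by have /andP[] := g0 x.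
have Ipn : I (fun x => `|f x|) = I p + I n.
  by rewrite -ID//; apply: eq_wint => x; have [] := pn x.
have KE x : K f x = K p x + (-1) * K n x.
  rewrite -KZ// -KD//; last by bmt.
  by congr kop; apply/funext => y; have [] := pn y.
have Ip : 0 <= I p by apply: wint_ge0 => [//|x]; have [/andP[]] := pn x.
have In : 0 <= I n by apply: wint_ge0 => [//|x]; have [_ /andP[]] := pn x.
have Ig : 0 <= I g by exact: wint_ge0.
have hp := scaled bp bg a0 b0 (fun x => let: And4 h _ _ _ := pn x in h) g0.
have hn := scaled bn bg a0 b0 (fun x => let: And4 _ h _ _ := pn x in h) g0.
have bKf : bm (K f) by exact: bK.
have bKp : bm (K p) by exact: bK.
have bKn : bm (K n) by exact: bK.
apply: (@le_trans _ _ (I (fun x => 8 * (K p x ^+ 4 * g x) + 8 * (K n x ^+ 4 * g x)))).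
  apply: Ile; [by bmt|by bmt|move=> x].
  rewrite KE [leRHS](_ : _ = (8 * K p x ^+ 4 + 8 * K n x ^+ 4) * g x); last by ring.
  apply: ler_wpM2r; first exact: g1.
  have e4 : ((-1) * K n x) ^+ 4 = K n x ^+ 4 by ring.
  by have := quartic (K p x) ((-1) * K n x); rewrite e4.
rewrite ID; [|by bmt|by bmt]; rewrite !IZ; [|by bmt|by bmt].
rewrite Ipn; move: hp hn Ip In Ig.
move: (I (fun x => K p x ^+ 4 * g x)) (I (fun x => K n x ^+ 4 * g x)) => X Y.
move: (I p) (I n) (I g) => F F' G hp hn F0 F0' G0.
have c0 : 0 <= L ^+ 4 * (a ^+ 3 * b) by rewrite !mulr_ge0 ?exprn_ge0 ?ltW.
have c1 : 0 <= L ^+ 4 * a ^+ 4 by exact: mulr_ge0.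
have := mulr_ge0 c0 F0; have := mulr_ge0 c0 F0'; have := mulr_ge0 c1 G0.
lra.
Qed.

(* Young's inequality with the parameter [L a b] balances the two terms. *)
Lemma kop_level_le f g a b : bm f -> bm g -> 0 < a -> a <= b ->
  (forall x, `|f x| <= a ^+ 2) -> (forall x, `|g x| <= b ^+ 2) ->
  `|I (fun x => K f x * g x)| <= 2176 * L * (a / b) *
    (a ^+ 2 * I (fun x => `|f x|) + b ^+ 2 * I (fun x => `|g x|)).
Proof.
move=> bf bg a0 ab fa gb.
have b0 : 0 < b by exact: lt_le_trans ab.
have bKf : bm (K f) by exact: bK.
pose t := L * a * b; have t0 : 0 < t by rewrite !mulr_gt0.
pose F := I (fun x => `|f x|); pose G := I (fun x => `|g x|).
have F0 : 0 <= F by apply: wint_ge0 => [//|x]; exact: normr_ge0.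
have G0 : 0 <= G by apply: wint_ge0 => [//|x]; exact: normr_ge0.
have sq : I (fun x => K f x ^+ 4 * `|g x|) <=
    2176 * L ^+ 4 * ((a ^+ 2) ^+ 3 * b ^+ 2 * F + (a ^+ 2) ^+ 4 * G).
  apply: signed; [by []|by bmt|exact: exprn_gt0|exact: exprn_gt0|by []|].
  by move=> x; rewrite normr_ge0 gb.
apply: (le_trans (Iabs _)); first by bmt.
apply: (@le_trans _ _ (I (fun x => 4^-1 * t ^- 3 * (K f x ^+ 4 * `|g x|) +
    3 / 4 * t * `|g x|))).
  apply: Ile; [by bmt|by bmt|move=> x].
  rewrite normrM -mulrA [X in _ <= X](_ : _ =
    (4^-1 * (t ^- 3 * K f x ^+ 4) + 3 / 4 * t) * `|g x|); last by field; lra.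
  apply: ler_wpM2r; first exact: normr_ge0.
  have -> : K f x ^+ 4 = `|K f x| ^+ 4.
    by rewrite (exprM _ 2 2) (exprM `|_| 2 2) real_normK ?num_real.
  set v := `|K f x|; have v0 : 0 <= v by exact: normr_ge0.
  (* Young's inequality [v <= v^4 / (4 t^3) + 3 t / 4], from [v^4 - 4 t^3 v + 3 t^4 = (v - t)^2 ((v
     + t)^2 + 2 t^2)]. *)
  have -> : 4^-1 * (t ^- 3 * v ^+ 4) + 3 / 4 * t =
      v + t ^- 3 / 4 * ((v - t) ^+ 2 * ((v + t) ^+ 2 + 2 * t ^+ 2)).
    by field; lra.
  rewrite lerDl mulr_ge0// ?divr_ge0 ?invr_ge0 ?exprn_ge0 ?(ltW t0)//.
  by rewrite mulr_ge0 ?sqr_ge0// addr_ge0 ?sqr_ge0// mulr_ge0 ?sqr_ge0.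
rewrite ID; [|by bmt|by bmt]; rewrite !IZ; [|by bmt|by bmt].
rewrite -/G.
have c0 : 0 <= 4^-1 * t ^- 3 by rewrite mulr_ge0 ?invr_ge0 ?exprn_ge0 ?ltW.
apply: (le_trans (lerD (ler_wpM2l c0 sq) (lexx _))).
rewrite -/F /t [leLHS](_ : _ = L * (a / b) *
   (544 * (a ^+ 2 * F + a ^+ 4 / b ^+ 2 * G) + 3 / 4 * (b ^+ 2 * G))); last first.
  have a0' : a != 0 by rewrite gt_eqF.
  have b0' : b != 0 by rewrite gt_eqF.
  have L0' : L != 0 by rewrite gt_eqF.
  by field; rewrite a0' b0' L0'.
rewrite -!mulrA [leRHS]mulrCA; apply: ler_wpM2l; first exact: ltW.
rewrite [leRHS]mulrCA; apply: ler_wpM2l; first exact: ltW.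
rewrite [leRHS]mulrCA; apply: ler_wpM2l; first by rewrite invr_ge0 ltW.
have : a ^+ 4 / b ^+ 2 <= b ^+ 2.
  rewrite ler_pdivrMr ?exprn_gt0// -exprD.
  by rewrite lerXn2r ?nnegrE ?(ltW a0)// ltW.
move=> /(ler_wpM2r G0).
have := mulr_ge0 (sqr_ge0 a) F0; have := mulr_ge0 (sqr_ge0 b) G0.
rewrite -!mulrA; lra.
Qed.

End Interpolation.

(** * Summation over dyadic height levels *)

Lemma geometric_small (R : realType) (c t eta : R) : 0 <= c -> 0 <= t < 1 -> 0 < eta ->
  exists n, c * t ^+ n <= eta.
Proof.
move=> c0 /andP[t0 t1] eta0.
have /cvgrPdist_lt/(_ eta eta0) [n _ /(_ n (leqnn n))] :
    (fun n => c * t ^+ n : R) @ \oo --> (c * 0 : R).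
  by apply: cvgMr; apply: cvg_expr; rewrite ger0_norm.
rewrite /= mulr0 sub0r normrN ger0_norm; last by rewrite mulr_ge0// exprn_ge0.
by move=> /ltW h; exists n.
Qed.

(** With truncated subtraction the exponent is [|i - j|]: this is the row sum needed for Schur's
    test, here for levels of height and later for dyadic radii. *)
Lemma sum_geo_dist (R : realType) (t : R) (n i : nat) : 0 <= t < 1 ->
  \sum_(j < n) t ^+ (i - j + (j - i))%N <= 2 / (1 - t).
Proof.
move=> t01; pose B := (1 - t)^-1.
have t0 l : 0 <= t ^+ l by rewrite exprn_ge0//; lra.
have t1 l : t ^+ l <= 1 by rewrite exprn_ile1//; lra.
have B0 : 0 < B by rewrite invr_gt0; lra.
have Bt : B * t + 1 = B by rewrite /B; field; lra.
rewrite -/B; clearbody B.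
(* The induction needs sharper bounds: [B t^(i+1-n)] as long as the last index is at most [i], and
   [2 B - B t^(n-i-1)] beyond the diagonal. *)
suff : if (n <= i.+1)%N
    then \sum_(j < n) t ^+ (i - j + (j - i))%N <= B * t ^+ (i.+1 - n)
    else \sum_(j < n) t ^+ (i - j + (j - i))%N <= 2 * B - B * t ^+ (n - i.+1).
  case: ifP => _ /le_trans; apply.
    by have := ler_wpM2l (ltW B0) (t1 (i.+1 - n)%N); lra.
  by have := mulr_ge0 (ltW B0) (t0 (n - i.+1)%N); lra.
elim: n => [|n IH]; first by rewrite leq0n big_ord0 mulr_ge0// ltW.
rewrite big_ord_recr /=; case: ifP => ni.
  have ni' : (n <= i)%N by [].
  move: IH; rewrite (ltnW ni) => IH; apply: (le_trans (lerD IH (lexx _))).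
  rewrite (_ : (n - i)%N = 0%N) ?addn0; last exact/eqP.
  rewrite subSS (subSn ni') exprS.
  by rewrite mulrA -[X in _ + X]mul1r -mulrDl Bt.
have in' : (i < n)%N by rewrite ltnNge; move/negbT: ni; rewrite -ltnNge ltnS.
rewrite (_ : (i - n)%N = 0%N) ?add0n; last by apply/eqP; rewrite subn_eq0 ltnW.
have BS p : 0 <= p -> 2 * B - B * p + t * p <= 2 * B - B * (t * p).
  move=> p0; rewrite -subr_ge0.
  rewrite (_ : _ - _ = (B - (B * t + 1) + (1 - t)) * p); last by ring.
  by rewrite Bt subrr add0r mulr_ge0//; lra.
have [ni1|ni1] := leqP n i.+1.
  have {}ni1 : n = i.+1 by apply/eqP; rewrite eqn_leq ni1.
  move: IH; rewrite ni1 leqnn subnn expr0 => IH.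
  by have := BS 1 ler01; rewrite !subSnn expr1; lra.
move: IH; rewrite leqNgt ni1 /= => IH.
rewrite subSn ?(ltnW ni1)//.
have -> : (n - i)%N = (n - i.+1).+1 by rewrite subnSK.
rewrite !exprS; have := BS _ (t0 (n - i.+1)%N); lra.
Qed.

Section LevelSets.
Context (R : realType) d (T : measurableType d).
Variable mu : {finite_measure set T -> \bar R}.
Context (k : T -> T -> R) (c : R).
Hypothesis bk : bm2 k.
Hypothesis ak : forall x y, k x y = - k y x.
Hypothesis c0 : 0 < c.

Let one := fun _ : T => 1 : R.
Let b1 : bm one. Proof. exact: bm_cst. Qed.
Let one0 x : 0 <= one x. Proof. exact: ler01. Qed.

Local Notation I := (wint mu one).
Local Notation K := (kop mu k one).

Hypothesis level_le : forall f g a b, bm f -> bm g -> 0 < a -> a <= b ->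
  (forall x, `|f x| <= a ^+ 2) -> (forall x, `|g x| <= b ^+ 2) ->
  `|I (fun x => K f x * g x)| <= c * (a / b) *
    (a ^+ 2 * I (fun x => `|f x|) + b ^+ 2 * I (fun x => `|g x|)).

Let ID := @wintD R d T mu one b1.
Let IZ := @wintZ R d T mu one b1.
Let IN := @wintN R d T mu one b1.
Let Ile := @le_wint R d T mu one b1 one0.
Let bK := @bm_kop R d T mu k one bk b1.
Let Isum := @wint_sum R d T mu.
Let skew := @kop_skew R d T mu k one bk ak b1.

Variables (a0 : R) (m : nat).
Hypothesis a00 : 0 < a0.
(** The heights are the squares of [a i], since [level_le] measures decay by square roots of
    heights: heights fall by [4] and the decay per level is [1/2]. *)
Let a i := a0 * 2^-1 ^+ i.
Let a_gt0 i : 0 < a i.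
Proof. by rewrite mulr_gt0// exprn_gt0// invr_gt0. Qed.

(* The part of [f] below the [i]-th level, cut to [0] after level [m]. *)
Definition below (f : T -> R) (i : nat) (x : T) : R :=
  if (i <= m)%N then f x * \1_[set y | `|f y| <= a i ^+ 2] x else 0.

(** Since [below] is zero past level [m], the last layer keeps all of [f] under its height, and both
    the layers and their absolute values telescope exactly. *)
Definition layer f i x := below f i x - below f i.+1 x.

Let bm_below f i : bm f -> bm (below f i).
Proof.
move=> bf; rewrite /below; case: (leqP i m) => _; last by bmt.
apply: bmM => //; apply: bm_indic.
have [mf _] := bf.
have mle : measurable_fun setT (fun y => `|f y| <= a i ^+ 2).
  by apply: measurable_fun_ler => //; exact: measurableT_comp.
by rewrite -[X in measurable X]setTI; exact: (mle measurableT [set true]).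
Qed.

Let bm_layer f i : bm f -> bm (layer f i).
Proof.
move=> bf; have b := bm_below i bf; have b' := bm_below i.+1 bf.
by rewrite /layer; bmt.
Qed.

Let belowE f i x : below f i x = f x \/ below f i x = 0.
Proof.
rewrite /below; case: ifP => _; last by right.
by rewrite indicE; case: (x \in _); rewrite ?mulr1 ?mulr0; [left|right].
Qed.

Let aS_le i : a i.+1 ^+ 2 <= a i ^+ 2.
Proof.
rewrite lerXn2r ?nnegrE ?(ltW (a_gt0 _))// /a ler_wpM2l ?(ltW a00)//.
by rewrite exprS ler_piMl// ?exprn_ge0 ?invr_ge0// invf_le1// ler1n.
Qed.

Let below_mono f i x : below f i x = 0 -> below f i.+1 x = 0.
Proof.
rewrite /below; case: (leqP i.+1 m) => // im; rewrite (ltnW im) !indicE.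
case: (boolP (x \in _)) => [_|h _]; first by rewrite mulr1 => ->; rewrite mul0r.
rewrite (_ : (x \in _) = false) ?mulr0//.
apply/negbTE; apply: contra h; rewrite !inE /= => /le_trans; apply.
exact: aS_le.
Qed.

Let below_le f i x : `|below f i x| <= a i ^+ 2.
Proof.
rewrite /below; case: ifP => _; last by rewrite normr0 sqr_ge0.
rewrite indicE; case: (boolP (x \in _)); rewrite ?mulr0 ?normr0 ?sqr_ge0//.
by rewrite inE /= mulr1.
Qed.

Let layer_le f i x : `|layer f i x| <= a i ^+ 2.
Proof.
rewrite /layer; case: (belowE f i x) => e; last first.
  by rewrite (below_mono e) e subrr normr0 sqr_ge0.
case: (belowE f i.+1 x) => e'; last by rewrite e' subr0 below_le.
by rewrite e e' subrr normr0 sqr_ge0.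
Qed.

Let layer_norm f i x : `|layer f i x| = `|below f i x| - `|below f i.+1 x|.
Proof.
rewrite /layer; case: (belowE f i x) => e; last first.
  by rewrite (below_mono e) e subrr normr0 subrr.
by case: (belowE f i.+1 x) => ->; rewrite e ?subrr ?normr0 ?subr0.
Qed.

Let belowT f i x : (i <= m)%N -> `|f x| <= a i ^+ 2 -> below f i x = f x.
Proof. by move=> im fx; rewrite /below im indicE mem_set ?mulr1. Qed.

Let aS i : a i ^+ 2 = 4 * a i.+1 ^+ 2.
Proof. by rewrite /a !exprMn -!exprM mulSn exprD; field. Qed.

(** Where a layer [i < m] is nonzero, [|f|] exceeds [a i.+1 ^ 2], a quarter of [a i ^ 2]. The last
    layer has no such lower bound and leaves the error [a m ^ 4]. *)
Let layer_weight f i x : (i <= m)%N ->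
  a i ^+ 2 * `|layer f i x| <=
    4 * `|f x| * `|layer f i x| + (a m ^+ 2) ^+ 2 *+ (i == m).
Proof.
have f0 : 0 <= 4 * `|f x| * `|layer f i x| by rewrite !mulr_ge0.
rewrite leq_eqVlt => /orP[/eqP im|im].
  rewrite im eqxx mulr1n; apply: ler_wpDl; first by rewrite -im.
  by rewrite [leRHS]expr2; apply: ler_wpM2l; [exact: sqr_ge0|exact: layer_le].
rewrite (ltn_eqF im) addr0; have [fx|fx] := lerP `|f x| (a i.+1 ^+ 2).
  have fx' : `|f x| <= a i ^+ 2.
    by rewrite (le_trans fx)// aS ler_peMl ?sqr_ge0// ler1n.
  by rewrite /layer !belowT ?(ltnW im)// subrr normr0 !mulr0.
by apply: ler_wpM2r; [exact: normr_ge0|rewrite aS ler_pM2l// ltW].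
Qed.

Let below0 f x : `|f x| <= a0 ^+ 2 -> below f 0 x = f x.
Proof. by move=> fa; rewrite belowT// /a expr0 mulr1. Qed.

Let below_last f x : below f m.+1 x = 0.
Proof. by rewrite /below ltnn. Qed.

Let layers_sum f x : `|f x| <= a0 ^+ 2 -> \sum_(i < m.+1) layer f i x = f x.
Proof.
move=> fa; rewrite -(big_mkord xpredT (fun i => layer f i x)).
rewrite (eq_bigr (fun i => - below f i.+1 x - - below f i x)); last first.
  by move=> i _; rewrite /layer opprK addrC.
by rewrite (telescope_sumr (fun i => - below f i x))// below_last below0// oppr0 sub0r opprK.
Qed.

Let layers_norm_sum f x : `|f x| <= a0 ^+ 2 ->
  \sum_(i < m.+1) `|layer f i x| = `|f x|.
Proof.
move=> fa; rewrite -(big_mkord xpredT (fun i => `|layer f i x|)).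
rewrite (eq_bigr (fun i => - `|below f i.+1 x| - - `|below f i x|)); last first.
  by move=> i _; rewrite layer_norm opprK addrC.
rewrite (telescope_sumr (fun i => - `|below f i x|))// below_last below0//.
by rewrite normr0 oppr0 sub0r opprK.
Qed.

Let mass f i := a i ^+ 2 * I (fun x => `|layer f i x|).

Let mass_sum f : bm f -> (forall x, `|f x| <= a0 ^+ 2) ->
  \sum_(i < m.+1) mass f i <= 4 * I (fun x => f x ^+ 2) + (a m ^+ 2) ^+ 2 * I one.
Proof.
move=> bf fa; have bl i : bm (layer f i) by exact: bm_layer.
rewrite (eq_bigr (fun i : 'I_m.+1 => I (fun x => a i ^+ 2 * `|layer f i x|))); last first.
  by move=> i _; rewrite IZ; [|bmt].
rewrite -(Isum (F := fun (i : 'I_m.+1) x => a i ^+ 2 * `|layer f i x|)); last first.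
  by move=> i; bmt.
rewrite -!IZ; [|by bmt|by bmt]; rewrite -ID; [|by bmt|by bmt].
apply: Ile; [|by bmt|move=> x].
  by apply: (@bm_sum _ _ _ _ (fun (i : 'I_m.+1) x => a i ^+ 2 * `|layer f i x|)) => i; bmt.
apply: (@le_trans _ _ (\sum_(i < m.+1)
    (4 * `|f x| * `|layer f i x| + (a m ^+ 2) ^+ 2 *+ (i == m :> nat)))).
  by apply: ler_sum => i _; apply: layer_weight; exact: (ltn_ord i).
rewrite big_split /= -mulr_sumr layers_norm_sum//.
have -> : f x ^+ 2 = `|f x| * `|f x| by rewrite -expr2 real_normK ?num_real.
rewrite [4 * (_ * _)]mulrA lerD2l mulr1.
rewrite (bigD1 ord_max)//= eqxx mulr1n big1 ?addr0// => i im.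
rewrite (_ : (i == m :> nat) = false)//.
by apply: contraNF im => /eqP im; apply/eqP/val_inj.
Qed.

Let mass0 f i : 0 <= mass f i.
Proof.
by apply: mulr_ge0; [exact: sqr_ge0|apply: wint_ge0 => // x; exact: normr_ge0].
Qed.

Let level_ratio i j : (j <= i)%N -> a i / a j = 2^-1 ^+ (i - j + (j - i))%N.
Proof.
move=> ji; rewrite (_ : (j - i)%N = 0%N); last exact/eqP.
rewrite addn0 /a -{1}(subnK ji) exprD; field.
by rewrite ?gt_eqF ?exprn_gt0.
Qed.

(** [level_le] wants the operator on the function of smaller height; when the lower layer is that of
    [g], skewness moves the operator over to it. *)
Let layer_pair f g i j : bm f -> bm g ->
  `|I (fun x => K (layer f i) x * layer g j x)| <=
  c * 2^-1 ^+ (i - j + (j - i))%N * (mass f i + mass g j).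
Proof.
move=> bf bg; have bfi := bm_layer i bf; have bgj := bm_layer j bg.
have aP p q : (p <= q)%N -> a q <= a p.
  move=> pq; rewrite /a; apply: ler_wpM2l; first exact: ltW.
  by rewrite ler_wiXn2l ?invr_ge0// invf_le1// ler1n.
have [ji|/ltnW ij] := leqP j i.
  rewrite -(level_ratio ji); apply: level_le => //; [exact: aP|..];
    move=> x; exact: layer_le.
rewrite skew//; rewrite normrN addnC -(level_ratio ij) addrC.
have -> : I (fun x => layer f i x * K (layer g j) x) =
  I (fun x => K (layer g j) x * layer f i x) by apply: eq_wint => x; rewrite mulrC.
by apply: level_le => //; [exact: aP|..]; move=> x; exact: layer_le.
Qed.

(** Schur's test for the matrix [2^-|i - j|], whose row sums are at most [2 / (1 - 1/2) = 4]. The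
    last term is the price of stopping at level [m]; [m] stays free so that it can be made
    arbitrarily small. *)
Lemma layered_bound f g : bm f -> bm g ->
  (forall x, `|f x| <= a0 ^+ 2) -> (forall x, `|g x| <= a0 ^+ 2) ->
  `|I (fun x => K f x * g x)| <= 4 * c * (4 * I (fun x => f x ^+ 2) +
     4 * I (fun x => g x ^+ 2) + 2 * (a0 ^+ 4 * I one) * 2^-1 ^+ m).
Proof.
move=> bf bg fa ga.
have bfi i : bm (layer f i) by exact: bm_layer.
have bgi i : bm (layer g i) by exact: bm_layer.
have bKf i : bm (K (layer f i)) by exact: bK.
have -> : I (fun x => K f x * g x) = \sum_(i < m.+1) \sum_(j < m.+1)
    I (fun x => K (layer f i) x * layer g j x).
  have -> : K f = fun x => \sum_(i < m.+1) K (layer f i) x.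
    apply/funext => x; rewrite /kop.
    rewrite -(Isum (F := fun (i : 'I_m.+1) y => k x y * layer f i y)).
      by apply: eq_wint => y; rewrite -mulr_sumr layers_sum.
    by move=> i; bmt.
  have -> : (fun x => (\sum_(i < m.+1) K (layer f i) x) * g x) =
     fun x => \sum_(i < m.+1) (K (layer f i) x * g x).
    by apply/funext => x; rewrite mulr_suml.
  rewrite (Isum (F := fun (i : 'I_m.+1) x => K (layer f i) x * g x)); last first.
    by move=> i; bmt.
  apply: eq_bigr => i _.
  rewrite -(Isum (F := fun (j : 'I_m.+1) x => K (layer f i) x * layer g j x)).
    by apply: eq_wint => x; rewrite -mulr_sumr layers_sum.
  by move=> j; bmt.
have w0 i j : 0 <= (2^-1 : R) ^+ (i - j + (j - i))%N.
  by rewrite exprn_ge0// invr_ge0.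
apply: (@le_trans _ _ (\sum_(i < m.+1) \sum_(j < m.+1)
    (c * 2^-1 ^+ (i - j + (j - i))%N * (mass f i + mass g j)))).
  apply: (le_trans (ler_norm_sum _ _ _)); apply: ler_sum => i _.
  apply: (le_trans (ler_norm_sum _ _ _)); apply: ler_sum => j _.
  exact: layer_pair.
have -> : \sum_(i < m.+1) \sum_(j < m.+1)
    (c * 2^-1 ^+ (i - j + (j - i))%N * (mass f i + mass g j)) =
  c * (\sum_(i < m.+1) mass f i * \sum_(j < m.+1) 2^-1 ^+ (i - j + (j - i))%N) +
  c * (\sum_(j < m.+1) mass g j * \sum_(i < m.+1) 2^-1 ^+ (j - i + (i - j))%N).
  rewrite -mulrDr.
  have -> : \sum_(j < m.+1) mass g j * \sum_(i < m.+1) 2^-1 ^+ (j - i + (i - j))%N =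
    \sum_(i < m.+1) \sum_(j < m.+1) mass g j * 2^-1 ^+ (i - j + (j - i))%N.
    rewrite exchange_big; apply: eq_bigr => i _; rewrite mulr_sumr.
    by apply: eq_bigr => j _; rewrite addnC.
  rewrite -big_split mulr_sumr; apply: eq_bigr => i _ /=.
  rewrite mulr_sumr -big_split mulr_sumr; apply: eq_bigr => j _ /=.
  by ring.
have h3 f' : \sum_(i < m.+1) mass f' i * \sum_(j < m.+1) 2^-1 ^+ (i - j + (j - i))%N
    <= 4 * \sum_(i < m.+1) mass f' i.
  rewrite mulr_sumr; apply: ler_sum => i _; rewrite [leRHS]mulrC.
  apply: ler_wpM2l; first exact: mass0.
  have -> : (4 : R) = 2 / (1 - 2^-1).
    by rewrite (_ : 1 - 2^-1 = 2^-1 :> R); [rewrite invrK; ring|field].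
  by apply: sum_geo_dist; lra.
apply: (le_trans (lerD (ler_wpM2l (ltW c0) (h3 f)) (ler_wpM2l (ltW c0) (h3 g)))).
have am : (a m ^+ 2) ^+ 2 * I one <= a0 ^+ 4 * I one * 2^-1 ^+ m.
  rewrite [leRHS]mulrAC; apply: ler_wpM2r; first exact: wint_ge0.
  rewrite /a -!exprM exprMn -exprM; apply: ler_wpM2l; first exact: exprn_ge0 (ltW _).
  by rewrite ler_wiXn2l ?invr_ge0 ?invf_le1 ?ler1n// leq_pmulr.
have := mass_sum bf fa; have := mass_sum bg ga; move: am.
move: (I (fun x => f x ^+ 2)) (I (fun x => g x ^+ 2)) => X Y.
move: (\sum_(i < m.+1) mass f i) (\sum_(i < m.+1) mass g i) => X' Y'.
move: ((a m ^+ 2) ^+ 2 * I one) (I one) (2^-1 ^+ m) => r n t am hg hf.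
rewrite [leLHS](_ : _ = 4 * c * (X' + Y')); last by ring.
apply: ler_wpM2l; first by rewrite mulr_ge0// ltW.
by rewrite -mulrA; lra.
Qed.

End LevelSets.

(** * The [L2] bound on bounded functions *)

Section L2Bound.
Context (R : realType) d (T : measurableType d).
Variable mu : {finite_measure set T -> \bar R}.
Context (k : T -> T -> R) (L : R).
Hypothesis bk : bm2 k.
Hypothesis ak : forall x y, k x y = - k y x.
Hypothesis L0 : 0 < L.

Let one := fun _ : T => 1 : R.
Let b1 : bm one. Proof. exact: bm_cst. Qed.
Let one0 x : 0 <= one x. Proof. exact: ler01. Qed.

Local Notation I := (wint mu one).
Local Notation K := (kop mu k one).

Hypothesis fourth : forall h, bm h -> (forall x, 0 <= h x <= 1) ->
  I (fun x => K h x ^+ 4 * h x) <= L ^+ 4 * I h.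

Let IZ := @wintZ R d T mu one b1.
Let bK := @bm_kop R d T mu k one bk b1.

Let form_bound f g : bm f -> bm g ->
  `|I (fun x => K f x * g x)| <=
  16 * (2176 * L) * (I (fun x => f x ^+ 2) + I (fun x => g x ^+ 2)).
Proof.
move=> bf bg; have [_ [A fA]] := bf; have [_ [B gB]] := bg.
pose a0 := 1 + `|A| + `|B|.
have a0_ge : 1 <= a0 by rewrite /a0 -addrA lerDl addr_ge0.
have a0sq : a0 <= a0 ^+ 2 by rewrite expr2 ler_peMl// (le_trans ler01).
have fa x : `|f x| <= a0 ^+ 2.
  apply: le_trans (fA x) (le_trans _ a0sq).
  by rewrite (le_trans (ler_norm A))// /a0 addrAC lerDr addr_ge0.
have ga x : `|g x| <= a0 ^+ 2.
  apply: le_trans (gB x) (le_trans _ a0sq).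
  by rewrite (le_trans (ler_norm B))// /a0 lerDr addr_ge0.
have a00 : 0 < a0 by exact: lt_le_trans a0_ge.
have c0 : 0 < 2176 * L by have := L0; lra.
have bound m := layered_bound bk ak c0 (kop_level_le bk L0 fourth) m a00 bf bg fa ga.
apply/ler_addgt0Pr => e e0.
pose r := 4 * (2176 * L) * (2 * (a0 ^+ 4 * I one)).
have r0 : 0 <= r.
  have I0 : 0 <= I one by exact: wint_ge0.
  have := mulr_ge0 (ltW L0) (mulr_ge0 (exprn_ge0 4 (ltW a00)) I0).
  by rewrite /r; lra.
have [m hm] : exists m, r * 2^-1 ^+ m <= e.
  by apply: geometric_small => //; lra.
apply: le_trans (bound m) _; move: hm; rewrite /r.
move: (I (fun x => f x ^+ 2)) (I (fun x => g x ^+ 2)) (2^-1 ^+ m) => X Y t; lra.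
Qed.

Lemma kop_L2 f : bm f ->
  I (fun x => K f x ^+ 2) <= (32 * (2176 * L)) ^+ 2 * I (fun x => f x ^+ 2).
Proof.
move=> bf; have bKf : bm (K f) by exact: bK.
pose c := 32 * (2176 * L).
have c0 : 0 < c by have := L0; rewrite /c; lra.
(* As [c] is twice the constant of [form_bound], testing against [c^-1 * K f] puts half of the
   left-hand side on the right, where it is absorbed. *)
have := form_bound bf (g := fun x => c^-1 * K f x).
move=> /(_ ltac:(bmt)) /(le_trans (ler_norm _)).
have -> : (fun x => K f x * (c^-1 * K f x)) = fun x => c^-1 * K f x ^+ 2.
  by apply/funext => x; ring.
have -> : (fun x => (c^-1 * K f x) ^+ 2) = fun x => c ^- 2 * K f x ^+ 2.
  by apply/funext => x; rewrite exprMn exprVn.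
rewrite !IZ; [|by bmt|by bmt]; rewrite -/c.
move: (I (fun x => f x ^+ 2)) (I (fun x => K f x ^+ 2)) => X Y h.
have : c * (c^-1 * Y) <= c * (16 * (2176 * L) * (X + c ^- 2 * Y)).
  by rewrite ler_pM2l.
have -> : c * (c^-1 * Y) = Y by rewrite mulrA divff ?mul1r// gt_eqF.
have -> : c * (16 * (2176 * L) * (X + c ^- 2 * Y)) = 2^-1 * (c ^+ 2 * X + Y).
  have -> : 16 * (2176 * L) = 2^-1 * c by rewrite /c; field.
  by field; rewrite gt_eqF.
lra.
Qed.

End L2Bound.

(** * Calderón–Zygmund kernels and the Wolff potential *)

Section PairWeight.
Context (R : realType) (s dl : R).
Hypothesis dl0 : 0 < dl.
Hypothesis dls : dl <= s.

(* [a^(dl - s) b^(- s - dl)] for [a <= b] *)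
Definition pairw (a b : R) : R :=
  (Num.min a b `^ (s - dl) * Num.max a b `^ (s + dl))^-1.

Let sd0 : 0 <= s - dl. Proof. by rewrite subr_ge0. Qed.
Let sd1 : 0 <= s + dl. Proof. by rewrite addr_ge0 ?(ltW dl0)// (le_trans (ltW dl0)). Qed.
Let s0 : 0 <= s. Proof. exact: le_trans (ltW dl0) dls. Qed.

Lemma pairwC a b : pairw a b = pairw b a.
Proof. by rewrite /pairw minC maxC. Qed.

Lemma pairw_ge0 a b : 0 <= pairw a b.
Proof. by rewrite invr_ge0 mulr_ge0 ?powR_ge0. Qed.

Let min0 (a b : R) : 0 < a -> 0 < b -> 0 < Num.min a b.
Proof. by move=> a0 b0; rewrite lt_min a0. Qed.

Let max0 (a b : R) : 0 < a -> 0 < b -> 0 < Num.max a b.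
Proof. by move=> a0 b0; rewrite lt_max a0. Qed.

Let denom0 a b : 0 < a -> 0 < b ->
  0 < Num.min a b `^ (s - dl) * Num.max a b `^ (s + dl).
Proof. by move=> a0 b0; rewrite mulr_gt0// powR_gt0 ?min0 ?max0. Qed.

Lemma pairw_anti a b a' b' : 0 < a -> 0 < b -> a <= a' -> b <= b' ->
  pairw a' b' <= pairw a b.
Proof.
move=> a0 b0 aa bb.
have a0' := lt_le_trans a0 aa; have b0' := lt_le_trans b0 bb.
rewrite /pairw lef_pV2 ?posrE ?denom0//; apply: ler_pM; rewrite ?powR_ge0//.
- apply: ge0_ler_powR; [exact: sd0|exact: ltW (min0 _ _)|exact: ltW (min0 _ _)|].
  by rewrite le_min !ge_min aa bb orbT.
- apply: ge0_ler_powR; [exact: sd1|exact: ltW (max0 _ _)|exact: ltW (max0 _ _)|].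
  by rewrite ge_max !le_max aa bb orbT.
Qed.

Lemma pairwM c a b : 0 < c -> 0 < a -> 0 < b ->
  pairw (c * a) (c * b) = (c `^ (2 * s))^-1 * pairw a b.
Proof.
move=> c0 a0 b0; have cge := ltW c0.
have mn0 := ltW (min0 a0 b0); have mx0 := ltW (max0 a0 b0).
rewrite /pairw -minr_pMr// -maxr_pMr// !powRM//.
have -> : 2 * s = (s - dl) + (s + dl) by ring.
rewrite [in RHS]powRD; last by rewrite (gt_eqF c0) implybT.
by rewrite -invfM; congr (_ ^-1); ring.
Qed.

(** The weight decreases in both arguments and is homogeneous of degree [-2 s]. *)
Lemma pairw_doubling a b a' b' : 0 < a -> 0 < b -> 0 < a' -> 0 < b' ->
  a' <= 2 * a -> b' <= 2 * b -> pairw a b <= 2 `^ (2 * s) * pairw a' b'.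
Proof.
move=> a0 b0 a0' b0' aa bb; rewrite mulrC -ler_pdivrMr ?powR_gt0//.
by rewrite mulrC -pairwM// pairw_anti.
Qed.

Lemma pairwE a b : 0 < a -> a <= b -> pairw a b = (a `^ s * b `^ s)^-1 * (a `^ dl / b `^ dl).
Proof.
move=> a0 ab; have b0 := lt_le_trans a0 ab.
rewrite /pairw min_l// max_r// powRB; last by rewrite (gt_eqF a0) implybT.
rewrite powRD; last by rewrite (gt_eqF b0) implybT.
by field; rewrite !gt_eqF// powR_gt0.
Qed.

Lemma pairw_diag a b : 0 < a -> a <= b -> (b `^ s * b `^ s)^-1 <= pairw a b.
Proof.
move=> a0 ab; have b0 := lt_le_trans a0 ab.
have -> : (b `^ s * b `^ s)^-1 = pairw b b.
  by rewrite pairwE// divff ?mulr1// gt_eqF// powR_gt0.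
exact: pairw_anti.
Qed.

End PairWeight.

(** * Symmetrization of a truncated kernel *)

Section SymmetrizationBound.
Context (R : realType) (X : pmetricType R) (s dl A e : R).
Hypothesis dl0 : 0 < dl.
Hypothesis dls : dl <= s.
Hypothesis A0 : 0 < A.
Hypothesis e0 : 0 < e.

Local Notation dist := (@mdist R X).
Local Notation w := (pairw s dl).

(** Smoothness is recorded in the first variable; antisymmetry transfers it to the second. *)
Definition real_CZ (kap : X -> X -> R) : Prop :=
  [/\ forall x y, kap x y = - kap y x,
      forall x y, x != y -> `|kap x y| <= A / dist x y `^ s &
      forall x x' y, x != y -> dist x x' <= 2^-1 * dist x y ->
        `|kap x y - kap x' y| <= A * (dist x x' `^ dl / dist x y `^ (s + dl))].

Definition trunc (kap : X -> X -> R) x y : R :=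
  if e <= dist x y then kap x y else 0.

(** The floor [e] keeps the weight bounded, and the truncated kernel does not see smaller distances.
    The triangle inequality survives, which is all that the doubling of the weight uses. *)
Definition tdist x y := Num.max (dist x y) e.

Lemma tdist_gt0 x y : 0 < tdist x y. Proof. by rewrite lt_max e0 orbT. Qed.

Lemma tdistC x y : tdist x y = tdist y x.
Proof. by rewrite /tdist metric_sym. Qed.

Lemma tdist_triangle x y z : tdist x z <= tdist x y + tdist y z.
Proof.
rewrite ge_max; apply/andP; split.
  by rewrite (le_trans (metric_triangle _ y _))// lerD// le_max lexx.
by rewrite -[leLHS]addr0 lerD// ?(ltW (tdist_gt0 _ _))// le_max lexx orbT.
Qed.

Context (kap : X -> X -> R).
Hypothesis CZ : real_CZ kap.

Local Notation k := (trunc kap).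

Lemma trunc_skew x y : k x y = - k y x.
Proof.
have [ak _ _] := CZ.
by rewrite /trunc metric_sym ak; case: ifP => _; rewrite ?oppr0.
Qed.

Let kap_le x y : 0 < dist x y -> `|kap x y| <= A / dist x y `^ s.
Proof. by rewrite mdist_gt0; have [_ + _] := CZ; exact. Qed.

Let inv2 r q : 0 < q -> q <= 2 * r -> (r `^ s)^-1 <= 2 `^ s * (q `^ s)^-1.
Proof.
move=> q0 qr; have r0 : 0 < r by have := lt_le_trans q0 qr; lra.
rewrite ler_pdivlMr ?powR_gt0// mulrC ler_pdivrMr ?powR_gt0//.
rewrite -powRM ?(ltW r0)//; apply: ge0_ler_powR => //.
- exact: le_trans (ltW dl0) dls.
- by rewrite nnegrE ltW.
- by rewrite nnegrE mulr_ge0 ?ltW.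
Qed.

(** With [x y] the shortest side, the first two products combine into
    [kap x y * (kap x z - kap y z)], where smoothness gains the factor [(p / q)^dl] of the weight.
    The third product involves only the two long sides, which are comparable to within the bound
    [q <= 2 r] and need no cancellation. *)
Lemma ksym_shortest x y z : dist x y <= dist x z -> dist x y <= dist y z ->
  `|ksym k x y z| <= 3 * 4 `^ s * A ^+ 2 * w (tdist x y) (tdist x z).
Proof.
move=> pq pr.
set p := dist x y in pq pr *; set q := dist x z in pq *; set r := dist y z in pr *.
have p0 : 0 <= p by exact: mdist_ge0.
have s0 : 0 <= s by exact: le_trans (ltW dl0) dls.
have qpr : q <= p + r by exact: metric_triangle.
have B0 : 1 <= 2 `^ s :> R.
  by rewrite -[leLHS](powRr0 2); apply: ler_powR => //; rewrite ler1n.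
have B4 : 4 `^ s = 2 `^ s * 2 `^ s :> R.
  by rewrite -powRM//; congr (_ `^ _); ring.
have W0 : 0 <= w (tdist x y) (tdist x z) by exact: pairw_ge0.
have bnd0 : 0 <= 3 * 4 `^ s * A ^+ 2 * w (tdist x y) (tdist x z).
  by rewrite !mulr_ge0 ?powR_ge0 ?(ltW A0).
(* If a long side is below [e], so is the shortest, and each of the three products then has a
   vanishing factor. *)
have [qe|qe] := ltP q e.
  rewrite /ksym /trunc (metric_sym y x) (metric_sym z x) -/p -/q.
  by rewrite (leNgt e p) (leNgt e q) qe (le_lt_trans pq qe) !mul0r !addr0 normr0.
have [re|re] := ltP r e.
  rewrite /ksym /trunc (metric_sym y x) (metric_sym z y) -/p -/r.
  rewrite (leNgt e p) (leNgt e r) re (le_lt_trans pr re).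
  by rewrite !(mul0r, mulr0) !addr0 normr0.
have q0 : 0 < q by exact: lt_le_trans qe.
have r0 : 0 < r by exact: lt_le_trans re.
have tq : tdist x z = q by rewrite /tdist max_l.
have q2r : q <= 2 * r by lra.
pose P := (p `^ s)^-1; pose Q := (q `^ s)^-1; pose S := (r `^ s)^-1.
have Q0 : 0 <= Q by rewrite invr_ge0 powR_ge0.
have S0 : 0 <= S by rewrite invr_ge0 powR_ge0.
have SQ : S <= 2 `^ s * Q by exact: inv2.
have kz : `|kap z x| <= A * Q by rewrite /Q -/q /q metric_sym kap_le// -metric_sym.
have kzy : `|kap z y| <= A * S by rewrite /S /r metric_sym kap_le// -metric_sym.
have third : `|kap z x * kap z y| <= 2 `^ s * A ^+ 2 * w (tdist x y) (tdist x z).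
  rewrite normrM (le_trans (ler_pM _ _ kz kzy))//.
  apply: (@le_trans _ _ (2 `^ s * A ^+ 2 * (Q * Q))).
    rewrite [leLHS](_ : _ = A ^+ 2 * Q * S); last by ring.
    rewrite [leRHS](_ : _ = A ^+ 2 * Q * (2 `^ s * Q)); last by ring.
    by rewrite ler_wpM2l// mulr_ge0// sqr_ge0.
  apply: ler_wpM2l; first by rewrite mulr_ge0 ?powR_ge0 ?sqr_ge0.
  rewrite /Q -invfM tq; apply: pairw_diag => //; first exact: tdist_gt0.
  by rewrite ge_max pq.
have [pe|pe] := ltP p e.
  have -> : ksym k x y z = kap z x * kap z y.
    rewrite /ksym /trunc (metric_sym y x) (metric_sym z x) (metric_sym z y).
    by rewrite -/p -/q -/r (leNgt e p) pe qe re /= !mul0r !add0r.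
  apply: le_trans third _; rewrite ler_wpM2r// ler_wpM2r ?sqr_ge0//.
  by rewrite B4; nra.
have p00 : 0 < p by exact: lt_le_trans pe.
have tp : tdist x y = p by rewrite /tdist max_l.
rewrite tp tq in W0 bnd0 third *.
have [ak kle ksm] := CZ.
have kxy : `|kap x y| <= A * P by exact: kap_le.
have kxz : `|kap x z| <= A * Q by exact: kap_le.
have kyz : `|kap y z| <= A * S by exact: kap_le.
have -> : ksym k x y z = kap x y * (kap x z - kap y z) + kap z x * kap z y.
  rewrite /ksym /trunc (metric_sym y x) (metric_sym z x) (metric_sym z y).
  by rewrite -/p -/q -/r pe qe re (ak y x); ring.
(* Smoothness is available for [p <= q / 2]. Otherwise [p] is comparable to [q], the factor
   [(p / q)^dl] is harmless, and the size bounds suffice. *)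
have first : `|kap x y * (kap x z - kap y z)| <= 2 * 4 `^ s * A ^+ 2 * w p q.
  have [p2|p2] := leP p (2^-1 * q).
    have /ksm/(_ p2) h : x != z by rewrite -mdist_gt0.
    rewrite normrM (le_trans (ler_pM _ _ kxy h))//.
    have -> : A * P * (A * (dist x y `^ dl / dist x z `^ (s + dl))) =
        A ^+ 2 * w p q.
      rewrite -/p -/q pairwE// powRD ?(gt_eqF q0) ?implybT//.
      by rewrite /P; field; rewrite !gt_eqF// powR_gt0.
    by apply: ler_wpM2r => //; rewrite ler_peMl ?sqr_ge0// B4; nra.
  have PQ : P <= 2 `^ s * Q by apply: inv2 => //; lra.
  have QW : Q * Q <= w p q by rewrite /Q -invfM pairw_diag.
  rewrite normrM.
  have h : `|kap x z - kap y z| <= A * Q + A * (2 `^ s * Q).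
    apply: (le_trans (ler_normB _ _)); apply: lerD => //.
    by apply: (le_trans kyz); rewrite ler_wpM2l// ltW.
  have h' : `|kap x y| <= A * (2 `^ s * Q).
    by apply: (le_trans kxy); rewrite ler_wpM2l// ltW.
  rewrite (le_trans (ler_pM _ _ h' h))//.
  have -> : A * (2 `^ s * Q) * (A * Q + A * (2 `^ s * Q)) =
     (2 `^ s + 4 `^ s) * A ^+ 2 * (Q * Q) by rewrite B4; ring.
  apply: ler_pM; [|exact: mulr_ge0| |exact: QW].
    by apply: mulr_ge0; [rewrite addr_ge0 ?powR_ge0|exact: sqr_ge0].
  by apply: ler_wpM2r; [exact: sqr_ge0|rewrite B4; nra].
apply: (le_trans (ler_normD _ _)); apply: (le_trans (lerD first third)).
rewrite -mulrDl -mulrDl; apply: ler_wpM2r => //.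
by apply: ler_wpM2r; [exact: sqr_ge0|rewrite B4; nra].
Qed.

Definition cz_weight x y z := w (tdist x y) (tdist x z).

Lemma ksym_perm12 (f : X -> X -> R) x y z : ksym f x y z = ksym f y x z.
Proof. by rewrite /ksym; ring. Qed.

Lemma ksym_perm23 (f : X -> X -> R) x y z : ksym f x y z = ksym f x z y.
Proof. by rewrite /ksym; ring. Qed.

Lemma ksym_le x y z : `|ksym k x y z| <= 3 * 4 `^ s * A ^+ 2 *
  (cz_weight x y z + cz_weight y x z + cz_weight z x y).
Proof.
have W0 a b c : 0 <= cz_weight a b c by exact: pairw_ge0.
have c0 : 0 <= 3 * 4 `^ s * A ^+ 2 by rewrite !mulr_ge0 ?powR_ge0 ?(ltW A0).
have [xy_xz|/ltW xz_xy] := leP (dist x y) (dist x z).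
  have [xy_yz|/ltW yz_xy] := leP (dist x y) (dist y z).
    apply: (le_trans (ksym_shortest xy_xz xy_yz)); apply: ler_wpM2l => //.
    by rewrite -/(cz_weight x y z) -addrA lerDl addr_ge0.
  rewrite ksym_perm12 ksym_perm23; apply: (le_trans (ksym_shortest _ _)).
  - by rewrite (metric_sym y x).
  - by rewrite (metric_sym z x) (le_trans yz_xy).
  - apply: ler_wpM2l => //; rewrite pairwC -/(cz_weight y x z).
    by rewrite (addrC (cz_weight x y z)) -addrA lerDl addr_ge0.
rewrite ksym_perm23; have [xz_yz|/ltW yz_xz] := leP (dist x z) (dist y z).
  apply: (le_trans (ksym_shortest _ _)) => //; first by rewrite (metric_sym z y).
  apply: ler_wpM2l => //; rewrite pairwC -/(cz_weight x y z).
  by rewrite -addrA lerDl addr_ge0.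
rewrite ksym_perm12 ksym_perm23; apply: (le_trans (ksym_shortest _ _)).
- by rewrite (metric_sym z y) (metric_sym z x).
- by rewrite (metric_sym z y) (metric_sym y x) (le_trans yz_xz).
- by apply: ler_wpM2l => //; rewrite pairwC -/(cz_weight z x y) lerDr addr_ge0.
Qed.

(** If [x] is no farther from [y] than from [y'], the triangle inequality makes [tdist y' y] at most
    twice [tdist y' x], and [pairw_doubling] applies. Integrated in [z], this is the exchange that
    the column sums require. *)
Lemma cz_weight_doubling x y y' :
  (forall z, cz_weight y' x z <= 2 `^ (2 * s) * cz_weight y' y z) \/
  (forall z, cz_weight y x z <= 2 `^ (2 * s) * cz_weight y y' z).
Proof.
have [h|/ltW h] := leP (tdist y x) (tdist y' x); [left|right] => z;
  apply: pairw_doubling; rewrite ?tdist_gt0//.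
- by rewrite (le_trans (tdist_triangle _ x _))// (tdistC x y); lra.
- by have := tdist_gt0 y' z; lra.
- by rewrite (le_trans (tdist_triangle _ x _))// (tdistC x y'); lra.
- by have := tdist_gt0 y z; lra.
Qed.

End SymmetrizationBound.

(** * Measurability on a separable metric space *)

Section BorelMetric.
Context (R : realType) (X : pmetricType R).
Local Notation T := (borelType X).
Local Notation dist := (@mdist R X).

Lemma open_measurable_borel (A : set X) : open A -> measurable (A : set T).
Proof. by move=> oA; exact: sub_sigma_algebra. Qed.

Lemma mdist_open (A : set X) :
  (forall x, A x -> exists2 e, 0 < e & forall y, dist x y < e -> A y) -> open A.
Proof.
move=> h; rewrite openE => x /h[e e0 he]; apply/nbhs_ballP; exists e => //.
by move=> y; rewrite ballEmdist => /he.
Qed.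

Lemma open_mball (x : X) r : open [set y | dist x y < r].
Proof.
apply: mdist_open => y /= xy.
exists (r - dist x y); first by rewrite subr_gt0.
by move=> z yz; rewrite (le_lt_trans (metric_triangle _ y _))// -ltrBrDl.
Qed.

Lemma measurable_mball (x : X) r : measurable ([set y | dist x y < r] : set T).
Proof. by apply: open_measurable_borel; exact: open_mball. Qed.

Lemma measurable_fun_rays d (U : measurableType d) (f : U -> R) :
  (forall a, measurable [set y | a < f y]) -> measurable_fun setT f.
Proof.
move=> mf; apply: (measurability _ (RGenOInfty.measurableE R)) => _ [_ [a ->] <-].
rewrite setTI (_ : _ @^-1` _ = [set y | a < f y])//.
by apply/seteqP; split=> y /=; rewrite in_itv/= andbT.
Qed.

Lemma measurable_set1_borel (q : X) : measurable ([set q] : set T).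
Proof.
rewrite -(setCK [set q]); apply: measurableC; apply: open_measurable_borel.
apply: mdist_open => y /= yq; have : 0 < dist y q by rewrite mdist_gt0; exact/eqP.
by move=> d0; exists (dist y q) => // z + zq; rewrite zq ltxx.
Qed.

(** Nothing is known of a kernel on the diagonal, but one exceptional point is a Borel set. *)
Lemma measurable_fun_punctured (f : X -> R) (q : X) :
  (forall y, y != q -> forall eta, 0 < eta ->
     exists2 e, 0 < e & forall z, dist y z < e -> `|f y - f z| < eta) ->
  measurable_fun setT (f : T -> R).
Proof.
move=> cf; apply: measurable_fun_rays => a.
rewrite (_ : [set y | _] = [set y | y != q /\ a < f y] `|`
   (if a < f q then [set q] else set0)); last first.
  apply/seteqP; split => [y /= ay|y /= [[]//|]].
    by case: (eqVneq y q) ay => [->|yq] ay; [right; rewrite ay|left].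
  by case: ifP => // aq ->.
apply: measurableU; last by case: ifP => // _; exact: measurable_set1_borel.
apply: open_measurable_borel; apply: mdist_open => y /= [yq ay].
have [|e e0 he] := cf y yq (f y - a); first by rewrite subr_gt0.
exists (Num.min e (dist y q)); first by rewrite lt_min e0 mdist_gt0.
move=> z; rewrite lt_min => /andP[/he h yzq]; split.
  by apply: contraTneq yzq => ->; rewrite ltxx.
by move: h; rewrite ltr_norml => /andP[_]; lra.
Qed.

Lemma measurable_mdist (x : X) : measurable_fun setT (dist x : T -> R).
Proof.
apply: (measurable_fun_punctured (q := x)) => y _ eta eta0.
exists eta => // z yz; apply: le_lt_trans yz; rewrite ler_norml.
have := metric_triangle x y z; have := metric_triangle x z y.
by rewrite (metric_sym z y); lra.
Qed.

Lemma separable_seq : separable_space X ->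
  exists e : nat -> X, forall x r, 0 < r -> exists i, dist x (e i) < r.
Proof.
move=> [D cD dD].
have [f finj] : exists f : X -> nat, {in D &, injective f} by exact/countable_injP.
exists (fun i => xget point [set y | D y /\ f y = i]) => x r r0.
have xr : [set y | dist x y < r] !=set0 by exists x; rewrite /= mdistxx.
have [y [/= xy Dy]] := dD _ xr (open_mball x r); exists (f y).
rewrite (_ : xget _ _ = y)//; case: xgetP => [z -> [Dz fz]|/(_ y) []]; last by split.
by apply: finj => //; exact/mem_set.
Qed.

(** Measurability on the product is that of the product sigma-algebra, not of its Borel sets.
    Replacing the first variable by an approximation with countably many values reduces it to
    measurability of the sections. *)
Lemma separable_approx : separable_space X ->
  exists p : nat -> X -> X, (forall n x, dist x (p n x) < n.+1%:R^-1) /\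
    forall n (F : T -> T -> R), (forall q, measurable_fun setT (F q)) ->
      measurable_fun setT (fun z : T * T => F (p n z.1) z.2).
Proof.
move=> /separable_seq[e eP].
have n0 n : 0 < n.+1%:R^-1 :> R by rewrite invr_gt0.
pose idx n x := ex_minn (eP x _ (n0 n)).
exists (fun n x => e (idx n x)); split=> [n x|n F mF].
  by rewrite /idx; case: ex_minnP.
have midx i : measurable ([set x | idx n x = i] : set T).
  rewrite (_ : [set x | _] = [set x | dist (e i) x < n.+1%:R^-1] `\`
     \big[setU/set0]_(j < i) [set x | dist (e j) x < n.+1%:R^-1]); last first.
    rewrite -(bigcup_mkord i (fun j => [set x | dist (e j) x < n.+1%:R^-1])).
    apply/seteqP; split => [x /= <-|x /= [xi xj]].
      rewrite /idx; case: ex_minnP => m hm mmin; split; first by rewrite metric_sym.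
      by move=> [j /= jm]; rewrite metric_sym => /mmin; rewrite leqNgt jm.
    rewrite /idx; case: ex_minnP => m hm mmin; apply/eqP; rewrite eqn_leq.
    rewrite mmin 1?metric_sym//= leqNgt; apply/negP => mi; apply: xj.
    by exists m => //=; rewrite metric_sym.
  apply: measurableD; first exact: measurable_mball.
  by apply: bigsetU_measurable => j _; exact: measurable_mball.
move=> _ B mB; rewrite setTI.
rewrite (_ : _ @^-1` _ = \bigcup_i ([set x | idx n x = i] `*` (F (e i) @^-1` B))).
  apply: bigcupT_measurable => i; apply: measurableX => //.
  by rewrite -[X in measurable X]setTI; exact: mF.
apply/seteqP; split => [[x y] /= h|[x y] [i _ [/= <-]]//].
by exists (idx n x).
Qed.

Context (sX : separable_space X).

Lemma measurable_mdist2 :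
  measurable_fun setT (fun z : T * T => dist z.1 z.2).
Proof.
have [p [pd pF]] := separable_approx sX.
apply: (measurable_fun_cvg (h := fun n (z : T * T) => dist (p n z.1) z.2)).
  by move=> n; apply: pF => q; exact: measurable_mdist.
move=> [x y] _ /=; apply/cvgrPdist_le => eta eta0.
near=> n.
have n_eta : n.+1%:R^-1 < eta by near: n; exact: near_infty_natSinv_lt (PosNum eta0).
have := lt_trans (pd n x) n_eta; have := metric_triangle (p n x) x y.
have := metric_triangle x (p n x) y.
by rewrite (metric_sym (p n x) x) ler_norml; lra.
Unshelve. all: by end_near. Qed.

Lemma powR_small (a eta : R) : 0 < a -> 0 < eta ->
  exists2 e, 0 < e & forall t, 0 <= t -> t < e -> t `^ a < eta.
Proof.
move=> a0 eta0; exists (eta `^ a^-1); first exact: powR_gt0.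
move=> t t0 te; have /= := gt0_ltr_powR a0 _ _ te.
by rewrite !nnegrE t0 powR_ge0 -powRrM mulVf ?gt_eqF// powRr1 ?(ltW eta0)//; exact.
Qed.

Context (s dl A e : R).
Hypothesis dl0 : 0 < dl.
Hypothesis dls : dl <= s.
Hypothesis A0 : 0 < A.
Hypothesis e0 : 0 < e.

Let s0 : 0 <= s. Proof. exact: le_trans (ltW dl0) dls. Qed.

Lemma bm3_cz_weight : bm3 (cz_weight s dl e : T -> T -> T -> R).
Proof.
have mt : measurable_fun setT (fun z : T * T => tdist e z.1 z.2 : R).
  exact: (measurable_maxr measurable_mdist2 (measurable_cst e)).
have mt1 : measurable_fun setT (fun p : T * T * T => tdist e p.1.1 p.1.2 : R).
  by apply: (measurableT_comp mt); exact: measurable_fst.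
have mt2 : measurable_fun setT (fun p : T * T * T => tdist e p.1.1 p.2 : R).
  apply: (measurableT_comp mt (g := fun p : T * T * T => (p.1.1, p.2))).
  by apply: measurable_fun_pair; msr.
apply: (@bm_le _ _ _ _ (pairw s dl e e)).
  rewrite /cz_weight /pairw; under eq_fun do rewrite invfM -!powRN.
  apply: measurable_funM.
    apply: (measurableT_comp (@measurable_powR R (- (s - dl)))).
    exact: measurable_minr.
  apply: (measurableT_comp (@measurable_powR R (- (s + dl)))).
  exact: measurable_maxr.
move=> p; rewrite ger0_norm ?pairw_ge0//; apply: pairw_anti => //;
  by rewrite le_max lexx orbT.
Qed.

Lemma real_CZ_continuous (kap : X -> X -> R) : real_CZ s dl A kap ->
  forall q y, y != q -> forall eta, 0 < eta ->
    exists2 r, 0 < r & forall z, dist y z < r -> `|kap y q - kap z q| < eta.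
Proof.
move=> [_ _ sm] q y yq eta eta0.
have d0 : 0 < dist y q by rewrite mdist_gt0.
have D0 : 0 < dist y q `^ (s + dl) by exact: powR_gt0.
have [r r0 hr] := powR_small dl0 (divr_gt0 (mulr_gt0 eta0 D0) A0).
exists (Num.min r (2^-1 * dist y q)); first by rewrite lt_min r0 mulr_gt0.
move=> z; rewrite lt_min => /andP[zr zq].
apply: le_lt_trans (sm y z q yq (ltW zq)) _.
by rewrite mulrA ltr_pdivrMr// mulrC -ltr_pdivlMr// hr// mdist_ge0.
Qed.

Lemma bm2_trunc (kap : X -> X -> R) : real_CZ s dl A kap ->
  bm2 (trunc e kap : T -> T -> R).
Proof.
move=> CZ; have [ak kle _] := CZ; have kc := real_CZ_continuous CZ.
have mk q : measurable_fun setT (kap q : T -> R).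
  apply: (measurable_fun_punctured (q := q)) => y yq eta eta0.
  have [r r0 hr] := kc q y yq eta eta0; exists r => // z /hr.
  by rewrite (ak q y) (ak q z) -opprD normrN.
apply: (@bm_le _ _ _ _ (A / e `^ s)); last first.
  move=> [x y] /=; rewrite /trunc; case: ifP => [exy|_]; last first.
    by rewrite normr0 divr_ge0 ?powR_ge0// ltW.
  have d0 := lt_le_trans e0 exy; rewrite mdist_gt0 in d0.
  apply: (le_trans (kle _ _ d0)); rewrite ler_pM2l// lef_pV2 ?posrE ?powR_gt0//.
    by apply: ge0_ler_powR => //; rewrite nnegrE ?mdist_ge0// ltW.
  by rewrite mdist_gt0.
have [p [pd pF]] := separable_approx sX.
have me : measurable ([set z | e <= dist z.1 z.2] : set (T * T)).
  rewrite -[X in measurable X]setTI.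
  exact: (measurable_fun_ler (measurable_cst e) measurable_mdist2) measurableT [set true] _.
(* Only the kernel is approximated; the discontinuous cut at [e] is evaluated at the true point. On
   the set that it keeps [x != y], so the kernel is continuous there. *)
apply: (measurable_fun_cvg (h := fun n (z : T * T) =>
    kap (p n z.1) z.2 * \1_[set z | e <= dist z.1 z.2] z)).
  by move=> n; apply: measurable_funM; [exact: pF|exact: measurable_indic].
move=> [x y] _ /=; rewrite indicE /trunc.
have [exy|exy] := leP e (dist x y); last first.
  rewrite memNset /=; last by apply/negP; rewrite -ltNge.
  by under eq_fun do rewrite mulr0; exact: cvg_cst.
rewrite mem_set//=; under eq_fun do rewrite mulr1.
have xy : x != y by rewrite -mdist_gt0 (lt_le_trans e0).
apply/cvgrPdist_lt => eta eta0; have [r r0 hr] := kc y x xy eta eta0.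
near=> n; apply: hr; apply: lt_trans (pd n x) _.
by near: n; exact: near_infty_natSinv_lt (PosNum r0).
Unshelve. all: by end_near. Qed.

End BorelMetric.

(** * The weight integrated against the Wolff potential *)

Section PotentialBound.
Context (R : realType) (X : pmetricType R) (s dl e M : R).
Local Notation T := (borelType X).
Variable mu : {finite_measure set T -> \bar R}.
Local Notation dist := (@mdist R X).
Hypothesis sX : separable_space X.
Hypothesis dl0 : 0 < dl.
Hypothesis dls : dl <= s.
Hypothesis e0 : 0 < e.
Hypothesis M0 : 0 < M.
Context (x : X).
Hypothesis WM : (Wpot mu s x <= M%:E)%E.

Let s0 : 0 < s. Proof. exact: lt_le_trans dl0 dls. Qed.

Let r k : R := e * 2 ^+ k.
Let r0 k : 0 < r k. Proof. by rewrite mulr_gt0// exprn_gt0. Qed.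
Let rS k : r k.+1 = 2 * r k. Proof. by rewrite /r exprS; ring. Qed.

Let m t := fine (mu (ball x t)).

Let mball t : measurable (ball x t : set T).
Proof. by rewrite ballEmdist; exact: measurable_mball. Qed.

Let m_mono : {homo m : a b / a <= b}.
Proof.
move=> a b ab; rewrite /m fine_le ?fin_num_measure// le_measure ?inE//.
by rewrite !ballEmdist => y /= /lt_le_trans; exact.
Qed.

Let m0 t : 0 <= m t. Proof. exact: fine_ge0. Qed.

Let f t := (m t / t `^ s) ^+ 2 / t.

Let mf : measurable_fun (`]0%R, +oo[%classic : set R) (fun t => (f t)%:E).
Proof.
apply/measurable_EFinP.
apply: (eq_measurable_fun (fun t => m t ^+ 2 * t `^ (- (2 * s + 1)))).
  move=> t; rewrite inE /= in_itv /= andbT => t0.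
  have t0' : t != 0 by rewrite gt_eqF.
  rewrite /f powRN powRD ?t0' ?implybT// powRr1 ?ltW//.
  have -> : 2 * s = s + s by ring.
  rewrite powRD ?t0' ?implybT//; field.
  by rewrite t0' gt_eqF// powR_gt0.
apply: measurable_funTS; apply: measurable_funM.
  by apply: measurable_funX; exact: nondecreasing_measurable.
exact: measurable_powR.
Qed.

Let f0 t : 0 < t -> 0 <= f t.
Proof. by move=> t0; rewrite /f divr_ge0 ?sqr_ge0// ltW. Qed.

Let rle k l : (k <= l)%N -> r k <= r l.
Proof. by move=> kl; rewrite /r ler_pM2l// ler_weXn2l// ler1n. Qed.

Let sub_pos a b : 0 < a -> `]a, b] `<=` (`]0, +oo[ : set R).
Proof.
by move=> a0 t /=; rewrite !in_itv /= andbT => /andP[/(lt_trans a0)].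
Qed.

Let mf_sub a b : 0 < a ->
  measurable_fun (`]a, b]%classic : set R) (fun t => (f t)%:E).
Proof. by move=> a0; apply: measurable_funS mf => //; exact: sub_pos. Qed.

Let f0_sub a b t : 0 < a -> (`]a, b]%classic : set R) t -> (0 <= (f t)%:E)%E.
Proof.
by move=> a0 /=; rewrite in_itv /= lee_fin => /andP[/(lt_trans a0) /f0].
Qed.

Let level_integral k :
  (((m (r k) / r k.+1 `^ s) ^+ 2 / 2)%:E <=
  \int[lebesgue_measure]_(t in `]r k, r k.+1]) (f t)%:E)%E.
Proof.
pose c := (m (r k) / r k.+1 `^ s) ^+ 2 / r k.+1.
have c0 : 0 <= c by rewrite divr_ge0 ?sqr_ge0// ltW.
have -> : (((m (r k) / r k.+1 `^ s) ^+ 2 / 2)%:E =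
   \int[lebesgue_measure]_(t in `]r k, r k.+1]) (cst c%:E t))%E.
  rewrite integral_cst//= lebesgue_measure_itv/= lte_fin.
  have -> : r k < r k.+1 by rewrite rS; have := r0 k; lra.
  rewrite -EFinB -EFinM; congr (_%:E); rewrite /c.
  have -> : r k.+1 - r k = r k.+1 / 2 by rewrite rS; field.
  by field; rewrite !gt_eqF// powR_gt0.
apply: ge0_le_integral => //.
- exact: mf_sub.
- move=> t /=; rewrite in_itv /= lee_fin => /andP[kt tk].
  have t0 := lt_trans (r0 k) kt.
  have ts0 : 0 < t `^ s by exact: powR_gt0.
  have rs0 : 0 < r k.+1 `^ s by exact: powR_gt0.
  rewrite /c /f; apply: ler_pM; rewrite ?sqr_ge0 ?invr_ge0 ?(ltW (r0 _))//.
    rewrite lerXn2r ?nnegrE ?divr_ge0 ?(ltW ts0) ?(ltW rs0)//.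
    apply: ler_pM; rewrite ?invr_ge0 ?(ltW rs0)//; first exact/m_mono/ltW.
    rewrite lef_pV2 ?posrE//; apply: ge0_ler_powR; rewrite ?nnegrE ?(ltW t0) ?(ltW (r0 _))//.
    exact: ltW.
  by rewrite lef_pV2 ?posrE.
Qed.

(** A level [k] below the last lies in the ball of radius [r k.+1], so its mass is charged to the
    radii between [r k.+1] and [r k.+2], where the ball is at least as large. These ranges are
    disjoint. *)
Let levels_sum N : \sum_(k < N) (m (r k.+1) / r k.+2 `^ s) ^+ 2 <= 2 * M.
Proof.
suff h : ((\sum_(k < N) ((m (r k.+1) / r k.+2 `^ s) ^+ 2 / 2))%:E <=
    \int[lebesgue_measure]_(t in `]r 1, r N.+1]) (f t)%:E)%E.
  rewrite -ler_pdivrMl// mulr_sumr -lee_fin.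
  apply: le_trans WM; apply: (@le_trans _ _
    (\int[lebesgue_measure]_(t in `]r 1, r N.+1]) (f t)%:E)%E).
    by apply: le_trans h; rewrite lee_fin; apply: ler_sum => k _; rewrite mulrC.
  apply: ge0_subset_integral => //.
  - by move=> t /=; rewrite in_itv /= andbT lee_fin => /f0.
  - exact: sub_pos.
elim: N => [|N IH].
  by rewrite big_ord0 integral_ge0// => t; exact: f0_sub.
rewrite big_ord_recr /= EFinD.
have r1N : r 1 <= r N.+1 by exact: rle.
have rNN : r N.+1 <= r N.+2 by exact: rle.
rewrite (@itv_bndbnd_setU _ _ _ (BRight (r N.+1))) ?bnd_simp//.
rewrite ge0_integral_setU//.
- by apply: leeD IH (level_integral N.+1).
- rewrite -itv_bndbnd_setU ?bnd_simp//; exact: mf_sub.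
- rewrite -itv_bndbnd_setU ?bnd_simp// => t; exact: f0_sub.
- apply/disj_setPS => t [] /=; rewrite !in_itv /= => /andP[_ tN] /andP[Nt _].
  by have := lt_le_trans Nt tN; rewrite ltxx.
Qed.

Let q : R := (2 `^ dl)^-1.

Let q01 : 0 <= q < 1.
Proof.
have h : 1 < 2 `^ dl :> R.
  have /= := gt0_ltr_powR dl0 (x := 1) (y := 2).
  by rewrite powR1; apply; rewrite ?nnegrE// ltr1n.
by rewrite /q invr_ge0 powR_ge0/= invf_lt1// (lt_trans ltr01).
Qed.

(** At dyadic radii the weight separates up to geometric decay in [|k - l|], so its double integral
    becomes a quadratic form in the normalized masses of the levels. *)
Let pairw_level k l :
  pairw s dl (r k) (r l) = (r k `^ s)^-1 * (r l `^ s)^-1 * q ^+ (k - l + (l - k))%N.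
Proof.
wlog kl : k l / (k <= l)%N => [h|].
  have [/h//|/ltnW /h] := leqP k l.
  by rewrite pairwC => ->; rewrite addnC [_^-1 * _]mulrC.
rewrite pairwE ?rle// invfM; congr (_ * _).
rewrite (_ : (k - l)%N = 0%N) ?add0n; last exact/eqP.
have -> : r l = r k * 2 ^+ (l - k) by rewrite /r -mulrA -exprD subnKC.
rewrite powRM ?exprn_ge0 ?(ltW (r0 k))//.
have -> p : (2 ^+ p) `^ dl = (2 `^ dl) ^+ p :> R.
  by rewrite -powR_mulrn// -powRrM mulrC powRrM powR_mulrn ?powR_ge0.
rewrite /q exprVn.
by field; rewrite !gt_eqF ?exprn_gt0 ?powR_gt0.
Qed.

(* The last level [N] is unbounded: finiteness of [mu] makes its contribution small. *)
Let lev N k (y : X) : bool :=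
  (r k <= tdist e x y) && ((k == N) || (tdist e x y < r k.+1)).

Let lev_exists N y : exists k : 'I_N.+1, lev N k y.
Proof.
have ex0 : exists k, (k <= N)%N && (r k <= tdist e x y).
  by exists 0%N; rewrite leq0n /= /r expr0 mulr1 /tdist le_max lexx orbT.
have bd k : (k <= N)%N && (r k <= tdist e x y) -> (k <= N)%N by move=> /andP[].
case: (ex_maxnP ex0 bd) => k /andP[kN kr] kmax.
exists (Ordinal (kN : (k < N.+1)%N)); rewrite /lev /= kr /=.
case: eqP => //= kNe; rewrite ltNge; apply/negP => kS.
have kN' : (k < N)%N by rewrite ltn_neqAle kN andbT; exact/eqP.
by have := kmax k.+1; rewrite kN' kS ltnn => /(_ isT).
Qed.

Let levset N k : set T := [set y | lev N k y].

Let mlev N k : measurable (levset N k).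
Proof.
have mt : measurable_fun setT (tdist e x : T -> R).
  exact: (measurable_maxr (measurable_mdist x) (measurable_cst e)).
rewrite (_ : levset N k = [set y | r k <= tdist e x y] `&`
    (if k == N then setT else [set y | tdist e x y < r k.+1])); last first.
  rewrite /levset /lev; apply/seteqP; split => y /=.
    by case: (k == N) => /= /andP[? ?].
  by case: (k == N) => /= -[-> //].
apply: measurableI.
  rewrite -[X in measurable X]setTI.
  exact: (measurable_fun_ler (measurable_cst (r k)) mt) measurableT [set true] _.
case: (k == N) => //; rewrite -[X in measurable X]setTI.
exact: (measurable_fun_ltr mt (measurable_cst (r k.+1))) measurableT [set true] _.
Qed.

Let weight_le N y z : cz_weight s dl e x y z <=
  \sum_(k < N.+1) \sum_(l < N.+1)
    pairw s dl (r k) (r l) * (\1_(levset N k) y * \1_(levset N l) z).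
Proof.
have t0 k l : 0 <= pairw s dl (r k) (r l) * (\1_(levset N k) y * \1_(levset N l) z).
  by rewrite mulr_ge0 ?pairw_ge0// mulr_ge0// !indicE ler0n.
have [k ky] := lev_exists N y; have [l lz] := lev_exists N z.
rewrite (bigD1 k)//= (bigD1 l)//= -addrA; apply: ler_wpDr.
  by rewrite addr_ge0// sumr_ge0// => *; rewrite ?sumr_ge0.
rewrite !indicE !mem_set// !mulr1.
by apply: pairw_anti => //; [move: ky|move: lz] => /andP[].
Qed.

Local Notation I := (wint mu (fun=> 1)).

Let b1 : bm (fun _ : T => 1 : R). Proof. exact: bm_cst. Qed.
Let one0 (y : T) : 0 <= (fun _ : T => 1 : R) y. Proof. exact: ler01. Qed.

Let mass N k := fine (mu (levset N k)) / r k `^ s.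

Let row_le N : I (fun y => I (fun z => cz_weight s dl e x y z)) <=
  \sum_(k < N.+1) \sum_(l < N.+1) mass N k * mass N l * q ^+ (k - l + (l - k))%N.
Proof.
have bc : bm3 (cz_weight s dl e : T -> T -> T -> R) by exact: bm3_cz_weight.
have bi k : bm (\1_(levset N k) : T -> R) by exact: bm_indic.
have bs y k : bm (fun z => \sum_(l < N.+1) pairw s dl (r k) (r l) *
   (\1_(levset N k) y * \1_(levset N l) z)).
  by apply: (@bm_sum _ _ _ _ (fun (l : 'I_N.+1) z => _)) => l; bmt.
have step1 y : I (fun z => cz_weight s dl e x y z) <=
   \sum_(k < N.+1) \1_(levset N k) y * (\sum_(l < N.+1)
      pairw s dl (r k) (r l) * fine (mu (levset N l))).
  apply: (@le_trans _ _ (I (fun z => \sum_(k < N.+1) \sum_(l < N.+1)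
    pairw s dl (r k) (r l) * (\1_(levset N k) y * \1_(levset N l) z)))).
    apply: (le_wint _ b1 one0); [by bmt| |by []].
    by apply: (@bm_sum _ _ _ _ (fun (k : 'I_N.+1) z => _)) => k; exact: bs.
  rewrite (wint_sum mu (F := fun (k : 'I_N.+1) z => _)); last by move=> k; exact: bs.
  apply: ler_sum => k _.
  rewrite (wint_sum mu (F := fun (l : 'I_N.+1) z => _)); last by move=> l; bmt.
  rewrite mulr_sumr; apply: ler_sum => l _.
  rewrite wintZ//; last by bmt.
  rewrite wintZ// wint_indic//.
  by rewrite mulrCA.
apply: (@le_trans _ _ (I (fun y => \sum_(k < N.+1) \1_(levset N k) y *
   (\sum_(l < N.+1) pairw s dl (r k) (r l) * fine (mu (levset N l)))))).
  apply: (le_wint _ b1 one0); [by bmt| |by []].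
  by apply: (@bm_sum _ _ _ _ (fun (k : 'I_N.+1) y => _)) => k; bmt.
rewrite (wint_sum mu (F := fun (k : 'I_N.+1) y => _)); last by move=> k; bmt.
apply: ler_sum => k _.
have -> : (fun y => \1_(levset N k) y * (\sum_(l < N.+1) pairw s dl (r k) (r l) *
    fine (mu (levset N l)))) =
  fun y => (\sum_(l < N.+1) pairw s dl (r k) (r l) * fine (mu (levset N l))) *
    \1_(levset N k) y by apply/funext => y; rewrite mulrC.
rewrite wintZ// wint_indic// mulr_suml; apply: ler_sum => l _.
rewrite pairw_level /mass le_eqVlt; apply/orP; left; apply/eqP; ring.
Qed.

Let B : R := 2 / (1 - q).

Let schur N (t : nat -> R) :
  \sum_(k < N.+1) \sum_(l < N.+1) t k * t l * q ^+ (k - l + (l - k))%N <=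
  B * \sum_(k < N.+1) t k ^+ 2.
Proof.
have q0 p : 0 <= q ^+ p by rewrite exprn_ge0//; case/andP: q01.
apply: (@le_trans _ _ (\sum_(k < N.+1) \sum_(l < N.+1)
    (2^-1 * (t k ^+ 2 * q ^+ (k - l + (l - k))%N) +
     2^-1 * (t l ^+ 2 * q ^+ (l - k + (k - l))%N)))).
  apply: ler_sum => k _; apply: ler_sum => l _; rewrite (addnC (l - k)%N).
  rewrite -mulrDr -mulrDl mulrA; apply: ler_wpM2r => //.
  by have := sqr_ge0 (t k - t l); nra.
under eq_bigr do rewrite big_split /=.
rewrite big_split /= [X in _ + X]exchange_big /=.
have h : \sum_(k < N.+1) \sum_(l < N.+1) 2^-1 * (t k ^+ 2 * q ^+ (k - l + (l - k))%N)
   <= 2^-1 * (B * \sum_(k < N.+1) t k ^+ 2).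
  rewrite mulrA mulr_sumr; apply: ler_sum => k _.
  rewrite -mulr_sumr -mulr_sumr -mulrA; apply: ler_wpM2l => //.
  by rewrite mulrC; apply: ler_wpM2r; [exact: sqr_ge0|exact: sum_geo_dist].
lra.
Qed.

Lemma wolff_row_bound : I (fun y => I (fun z => cz_weight s dl e x y z)) <=
  2 / (1 - (2 `^ dl)^-1) * (2 * (4 `^ s) ^+ 2 + 1) * M.
Proof.
rewrite -/q -/B.
have B0 : 0 <= B by rewrite /B divr_ge0// subr_ge0 ltW//; case/andP: q01.
pose c := fine (mu setT) / e `^ s; pose t : R := (2 `^ s)^-1.
have c0 : 0 <= c by rewrite divr_ge0 ?powR_ge0// fine_ge0.
have t01 : 0 <= t < 1.
  have h : 1 < 2 `^ s :> R.
    have /= := gt0_ltr_powR s0 (x := 1) (y := 2).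
    by rewrite powR1; apply; rewrite ?nnegrE// ltr1n.
  by rewrite /t invr_ge0 powR_ge0/= invf_lt1// (lt_trans ltr01).
have rsE k : r k `^ s = e `^ s * (2 `^ s) ^+ k.
  rewrite /r powRM ?exprn_ge0 ?(ltW e0)//; congr (_ * _).
  by rewrite -powR_mulrn// -powRrM mulrC powRrM powR_mulrn ?powR_ge0.
(* The last level has at most the total mass, and the total mass over [r N ^ s] is [c * t ^ N],
   which tends to zero. *)
have [N hN] : exists N, c ^+ 2 * (t ^+ 2) ^+ N <= M.
  apply: geometric_small => //; first exact: sqr_ge0.
  by rewrite sqr_ge0 expr_lt1//; case/andP: t01.
have mass0 k : 0 <= mass N k by rewrite divr_ge0 ?powR_ge0// fine_ge0.
have last_mass : mass N N ^+ 2 <= M.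
  apply: le_trans hN; rewrite exprAC -exprMn lerXn2r ?nnegrE ?mass0//.
    by rewrite mulr_ge0// exprn_ge0//; case/andP: t01.
  rewrite /mass rsE /c /t exprVn -mulrA -invfM; apply: ler_wpM2r.
    by rewrite invr_ge0 mulr_ge0 ?exprn_ge0 ?powR_ge0.
  by rewrite fine_le ?fin_num_measure// le_measure ?inE.
have mass_le k : (k < N)%N ->
    mass N k ^+ 2 <= (4 `^ s) ^+ 2 * (m (r k.+1) / r k.+2 `^ s) ^+ 2.
  move=> kN; rewrite -exprMn lerXn2r ?nnegrE//.
    by rewrite mulr_ge0 ?powR_ge0// divr_ge0 ?powR_ge0.
  have -> : 4 `^ s * (m (r k.+1) / r k.+2 `^ s) = m (r k.+1) / r k `^ s.
    have -> : r k.+2 = 4 * r k by rewrite !rS; ring.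
    rewrite powRM ?(ltW (r0 k))//; field.
    by rewrite !gt_eqF// powR_gt0.
  apply: ler_wpM2r; first by rewrite invr_ge0 powR_ge0.
  rewrite /m fine_le ?fin_num_measure// le_measure ?inE//.
  move=> y; rewrite /levset /lev /= => /andP[_].
  by rewrite (ltn_eqF kN) /= /tdist gt_max ballEmdist => /andP[].
apply: le_trans (row_le N) _; apply: le_trans (schur N (mass N)) _.
rewrite -mulrA; apply: ler_wpM2l => //.
rewrite big_ord_recr /= mulrDl mul1r; apply: lerD => //.
apply: (@le_trans _ _ (\sum_(k < N) (4 `^ s) ^+ 2 * (m (r k.+1) / r k.+2 `^ s) ^+ 2)).
  by apply: ler_sum => k _; exact: mass_le.
rewrite -mulr_sumr [leRHS](_ : _ = (4 `^ s) ^+ 2 * (2 * M)); last by ring.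
apply: ler_wpM2l; first exact: sqr_ge0.
exact: levels_sum.
Qed.

End PotentialBound.

Lemma row_column_combine (R : realType) (D w a b n : R) :
  a <= w * n -> b <= 2 * D * w * n -> 2 * a + 8 * b <= (2 + 16 * D) * w * n.
Proof. by move=> h1 h2; lra. Qed.

Lemma sqr_add_double (R : realType) (a b : R) :
  (a + 2 * b) ^+ 2 <= 2 * a ^+ 2 + 8 * b ^+ 2.
Proof. by have := sqr_ge0 (a - 2 * b); nra. Qed.

(** * The bound for real antisymmetric kernels *)

Section CZBound.
Context (R : realType) (X : pmetricType R) (s dl A e M : R).
Local Notation T := (borelType X).
Variable mu : {finite_measure set T -> \bar R}.
Hypothesis sX : separable_space X.
Hypothesis dl0 : 0 < dl.
Hypothesis dls : dl <= s.
Hypothesis A0 : 0 < A.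
Hypothesis e0 : 0 < e.
Hypothesis M0 : 0 < M.
Hypothesis WM : forall x, msupport mu x -> (Wpot mu s x <= M%:E)%E.

Local Notation dist := (@mdist R X).

(** By separability, the points off the support are covered by countably many null balls with
    centres in a dense sequence and radii [1 / (n + 1)]. *)
Lemma msupport_full : {ae mu, forall x : T, msupport mu x}.
Proof.
have [p pP] := separable_seq sX.
pose B i n := [set y | dist (p i) y < n.+1%:R^-1].
have mB i n : measurable (B i n : set T) by exact: measurable_mball.
pose Z i n := if mu (B i n) == 0%E then B i n else set0.
have nZ : mu.-negligible (\bigcup_i \bigcup_n Z i n : set T).
  apply: negligible_bigcup => i; apply: negligible_bigcup => n.
  rewrite /Z; case: eqP => [h|_]; last exact: negligible_set0.
  by apply/negligibleP.
apply: (negligibleS _ nZ) => x /= /existsNP[r /not_implyP[r0 /negP]].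
rewrite -leNgt => mr0.
have [n nr] : exists n, n.+1%:R^-1 < r / 2.
  have [n _ h] := near_infty_natSinv_lt (PosNum (divr_gt0 r0 (ltr0Sn R 1))).
  by exists n; exact: (h n (leqnn n)).
have [i xi] := pP x n.+1%:R^-1 ltac:(by rewrite invr_gt0).
exists i => //; exists n => //; rewrite /Z ifT; last first.
  apply/eqP/le_anti; rewrite measure_ge0 andbT (le_trans _ mr0)//.
  apply: le_measure; rewrite ?inE//.
    by rewrite ballEmdist; exact: measurable_mball.
  move=> y; rewrite /B ballEmdist /= => piy.
  rewrite (le_lt_trans (metric_triangle _ (p i) _))//.
  by have := lt_trans xi nr; have := lt_trans piy nr; lra.
by rewrite /B /= metric_sym.
Qed.

Let Cw := 2 / (1 - (2 `^ dl)^-1) * (2 * (4 `^ s) ^+ 2 + 1).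

Let row_ae : {ae mu, forall x : T,
  wint mu (fun=> 1) (fun y => wint mu (fun=> 1) (cz_weight s dl e x y)) <= Cw * M}.
Proof.
have F := ae_filter_ringOfSetsType mu; apply: (filterS _ msupport_full) => x sx.
exact: (@wolff_row_bound R X s dl e M mu sX dl0 dls e0 M0 x (WM sx)).
Qed.

Context (kap : X -> X -> R).
Hypothesis CZ : real_CZ s dl A kap.

Let k : T -> T -> R := trunc e kap.
Let bk : bm2 k. Proof. exact: (bm2_trunc sX dl0 dls A0 e0 CZ). Qed.
Let ak (x y : T) : k x y = - k y x. Proof. exact: (trunc_skew e CZ). Qed.

Let c := 3 * 4 `^ s * A ^+ 2.
Let D : R := 2 `^ (2 * s).
Let F : T -> T -> T -> R := cz_weight s dl e.

Let bF : bm3 F. Proof. exact: bm3_cz_weight. Qed.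
Let F0 x y z : 0 <= F x y z. Proof. exact: pairw_ge0. Qed.
Let FC x y z : F x y z = F x z y. Proof. exact: pairwC. Qed.

Let Q x y z := c * (F x y z + F y x z + F z x y).

Local Notation one := (fun=> 1 : R).

Let b1 : bm (one : T -> R). Proof. exact: bm_cst. Qed.

Lemma wint_weight_le (h f : T -> R) : bm h -> (forall x, 0 <= h x <= 1) -> bm f ->
  (forall x, 0 <= f x) -> wint mu h f <= wint mu one f.
Proof.
move=> bh h01 bf f0; rewrite wint_weight; apply: le_wint; [by bmt|by []|by bmt|by []|].
by move=> x; rewrite ler_piMr//; case/andP: (h01 x).
Qed.

Let Cw0 : 0 <= Cw.
Proof.
apply: mulr_ge0; last by apply: addr_ge0 => //; apply: mulr_ge0 => //; exact: sqr_ge0.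
rewrite divr_ge0// subr_ge0 invf_le1 ?powR_gt0//.
by rewrite -[leLHS](powRr0 2); apply: ler_powR; [rewrite ler1n|exact: ltW].
Qed.

(** The [4] is that of the fourth moment. With row sum [V] and column sum [W],
    [(V + 2 W)^2 <= 2 V^2 + 8 W^2], and the column bound [2 D] turns this into [2 + 16 D]. *)
Let L4 := 4 * (c ^+ 2 * (2 + 16 * D) * Cw ^+ 2).

Let row_h_ae h : bm h -> (forall x, 0 <= h x <= 1) ->
  {ae mu, forall y : T, wint mu h (fun x => wint mu h (F y x)) <= Cw * M}.
Proof.
move=> bh h01; have h0 x : 0 <= h x by case/andP: (h01 x).
have fil := ae_filter_ringOfSetsType mu; apply: (filterS _ row_ae) => x.
have Fx0 (g : T -> R) y : (forall z, 0 <= g z) -> 0 <= wint mu g (F x y).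
  by move=> g0; apply: wint_ge0 => // z; exact: F0.
apply: le_trans; apply: (@le_trans _ _ (wint mu h (fun y => wint mu one (F x y)))).
  apply: le_wint => //; [by bmt|by bmt|move=> y].
  by apply: wint_weight_le => //; bmt.
by apply: wint_weight_le => //; [bmt|move=> y; exact: Fx0].
Qed.

(** Moving the weight turns the left-hand side into the fourth moment of the operator on [1] for the
    density [h]. In the integrated majorant the vertex [x] contributes a row sum of [kp], and the
    vertices [y] and [z] one column sum each. *)
Let fourth h : bm h -> (forall x, 0 <= h x <= 1) ->
  wint mu one (fun x => kop mu k one h x ^+ 4 * h x) <= L4 * M ^+ 2 * wint mu one h.
Proof.
move=> bh h01; have h0 x : 0 <= h x by case/andP: (h01 x).
have rows := row_h_ae bh h01.
pose kp y x := wint mu h (F y x).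
have bkp : bm2 kp by rewrite /kp; bmt.
have kp0 y x : 0 <= kp y x by apply: wint_ge0 => // z; exact: F0.
have D0 : 0 <= D by exact: powR_ge0.
have CM0 : 0 <= Cw * M by rewrite mulr_ge0// ltW.
have kpd x y y' : kp y' x <= D * kp y' y \/ kp y x <= D * kp y y'.
  have [le|le] := cz_weight_doubling dl0 dls e0 x y y'; [left|right];
    (rewrite /kp -wintZ; [|by []|by bmt]); apply: le_wint => //; bmt.
have IV2 := row_sum_sqr_le bh h0 bkp kp0 CM0 rows.
have IW2 := column_sum_sqr_le bh h0 bkp kp0 D0 CM0 rows kpd.
have c0 : 0 <= c by rewrite /c !mulr_ge0 ?powR_ge0 ?(ltW A0).
have bQ : bm3 Q by rewrite /Q; bmt.
have Q0 x y z : 0 <= Q x y z by rewrite /Q mulr_ge0// !addr_ge0.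
have Q12 x y z : Q x y z = Q y x z by rewrite /Q (FC z x y); ring.
have Q23 x y z : Q x y z = Q x z y.
  by rewrite /Q (FC x y z) (FC y x z) (FC z x y); ring.
have kQ x y z : `|ksym k x y z| <= Q x y z.
  exact: (ksym_le dl0 dls A0 e0 CZ).
have := kop1_fourth_moment mu bk ak bh h0 bQ Q0 Q12 Q23 kQ.
have -> : wint mu h (fun x => kop mu k h one x ^+ 4) =
    wint mu one (fun x => kop mu k one h x ^+ 4 * h x).
  rewrite wint_weight; apply: eq_wint => x; congr (_ ^+ 4 * _).
  by rewrite /kop wint_weight; apply: eq_wint => y; rewrite mulr1.
move/le_trans; apply.
have E_eq x : wint mu h (fun y => wint mu h (Q x y)) =
    c * (wint mu h (kp x) + 2 * wint mu h (fun y => kp y x)).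
  have eq1 y : wint mu h (Q x y) =
      c * (kp x y + kp y x + wint mu h (fun z => F z x y)).
    rewrite wintZ; [|by []|by bmt].
    by rewrite !wintD; [|by []|by bmt|by bmt|by []|by bmt|by bmt].
  rewrite (eq_wint mu h eq1) wintZ; [|by []|by bmt].
  rewrite !wintD; [|by []|by bmt|by bmt|by []|by bmt|by bmt].
  rewrite [X in _ + _ + X]wint_swap; [|by []|by bmt].
  by rewrite mulr2n mulrDl mul1r addrA.
rewrite (eq_wint mu h (fun x => congr1 (fun u => u ^+ 2) (E_eq x))).
have -> : L4 * M ^+ 2 = 4 * (c ^+ 2 * ((2 + 16 * D) * (Cw * M) ^+ 2)).
  by rewrite /L4 [(Cw * M) ^+ 2]exprMn; move: (c ^+ 2) (Cw ^+ 2) => u v; ring.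
rewrite -[leRHS]mulrA; apply: ler_wpM2l => //; rewrite -[leRHS]mulrA.
apply: (@le_trans _ _ (wint mu h (fun x => c ^+ 2 *
    (2 * wint mu h (kp x) ^+ 2 + 8 * wint mu h (fun y => kp y x) ^+ 2)))).
  apply: le_wint => //; [by bmt|by bmt|move=> x].
  rewrite exprMn; apply: ler_wpM2l; first exact: sqr_ge0.
  exact: sqr_add_double.
rewrite wintZ; [|by []|by bmt]; apply: ler_wpM2l; first exact: sqr_ge0.
have -> : wint mu h (fun x => 2 * wint mu h (kp x) ^+ 2 +
      8 * wint mu h (fun y => kp y x) ^+ 2) =
    2 * wint mu h (fun x => wint mu h (kp x) ^+ 2) +
    8 * wint mu h (fun x => wint mu h (fun y => kp y x) ^+ 2).
  rewrite wintD; [|by []|by bmt|by bmt].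
  by congr (_ + _); (rewrite wintZ; [by []|by []|by bmt]).
have -> : wint mu one h = wint mu h one.
  by rewrite [RHS]wint_weight; apply: eq_wint => x; rewrite mul1r.
exact: (row_column_combine IV2 IW2).
Qed.

(** The summand [1] yields the strict positivity asked of [L] from [0 <= L4] alone. *)
Let L04 := 1 + L4.
Definition cz_const : R := (32 * 2176) ^+ 2 * Num.sqrt L04.

Let L40 : 0 <= L4.
Proof.
apply: mulr_ge0 => //; apply: mulr_ge0; last exact: sqr_ge0.
by apply: mulr_ge0; [exact: sqr_ge0|rewrite addr_ge0 ?mulr_ge0 ?powR_ge0].
Qed.

Lemma cz_const_gt0 : 0 < cz_const.
Proof.
apply: mulr_gt0; first by apply: exprn_gt0; lra.
by rewrite sqrtr_gt0 /L04; have := L40; lra.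
Qed.

Lemma trunc_bm_L2 g : bm g ->
  wint mu one (fun x => kop mu k one g x ^+ 2) <=
  cz_const * M * wint mu one (fun x => g x ^+ 2).
Proof.
move=> bg.
have L41 : 0 < L04 by rewrite /L04; have := L40; lra.
(* Chosen with [L^4 = L04 * M^2], so that the [L2] bound, which is a multiple of [L^2], is linear in
   [M]. *)
pose L := Num.sqrt (Num.sqrt L04) * Num.sqrt M.
have L0 : 0 < L by rewrite mulr_gt0 ?sqrtr_gt0.
have LE2 : L ^+ 2 = Num.sqrt L04 * M.
  by rewrite /L exprMn !sqr_sqrtr ?sqrtr_ge0// ltW.
have LE4 : L ^+ 4 = L04 * M ^+ 2.
  by rewrite (exprM _ 2 2) LE2 exprMn sqr_sqrtr// ltW.
have := @kop_L2 R _ T mu k L bk ak L0.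
have h4 h : bm h -> (forall x, 0 <= h x <= 1) ->
  wint mu one (fun x => kop mu k one h x ^+ 4 * h x) <= L ^+ 4 * wint mu one h.
  move=> bh h01; apply: (le_trans (fourth bh h01)); rewrite LE4.
  apply: ler_wpM2r; first by apply: wint_ge0 => // x; case/andP: (h01 x).
  by apply: ler_wpM2r; [exact: sqr_ge0|rewrite /L04; lra].
move=> /(_ h4 g bg) /le_trans; apply.
rewrite mulrA exprMn LE2 /cz_const le_eqVlt; apply/orP; left; apply/eqP.
by ring.
Qed.

End CZBound.

(** * Extension from bounded to square integrable functions *)

Section SquareIntegrable.
Context (R : realType) d (T : measurableType d).
Variable mu : {finite_measure set T -> \bar R}.
Context (k : T -> T -> R) (C : R).
Hypothesis bk : bm2 k.
Hypothesis C0 : 0 <= C.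

Local Notation one := (fun=> 1 : R).

Hypothesis bound : forall g, bm g ->
  wint mu one (fun x => kop mu k one g x ^+ 2) <= C * wint mu one (fun x => g x ^+ 2).

Context (g : T -> R).
Hypothesis mg : measurable_fun setT g.
Hypothesis g2 : mu.-integrable setT (fun x => (g x ^+ 2)%:E).

Let b1 : bm (one : T -> R). Proof. exact: bm_cst. Qed.

Lemma sqr_integrable : mu.-integrable setT (EFin \o g).
Proof.
have i1 : mu.-integrable setT (EFin \o cst 1) by exact: finite_measure_integrable_cst.
have := integrableD measurableT i1 g2.
apply: le_integrable => //; first exact/measurable_EFinP.
move=> x _ /=; rewrite lee_fin [leRHS]ger0_norm ?addr_ge0 ?sqr_ge0//.
rewrite -(real_normK (num_real (g x))); have := sqr_ge0 (`|g x| - 2^-1); nra.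
Qed.

Let G := \int[mu]_x (g x ^+ 2).
Let GE : (\int[mu]_x (g x ^+ 2)%:E = G%:E)%E.
Proof. by rewrite /G /Rintegral fineK// integrable_fin_num. Qed.

Let cut n x := g x * \1_[set y | `|g y| <= n.+1%:R] x.

Let cut_measurable n : measurable [set y | `|g y| <= n.+1%:R].
Proof.
have mle : measurable_fun setT (fun y => `|g y| <= n.+1%:R).
  by apply: measurable_fun_ler => //; exact: measurableT_comp.
by rewrite -[X in measurable X]setTI; exact: (mle measurableT [set true]).
Qed.

Let cutP n x : (`|g x| <= n.+1%:R /\ cut n x = g x) \/ (n.+1%:R < `|g x| /\ cut n x = 0).
Proof.
rewrite /cut indicE; have [h|h] := leP `|g x| n.+1%:R; [left|right]; split => //.
  by rewrite mem_set// mulr1.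
by rewrite memNset ?mulr0//= leNgt h.
Qed.

Let bcut n : bm (cut n).
Proof.
apply: (@bm_le _ _ _ _ n.+1%:R).
  by apply: measurable_funM => //; exact: measurable_indic.
by move=> x; case: (cutP n x) => -[h ->]//; rewrite normr0.
Qed.

(** The difference is nonzero only where [|g| > n + 1], and there [|g| <= g^2 / (n + 1)]. With a
    bounded kernel this makes the error of the integral uniform in [x]. *)
Let cut_err n x : `|g x - cut n x| <= n.+1%:R^-1 * g x ^+ 2.
Proof.
have n0 : 0 < n.+1%:R :> R by [].
case: (cutP n x) => -[h ->]; first by rewrite subrr normr0 mulr_ge0 ?sqr_ge0// invr_ge0.
rewrite subr0 mulrC ler_pdivlMr// -(real_normK (num_real (g x))) expr2.
by apply: ler_wpM2l => //; exact: ltW.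
Qed.

Let bk_sig := cid (proj2 bk).
Let B := sval bk_sig.
Let kB x y : `|k x y| <= B.
Proof. exact: (svalP bk_sig (x, y)). Qed.
Let B0 : 0 <= B. Proof. exact: le_trans (kB point point). Qed.

Definition kint x := \int[mu]_y (k x y * g y).

Lemma kint_integrable x : mu.-integrable setT (EFin \o (fun y => k x y * g y)).
Proof.
have [mk _] := bm2l x bk.
have : mu.-integrable setT (EFin \o (fun y => B * g y)).
  by have := integrableZl measurableT B sqr_integrable.
apply: le_integrable => //; first by apply/measurable_EFinP; exact: measurable_funM.
by move=> y _ /=; rewrite lee_fin !normrM (ger0_norm B0) ler_wpM2r.
Qed.

Let err n := B * (n.+1%:R^-1 * G).

Let kint_err n x : `|kint x - kop mu k one (cut n) x| <= err n.
Proof.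
have bkx := bm2l x bk; have bc := bcut n; have [mk _] := bkx.
have [mc _] := bc.
have ic : mu.-integrable setT (EFin \o (fun y => k x y * cut n y)).
  by apply: bm_integrable; bmt.
have ie : mu.-integrable setT (EFin \o (fun y => k x y * g y - k x y * cut n y)).
  by have := integrableB measurableT (kint_integrable x) ic.
have ik := kint_integrable x; rewrite /kop wintE /kint -RintegralB//.
apply: le_trans (le_normr_Rintegral measurableT ie) _.
have ig : mu.-integrable setT (EFin \o (fun y => B * n.+1%:R^-1 * g y ^+ 2)).
  by have := integrableZl measurableT (B * n.+1%:R^-1) g2.
rewrite /err mulrA /G -RintegralZl//; apply: le_Rintegral => //.
  by have := integrable_norm ie.
move=> y _; rewrite -mulrBr normrM -mulrA.
by apply: ler_pM => //; exact: cut_err.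
Qed.

Let err_cvg e : 0 < e -> exists n, forall m, (n <= m)%N -> err m <= e.
Proof.
move=> e0; have G0 : 0 <= G by apply: Rintegral_ge0 => x _; exact: sqr_ge0.
have BG0 : 0 <= B * G by exact: mulr_ge0.
have [n _ hn] := near_infty_natSinv_lt (PosNum (divr_gt0 e0 (ltr_wpDl BG0 ltr01))).
exists n => m /hn /= h.
rewrite /err mulrCA; apply: (@le_trans _ _ (e / (B * G + 1) * (B * G))).
  by apply: ler_wpM2r => //; exact: ltW.
rewrite mulrAC ler_pdivrMr ?ltr_wpDl//; apply: ler_wpM2l; first exact: ltW.
by rewrite lerDl.
Qed.

Let bK n : bm (kop mu k one (cut n)).
Proof. by apply: bm_kop => //; exact: bcut. Qed.

Lemma measurable_kint : measurable_fun setT kint.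
Proof.
apply: (measurable_fun_cvg (h := fun n => kop mu k one (cut n))).
  by move=> n; have [] := bK n.
move=> x _; apply/cvgrPdist_le => e e0; have [n hn] := err_cvg e0.
by exists n => // m /= /hn; exact: le_trans (kint_err m x).
Qed.

(** The factor [2] comes from squaring a sum of the operator on the cut function and a uniform
    error, which is negligible because [mu] is finite. *)
Lemma kint_L2 : (\int[mu]_x (kint x ^+ 2)%:E <= (2 * C)%:E * \int[mu]_x (g x ^+ 2)%:E)%E.
Proof.
rewrite GE -EFinM; apply/lee_addgt0Pr => e e0.
pose m := fine (mu setT).
have m0 : 0 <= m by exact: fine_ge0.
(* The bound by [1] gives [err^2 <= err]; the other one gives [2 * err * m <= e], also when
   [m = 0]. *)
pose t := Num.min 1 (e / (2 * m + 1)).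
have m1 : 0 < 2 * m + 1 by lra.
have t0 : 0 < t by rewrite lt_min ltr01 divr_gt0.
have [n hn] := err_cvg t0; have {hn} h := hn n (leqnn n).
have e2 : 2 * (err n ^+ 2) * m <= e.
  have G0 : 0 <= G by apply: Rintegral_ge0 => x _; exact: sqr_ge0.
  have er0 : 0 <= err n by rewrite /err !mulr_ge0 ?invr_ge0.
  have h1 : err n <= 1 by rewrite (le_trans h)// ge_min lexx.
  have h2 : err n <= e / (2 * m + 1) by rewrite (le_trans h)// ge_min lexx orbT.
  rewrite ler_pdivlMr// in h2.
  have : err n ^+ 2 * m <= err n * m by rewrite ler_wpM2r// expr2 ler_piMl.
  have := mulr_ge0 er0 m0; lra.
have bKn := bK n; have bc := bcut n.
have bF : bm (fun x => 2 * kop mu k one (cut n) x ^+ 2 + 2 * err n ^+ 2) by bmt.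
apply: (@le_trans _ _ (\int[mu]_x (2 * kop mu k one (cut n) x ^+ 2 + 2 * err n ^+ 2)%:E)%E).
  apply: ge0_le_integral => //.
  - by move=> x _; rewrite lee_fin sqr_ge0.
  - by apply/measurable_EFinP; apply: measurable_funX; exact: measurable_kint.
  - by apply/measurable_EFinP; have [] := bF.
  - move=> x _; rewrite lee_fin.
    have : `|kint x - kop mu k one (cut n) x| ^+ 2 <= err n ^+ 2.
      by rewrite lerXn2r ?nnegrE// (le_trans _ (kint_err n x)).
    rewrite real_normK ?num_real//.
    by have := sqr_ge0 (kint x - 2 * kop mu k one (cut n) x); nra.
have -> : (\int[mu]_x (2 * kop mu k one (cut n) x ^+ 2 + 2 * err n ^+ 2)%:E)%E =
    (2 * wint mu one (fun x => kop mu k one (cut n) x ^+ 2) + 2 * err n ^+ 2 * m)%:E.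
  rewrite -[LHS]fineK; last exact: integrable_fin_num (bm_integrable mu bF).
  congr (_%:E); rewrite -[LHS]/(\int[mu]_x _) -wintE wintD; [|by []|by bmt|by bmt].
  rewrite wintZ; [|by []|by bmt]; congr (_ + _).
  by rewrite wintE Rintegral_cst.
rewrite lee_fin; apply: lerD e2; rewrite -mulrA; apply: ler_wpM2l => //.
apply: le_trans (bound bc) _; apply: ler_wpM2l => //.
rewrite wintE /G; apply: le_Rintegral => //.
  by apply: bm_integrable; bmt.
by move=> x _; case: (cutP n x) => -[_ ->]//; rewrite expr0n sqr_ge0.
Qed.

End SquareIntegrable.

Lemma sqr_ereal_powR (R : realType) (x : \bar R) : (0 <= x -> x `^ 2 = x ^+ 2)%E.
Proof.
case: x => [r r0||]; last by [].
- by rewrite poweR_EFin powR_mulrn// EFin_expe.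
- by rewrite poweRyr ?pnatr_eq0// expe2 mulyy.
Qed.

Lemma L2norm_sqr (R : realType) d (T : measurableType d) (mu : {measure set T -> \bar R})
  (V : Type) (nrm : V -> R) (f : T -> V) :
  (L2norm mu nrm f ^+ 2 = \int[mu]_x (nrm (f x) ^+ 2)%:E)%E.
Proof.
rewrite -sqr_ereal_powR ?Lnorm_ge0// powR_Lnorm ?pnatr_eq0//.
apply: eq_integral => x _; rewrite sqr_ereal_powR// -EFin_expe /=.
by rewrite real_normK ?num_real.
Qed.

(** * Complex kernels and the operator norm *)

Section ComplexKernel.
Context (R : realType) (X : pmetricType R) (s delta A : R).
Local Notation T := (borelType X).
Variable mu : {finite_measure set T -> \bar R}.
Context (K : X -> X -> R[i]).
Hypothesis sX : separable_space X.
Hypothesis s0 : 0 < s.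
Hypothesis delta0 : 0 < delta.
Hypothesis A0 : 0 < A.
Hypothesis Kanti : antisymmetric_kernel K.
Hypothesis KCZ : CZ_kernel A s delta K.

Local Notation dist := (@mdist R X).

Lemma Re_le_normc (z : R[i]) : `|complex.Re z| <= Normc.normc z.
Proof.
case: z => a b /=; rewrite -sqrtr_sqr ler_wsqrtr// lerDl; exact: sqr_ge0.
Qed.

Lemma Im_le_normc (z : R[i]) : `|complex.Im z| <= Normc.normc z.
Proof.
case: z => a b /=; rewrite -sqrtr_sqr ler_wsqrtr// lerDr; exact: sqr_ge0.
Qed.

Lemma normc_sqr (z : R[i]) : Normc.normc z ^+ 2 = complex.Re z ^+ 2 + complex.Im z ^+ 2.
Proof. by case: z => a b /=; rewrite sqr_sqrtr// addr_ge0 ?sqr_ge0. Qed.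

(** The pair weight needs [dl <= s]. Lowering the smoothness exponent is harmless, because the ratio
    of the two distances in that condition is at most [1]. *)
Let dl := Num.min delta s.
Let dl0 : 0 < dl. Proof. by rewrite lt_min delta0. Qed.
Let dls : dl <= s. Proof. by rewrite ge_min lexx orbT. Qed.

Let smooth_weaken t d : 0 <= t -> t <= d -> 0 < d ->
  t `^ delta / d `^ (s + delta) <= t `^ dl / d `^ (s + dl).
Proof.
move=> t0 td d0; have dld : dl <= delta by rewrite ge_min lexx.
have [->|tn0] := eqVneq t 0; first by rewrite !powR0 ?gt_eqF// !mul0r.
have tgt0 : 0 < t by rewrite lt_neqAle eq_sym tn0.
have -> : t `^ delta = t `^ dl * t `^ (delta - dl).
  by rewrite -powRD ?tn0 ?implybT//; congr (_ `^ _); ring.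
have -> : d `^ (s + delta) = d `^ (s + dl) * d `^ (delta - dl).
  by rewrite -powRD ?(gt_eqF d0) ?implybT//; congr (_ `^ _); ring.
rewrite -mulf_div ler_piMr ?divr_ge0 ?powR_ge0//.
rewrite ler_pdivrMr ?powR_gt0// mul1r; apply: ge0_ler_powR => //.
- by rewrite subr_ge0.
- by rewrite nnegrE ltW.
Qed.

Lemma component_CZ (p : R[i] -> R) : (forall z, `|p z| <= Normc.normc z) ->
  {morph p : z w / z - w} -> p 0 = 0 -> real_CZ s dl A (fun x y => p (K x y)).
Proof.
move=> p_le pB p0; have [K1 K2] := KCZ; split => [x y|x y xy|x x' y xy xx'].
- by rewrite Kanti -[- K y x]sub0r pB p0 sub0r.
- exact: le_trans (p_le _) (K1 x y xy).
- have [+ _] := K2 x x' y xy xx'; rewrite -pB => /(le_trans (p_le _)) /le_trans; apply.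
  have d0 : 0 < dist x y by rewrite mdist_gt0.
  apply: ler_wpM2l; first exact: ltW.
  by apply: smooth_weaken => //; [exact: mdist_ge0|rewrite (le_trans xx')//; lra].
Qed.

Let k1 x y := complex.Re (K x y).
Let k2 x y := complex.Im (K x y).

Let CZ1 : real_CZ s dl A k1.
Proof. by apply: component_CZ => //; [exact: Re_le_normc|move=> [a b] [c d]]. Qed.

Let CZ2 : real_CZ s dl A k2.
Proof. by apply: component_CZ => //; [exact: Im_le_normc|move=> [a b] [c d]]. Qed.

Context (e M : R).
Hypothesis e0 : 0 < e.
Hypothesis M0 : 0 < M.
Hypothesis WM : forall x, msupport mu x -> (Wpot mu s x <= M%:E)%E.

Let C := cz_const s dl A * M.
Let C0 : 0 <= C. Proof. by rewrite mulr_ge0 ?ltW// cz_const_gt0. Qed.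

Let t1 : T -> T -> R := trunc e k1.
Let t2 : T -> T -> R := trunc e k2.
Let bt1 : bm2 t1. Proof. exact: (bm2_trunc sX dl0 dls A0 e0 CZ1). Qed.
Let bt2 : bm2 t2. Proof. exact: (bm2_trunc sX dl0 dls A0 e0 CZ2). Qed.
Let bound1 := @trunc_bm_L2 R X s dl A e M mu sX dl0 dls A0 e0 M0 WM k1 CZ1.
Let bound2 := @trunc_bm_L2 R X s dl A e M mu sX dl0 dls A0 e0 M0 WM k2 CZ2.

Context (f : T -> R[i]).
Hypothesis L2f : L2 mu f.

Let u x := complex.Re (f x).
Let v x := complex.Im (f x).
Let mu_ : measurable_fun setT u. Proof. by have [] := L2f. Qed.
Let mv : measurable_fun setT v. Proof. by have [] := L2f. Qed.

Let fE : (\int[mu]_x (Normc.normc (f x) ^+ 2)%:E =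
  \int[mu]_x (u x ^+ 2)%:E + \int[mu]_x (v x ^+ 2)%:E)%E.
Proof.
under eq_integral do rewrite normc_sqr EFinD.
rewrite ge0_integralD//.
- by move=> x _; rewrite lee_fin sqr_ge0.
- by apply/measurable_EFinP; exact: measurable_funX.
- by move=> x _; rewrite lee_fin sqr_ge0.
- by apply/measurable_EFinP; exact: measurable_funX.
Qed.

Let f_fin : (\int[mu]_x (Normc.normc (f x) ^+ 2)%:E < +oo)%E.
Proof.
rewrite -L2norm_sqr expe2; have [_ _ h] := L2f.
by rewrite lte_mul_pinfty// ?Lnorm_ge0// ge0_fin_numE// Lnorm_ge0.
Qed.

Let u2 : mu.-integrable setT (fun x => (u x ^+ 2)%:E).
Proof.
apply/integrableP; split; first by apply/measurable_EFinP; exact: measurable_funX.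
apply: le_lt_trans f_fin; rewrite fE.
under eq_integral do rewrite /= ger0_norm ?sqr_ge0//.
by rewrite leeDl// integral_ge0// => x _; rewrite lee_fin sqr_ge0.
Qed.

Let v2 : mu.-integrable setT (fun x => (v x ^+ 2)%:E).
Proof.
apply/integrableP; split; first by apply/measurable_EFinP; exact: measurable_funX.
apply: le_lt_trans f_fin; rewrite fE.
under eq_integral do rewrite /= ger0_norm ?sqr_ge0//.
by rewrite leeDr// integral_ge0// => x _; rewrite lee_fin sqr_ge0.
Qed.

Let truncE (k : X -> X -> R) x y (w : T -> R) :
  ((fun y => k x y * w y) \_ (~` ball x e)) y = trunc e k x y * w y.
Proof.
rewrite patchE /trunc; have [exy|exy] := leP e (dist x y).
  by rewrite mem_set// ballEmdist /= => /lt_le_trans/(_ exy); rewrite ltxx.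
by rewrite memNset ?mul0r// ballEmdist /=; apply.
Qed.

Let mball x : measurable (~` ball x e : set T).
Proof. by apply: measurableC; rewrite ballEmdist; exact: measurable_mball. Qed.

Let CZtruncE x : CZtrunc mu K e f x =
  (kint mu t1 u x - kint mu t2 v x) +i* (kint mu t1 v x + kint mu t2 u x).
Proof.
rewrite /CZtrunc /cintegral; congr (_ +i* _).
- rewrite Rintegral_mkcond /kint -RintegralB//; try exact: kint_integrable.
  apply: eq_Rintegral => y _.
  rewrite -(truncE k1 x y u) -(truncE k2 x y v) !patchE /k1 /k2 /u /v.
  by case: ifP => _; rewrite ?subr0//; case: (K x y); case: (f y).
- rewrite Rintegral_mkcond /kint -RintegralD//; try exact: kint_integrable.
  apply: eq_Rintegral => y _.
  rewrite -(truncE k1 x y v) -(truncE k2 x y u) !patchE /k1 /k2 /u /v.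
  by case: ifP => _; rewrite ?addr0//; case: (K x y) => ? ?; case: (f y) => ? ? /=.
Qed.

(** Both parts of the value are sums of two real operators, so squaring costs [2]; each operator
    costs [2 C]; and each of [u], [v] is met twice. Together this is [8 C]. *)
Lemma CZtrunc_L2 : (\int[mu]_x (Normc.normc (CZtrunc mu K e f x) ^+ 2)%:E <=
  (8 * cz_const s dl A * M)%:E * \int[mu]_x (Normc.normc (f x) ^+ 2)%:E)%E.
Proof.
pose S a b := (\int[mu]_x (kint mu a b x ^+ 2)%:E)%E.
have mS (a : T -> T -> R) (b : T -> R) : bm2 a -> measurable_fun setT b ->
    mu.-integrable setT (fun x => (b x ^+ 2)%:E) ->
    measurable_fun setT (fun x => (kint mu a b x ^+ 2)%:E).
  move=> ba mb ib; apply/measurable_EFinP; apply: measurable_funX.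
  exact: measurable_kint.
have h11 := kint_L2 bt1 C0 bound1 mu_ u2.
have h22 := kint_L2 bt2 C0 bound2 mv v2.
have h12 := kint_L2 bt1 C0 bound1 mv v2.
have h21 := kint_L2 bt2 C0 bound2 mu_ u2.
have m11 := mS _ _ bt1 mu_ u2; have m22 := mS _ _ bt2 mv v2.
have m12 := mS _ _ bt1 mv v2; have m21 := mS _ _ bt2 mu_ u2.
apply: (@le_trans _ _ (2%:E * (S t1 u + S t2 v + S t1 v + S t2 u))%E).
  have nn (a : T -> T -> R) (b : T -> R) x : setT x -> (0 <= (kint mu a b x ^+ 2)%:E)%E.
    by move=> _; rewrite lee_fin sqr_ge0.
  have nn2 (a a' : T -> T -> R) (b b' : T -> R) x : setT x ->
      (0 <= (kint mu a b x ^+ 2)%:E + (kint mu a' b' x ^+ 2)%:E)%E.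
    by move=> Tx; rewrite adde_ge0// nn.
  have nn3 x : setT x -> (0 <= (kint mu t1 u x ^+ 2)%:E + (kint mu t2 v x ^+ 2)%:E +
      (kint mu t1 v x ^+ 2)%:E)%E by move=> Tx; rewrite adde_ge0// ?nn2// nn.
  have m3 := emeasurable_funD m11 m22; have m4 := emeasurable_funD m3 m12.
  have m5 := emeasurable_funD m4 m21.
  rewrite /S -ge0_integralD; [|by []|exact: nn|exact: m11|exact: nn|exact: m22].
  rewrite -ge0_integralD; [|by []|exact: nn2|exact: m3|exact: nn|exact: m12].
  rewrite -ge0_integralD; [|by []|exact: nn3|exact: m4|exact: nn|exact: m21].
  rewrite -ge0_integralZl_EFin; [|by []| |exact: m5|by []]; last first.
    by move=> x Tx; rewrite adde_ge0 ?nn3// nn.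
  have m1 : measurable_fun setT (fun x => kint mu t1 u x - kint mu t2 v x).
    by apply: measurable_funB; exact: measurable_kint.
  have m2 : measurable_fun setT (fun x => kint mu t1 v x + kint mu t2 u x).
    by apply: measurable_funD; exact: measurable_kint.
  apply: ge0_le_integral => //.
  - by move=> x _; rewrite lee_fin sqr_ge0.
  - apply/measurable_EFinP; under eq_fun do rewrite normc_sqr CZtruncE /=.
    by apply: measurable_funD; exact: measurable_funX.
  - by apply: emeasurable_funM => //; exact: m5.
  - move=> x _; rewrite normc_sqr CZtruncE /= -!EFinD -EFinM lee_fin.
    move: (kint mu t1 u x) (kint mu t2 v x) (kint mu t1 v x) (kint mu t2 u x) => a b c d.
    by have := sqr_ge0 (a + b); have := sqr_ge0 (c - d); nra.
rewrite fE; apply: (@le_trans _ _ (2%:E * ((2 * C)%:E * (\int[mu]_x (u x ^+ 2)%:E) +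
  (2 * C)%:E * (\int[mu]_x (v x ^+ 2)%:E) + (2 * C)%:E * (\int[mu]_x (v x ^+ 2)%:E) +
  (2 * C)%:E * (\int[mu]_x (u x ^+ 2)%:E)))%E).
  by apply: lee_wpmul2l => //; rewrite !leeD.
rewrite -(fineK (integrable_fin_num measurableT u2)).
rewrite -(fineK (integrable_fin_num measurableT v2)).
rewrite -!(EFinM, EFinD) lee_fin /C le_eqVlt; apply/orP; left; apply/eqP.
by ring.
Qed.

End ComplexKernel.

Lemma L2opnorm_sqr_le (R : realType) d (T : measurableType d)
  (mu : {measure set T -> \bar R}) (V : Type) (nrm : V -> R)
  (S : (T -> R[i]) -> T -> V) (B : R) : 0 <= B ->
  (forall f, L2 mu f -> (\int[mu]_x (nrm (S f x) ^+ 2)%:E <=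
     B%:E * \int[mu]_x (Normc.normc (f x) ^+ 2)%:E)%E) ->
  (L2opnorm mu nrm S ^+ 2 <= B%:E)%E.
Proof.
move=> B0 SB.
pose z : T -> R[i] := fun=> 0.
(* Squaring is monotone on nonnegative extended reals only; the zero function is a competitor, so
   the supremum is not [-oo]. *)
have sup0 : (0 <= L2opnorm mu nrm S)%E.
  apply: (@le_trans _ _ (L2norm mu nrm (S z))); first exact: Lnorm_ge0.
  apply: ereal_sup_ubound; exists z => //=.
  have n0 : (L2norm mu (@Normc.normc R) z = 0)%E.
    by rewrite /L2norm /z /= expr0n /= addr0 sqrtr0 Lnorm0// eqe pnatr_eq0.
  by split; [split; rewrite /= ?n0//; exact: measurable_cst|rewrite n0].
have supB : (L2opnorm mu nrm S <= (Num.sqrt B)%:E)%E.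
  apply: ge_ereal_sup => _ [f [L2f f1] <-].
  have := SB f L2f; rewrite -!L2norm_sqr => h.
  have f2 : (L2norm mu (@Normc.normc R) f ^+ 2 <= 1)%E.
    by rewrite expe2 -[leRHS]mule1; apply: lee_pmul => //; exact: Lnorm_ge0.
  have {h} : (L2norm mu nrm (S f) ^+ 2 <= B%:E)%E.
    by apply: (le_trans h); rewrite -[leRHS]mule1; apply: lee_wpmul2l.
  have : (0 <= L2norm mu nrm (S f))%E by exact: Lnorm_ge0.
  case: (L2norm mu nrm (S f)) => [r||]//.
    rewrite -EFin_expe !lee_fin => r0 rB.
    by rewrite -(ger0_norm r0) -sqrtr_sqr ler_wsqrtr.
have -> : (B%:E = (Num.sqrt B)%:E ^+ 2)%E by rewrite -EFin_expe sqr_sqrtr.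
by rewrite !expe2; apply: lee_pmul.
Qed.

Lemma CZ_upper_bound (R : realType) (A s delta : R) :
  0 < A -> 0 < s -> 0 < delta -> delta <= 1 ->
  exists2 C : R, 0 < C &
  forall (X : pmetricType R)
    (mu : {finite_measure set (borelType X) -> \bar R})
    (K : X -> X -> R[i]),
  separable_space X ->
  antisymmetric_kernel K ->
  CZ_kernel A s delta K ->
  (ereal_sup [set L2opnorm mu (@Normc.normc R) (CZtrunc mu K eps) ^+ 2
             | eps in `]0%R, +oo[]
   <= C%:E * nneg_sup [set Wpot mu s x | x in msupport mu])%E.
Proof.
move=> A0 s0 delta0 _.
have dl0 : 0 < Num.min delta s by rewrite lt_min delta0.
pose c := 8 * cz_const s (Num.min delta s) A.
have c0 : 0 < c by rewrite mulr_gt0// cz_const_gt0.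
exists c => // X mu K sX aK CZ.
set w := nneg_sup _.
have w0 : (0 <= w)%E by apply: ereal_sup_ubound; left.
apply: ge_ereal_sup => _ [e /= e0 <-]; rewrite in_itv /= andbT in e0.
have wW x : msupport mu x -> (Wpot mu s x <= w)%E.
  by move=> sx; apply: ereal_sup_ubound; right; exists x.
clearbody w; case: w w0 wW => [w w0 wW|_ _|//]; last by rewrite mulry gtr0_sg// mul1e leey.
rewrite lee_fin in w0.
(* The supremum [w] may vanish while the estimates require [M > 0]: they are applied with
   [M = w + eta / c]. *)
apply/lee_addgt0Pr => eta eta0.
have M0 : 0 < w + eta / c by rewrite ltr_wpDl// divr_gt0.
have -> : (c%:E * w%:E + eta%:E = (c * (w + eta / c))%:E)%E.
  by rewrite -EFinM -EFinD; congr (_%:E); field; rewrite gt_eqF.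
apply: L2opnorm_sqr_le; first by rewrite mulr_ge0 ?ltW.
move=> f L2f; apply: CZtrunc_L2 => //.
move=> x /wW /le_trans; apply.
by rewrite lee_fin lerDl ltW// divr_gt0.
Qed.

(** * Concave gauges and the cosine sum of a triangle *)

Section MonotoneDerivative.
Context (R : realType).
Implicit Types (f : R -> R).

Lemma mean_value f a b : a < b -> (forall t, a <= t <= b -> derivable f t 1) ->
  exists2 c, a < c < b & f b - f a = derive1 f c * (b - a).
Proof.
move=> ab df.
have [t||c] := @MVT R f (derive1 f) a b ab.
- rewrite in_itv /= => /andP[at_ tb]; rewrite derive1E; apply/derivableP.
  by apply: df; rewrite !ltW.
- by apply: derivable_within_continuous => t; rewrite in_itv /=; exact: df.
- by rewrite in_itv /=; exists c.
Qed.

Lemma difference_quotient f t : derivable f t 1 -> forall e, 0 < e ->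
  exists2 r, 0 < r & forall h, h != 0 -> `|h| < r ->
    `|h^-1 * (f (t + h) - f t) - derive1 f t| < e.
Proof.
move=> df e e0; rewrite derive1E.
move/cvgrPdist_lt : df => /(_ e e0) [r r0 hr]; exists r => // h h0 hr'.
have := hr h; rewrite /= sub0r normrN => /(_ hr' h0).
by rewrite distrC /= scaler1 [h + t]addrC.
Qed.

(** By the mean value theorem the difference quotients at [t] with steps [h] and [- h] are values of
    the derivative at points on either side of [t]. They are close to the derivative at [t], and
    monotonicity traps all values in between. *)
Lemma nonincreasing_derivative_continuous f t : 0 < t ->
  (forall u, 0 < u -> derivable f u 1) ->
  {in `]0, +oo[ &, {homo derive1 f : x y /~ x <= y}} ->
  {for t, continuous (derive1 f)}.
Proof.
move=> t0 df mono; apply/cvgrPdist_lt => e e0.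
have [r r0 hr] := difference_quotient (df t t0) e0.
pose h := Num.min (r / 2) (t / 2).
have h0 : 0 < h by rewrite lt_min !divr_gt0.
have hr' : h < r by rewrite (le_lt_trans (y := r / 2)) ?ge_min ?lexx//; lra.
have ht : h < t by rewrite (le_lt_trans (y := t / 2)) ?ge_min ?lexx ?orbT//; lra.
have pos u : (0 < u) = (u \in `]0, +oo[) by rewrite in_itv /= andbT.
have [c /andP[tc cth] fc] : exists2 c, t < c < t + h &
    f (t + h) - f t = derive1 f c * (t + h - t).
  apply: mean_value; first by rewrite ltrDl.
  by move=> u /andP[tu _]; apply: df; exact: lt_le_trans tu.
have [c' /andP[hc ct] fc'] : exists2 c, t - h < c < t &
    f t - f (t - h) = derive1 f c * (t - (t - h)).
  apply: mean_value; first by rewrite ltrBlDl ltrDr.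
  by move=> u /andP[tu _]; apply: df; apply: lt_le_trans tu; rewrite subr_gt0.
have lo : derive1 f t - e < derive1 f c.
  have := hr h; rewrite gt_eqF// => /(_ isT); rewrite gtr0_norm// => /(_ hr').
  rewrite fc addrAC subrr add0r mulrC mulfK ?gt_eqF// ltr_norml => /andP[+ _].
  by lra.
have hi : derive1 f c' < derive1 f t + e.
  have := hr (- h); rewrite oppr_eq0 gt_eqF// => /(_ isT).
  rewrite normrN gtr0_norm// => /(_ hr').
  have -> : (- h)^-1 * (f (t - h) - f t) = derive1 f c'.
    rewrite invrN mulNr -mulrN opprB fc' opprB addrCA subrr addr0 mulrC mulfK//.
    by rewrite gt_eqF.
  by rewrite ltr_norml => /andP[_]; lra.
have c'0 : 0 < c' by apply: lt_trans hc; rewrite subr_gt0.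
have c0 : 0 < c by exact: lt_trans tc.
near=> u.
have uc : u < c by near: u; exact: lt_nbhsl.
have c'u : c' < u by near: u; exact: lt_nbhsr.
have u0 : 0 < u by exact: lt_trans c'u.
have h1 : derive1 f c <= derive1 f u by apply: mono; rewrite -?pos// ltW.
have h2 : derive1 f u <= derive1 f c' by apply: mono; rewrite -?pos// ltW.
by rewrite ltr_norml; apply/andP; split; lra.
Unshelve. all: by end_near. Qed.

End MonotoneDerivative.

Section ConcaveGauge.
Context (R : realType) (phi : R -> R) (s : R).
Hypothesis s0 : 0 < s.
Hypothesis s1 : s < 1.
Hypothesis Phi : PhiClass phi.
Hypothesis concave_phi : concave_halfline phi.
Hypothesis dbl : doubling s phi.

Let phi0 : phi 0 = 0. Proof. by have [[]] := Phi. Qed.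

Let in_half (t : R) : 0 <= t -> t \in `[0, +oo[.
Proof. by rewrite in_itv /= andbT. Qed.

Lemma phi_lt a b : 0 <= a -> a < b -> phi a < phi b.
Proof.
have [[_ inc _] _ _ _] := Phi.
by move=> a0 ab; apply: inc => //; apply: in_half => //; rewrite ltW// (le_lt_trans a0).
Qed.

Lemma phi_le a b : 0 <= a -> a <= b -> phi a <= phi b.
Proof. by move=> a0; rewrite le_eqVlt => /orP[/eqP ->//|/(phi_lt a0)/ltW]. Qed.

Lemma phi_gt0 t : 0 < t -> 0 < phi t.
Proof. by move=> t0; rewrite -phi0 phi_lt. Qed.

Let dphi t : 0 < t -> derivable phi t 1.
Proof. by have [[_ _ d] _ _ _] := Phi; exact: d. Qed.

Lemma phi_concave a b p : 0 <= a -> 0 <= b -> 0 <= p <= 1 ->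
  p * phi a + (1 - p) * phi b <= phi (p * a + (1 - p) * b).
Proof.
move=> a0 b0 /andP[p0 p1].
have ain : (a : R^o) \in (`[0, +oo[%classic : set R) by rewrite inE; exact: in_half.
have bin : (b : R^o) \in (`[0, +oo[%classic : set R) by rewrite inE; exact: in_half.
have h : - phi (p * a + (1 - p) * b) <= p * - phi a + (1 - p) * - phi b.
  exact: (concave_phi (Itv01 p0 p1) ain bin).
lra.
Qed.

(** With [p = a / b], both [2 a] and [b] are convex combinations of [a] and [a + b] with exchanged
    weights. Adding the two concavity inequalities gives [phi a + phi (a + b) <= phi (2 a) + phi b],
    and doubling bounds [phi (2 a)]. *)
Lemma phi_increment a b : 0 < a -> a <= b ->
  phi (a + b) - phi b <= (2 `^ s - 1) * phi a.
Proof.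
move=> a0 ab; have b0 := lt_le_trans a0 ab.
have p01 : 0 <= a / b <= 1.
  by apply/andP; split; [rewrite divr_ge0 ?ltW|rewrite ler_pdivrMr// mul1r].
have ab0 : 0 <= a + b by rewrite addr_ge0// ltW.
have e1 : a / b * (a + b) + (1 - a / b) * a = 2 * a by field; rewrite gt_eqF.
have e2 : a / b * a + (1 - a / b) * (a + b) = b by field; rewrite gt_eqF.
have := phi_concave ab0 (ltW a0) p01; have := phi_concave (ltW a0) ab0 p01.
rewrite e1 e2; move: (a / b) => p h2 h1.
by have := dbl (ltW a0); lra.
Qed.

Lemma dphi_ge0 t : 0 < t -> 0 <= derive1 phi t.
Proof.
move=> t0; rewrite leNgt; apply/negP => d0.
have [|r r0 hr] := difference_quotient (dphi t0) (e := - derive1 phi t).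
  by rewrite oppr_gt0.
have r2 : 0 < r / 2 by rewrite divr_gt0.
have := hr (r / 2); rewrite gt_eqF// => /(_ isT).
rewrite gtr0_norm// => /(_ ltac:(lra)); rewrite ltr_norml => /andP[_].
have : 0 < (r / 2)^-1 * (phi (t + r / 2) - phi t).
  by rewrite mulr_gt0 ?invr_gt0// subr_gt0 phi_lt ?ltrDl// ltW.
lra.
Qed.

(** [PhiClass] allows either monotonicity of the derivative; the increasing case is the decreasing
    one for [- phi]. *)
Lemma dphi_continuous t : 0 < t -> {for t, continuous (derive1 phi)}.
Proof.
move=> t0; have [_ _ [inc|dec] _] := Phi; last exact: nonincreasing_derivative_continuous.
have dN u : 0 < u -> derive1 (- phi) u = - derive1 phi u.
  by move=> u0; rewrite !derive1E deriveN//; exact: dphi.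
have cN : {for t, continuous (derive1 (- phi))}.
  apply: nonincreasing_derivative_continuous => //.
    by move=> u u0; apply: derivableN; exact: dphi.
  move=> x y x0 y0 xy; rewrite !in_itv /= !andbT in x0 y0.
  rewrite !dN// lerN2; apply: inc => //; by rewrite in_itv /= andbT.
apply/cvgrPdist_lt => e e0; move/cvgrPdist_lt : cN => /(_ e e0) near_t.
near=> u; have u0 : 0 < u by near: u; exact: lt_nbhsr.
have : `|derive1 (- phi) t - derive1 (- phi) u| < e by near: u; exact: near_t.
by rewrite !dN// -opprD normrN.
Unshelve. all: by end_near. Qed.

Let F (t : R) : R := - (2^-1 * (phi t ^+ 2)^-1).
Let f (t : R) : R := derive1 phi t / phi t ^+ 3.

Let F_derive (t : R) : 0 < t -> is_derive t 1 F (f t).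
Proof.
move=> t0; have p0 : phi t != 0 by rewrite gt_eqF// phi_gt0.
have dp : is_derive t 1 phi (derive1 phi t).
  by rewrite derive1E; apply/derivableP; exact: dphi.
have d2 : is_derive t 1 (phi ^+ 2) ((2%:R * phi t ^+ 1) *: derive1 phi t).
  exact: is_deriveX.
have pp : (phi ^+ 2) t != 0 by exact: (expf_neq0 2 p0).
have := is_deriveN (is_deriveZ 2^-1 (is_deriveV pp d2)).
move/is_derive_eq; apply.
rewrite /f /= /GRing.scale /= (_ : (phi ^+ 2) t = phi t ^+ 2)//.
by field.
Qed.

Let f0 t : 0 < t -> 0 <= f t.
Proof. by move=> t0; rewrite divr_ge0 ?dphi_ge0// exprn_ge0// ltW// phi_gt0. Qed.

Lemma weight_continuous (t : R) : 0 < t -> {for t, continuous f}.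
Proof.
move=> t0; apply: continuousM; first exact: dphi_continuous.
apply: continuousV; first by rewrite expf_neq0// gt_eqF// phi_gt0.
apply: differentiable_continuous; apply/derivable1_diffP.
by have [] := is_deriveX 3 (derivableP (dphi t0)).
Qed.

(** The antiderivative is [-1 / (2 phi^2)], and [phi] tends to infinity, so only the lower end
    contributes. *)
Lemma weight_tail m : 0 < m ->
  (\int[lebesgue_measure]_(t in `[m, +oo[) (f t)%:E = (2^-1 * (phi m ^+ 2)^-1)%:E)%E.
Proof.
move=> m0.
have cF (t : R) : 0 < t -> {for t, continuous F}.
  move=> t0; apply: differentiable_continuous; apply/derivable1_diffP.
  by have [] := F_derive t0.
rewrite (@ge0_continuous_FTC2y R f F m 0).
- by rewrite sub0e -EFinN /F opprK.
- by move=> t mt; apply: f0; exact: lt_le_trans mt.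
- apply/continuous_within_itvcyP; split.
    by move=> t; rewrite in_itv /= andbT => mt; apply: weight_continuous; exact: lt_trans mt.
  by apply: cvg_at_right_filter; exact: weight_continuous.
- have [_ + _ _] := Phi => /cvgryPge big.
  apply/cvgrPdist_lt => e e0; near=> t.
  have h1 : 1 <= phi t by near: t; exact: big.
  have h2 : e^-1 <= phi t by near: t; exact: big.
  rewrite /F sub0r opprK ger0_norm; last by rewrite mulr_ge0 ?invr_ge0 ?sqr_ge0.
  have p0 : 0 < phi t by exact: lt_le_trans h1.
  have h3 : (phi t)^-1 <= e by rewrite -[leRHS]invrK lef_pV2 ?posrE ?invr_gt0.
  have h4 : (phi t ^+ 2)^-1 <= (phi t)^-1.
    by rewrite lef_pV2 ?posrE ?exprn_gt0// expr2 ler_peMl// ltW.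
  by have := le_trans h4 h3; lra.
- by move=> t mt; have [] := F_derive (lt_trans m0 mt).
- by apply: cvg_at_right_filter; exact: cF.
- move=> t; rewrite in_itv /= andbT => mt.
  by rewrite derive1E; have [_] := F_derive (lt_trans m0 mt).
Unshelve. all: by end_near. Qed.

End ConcaveGauge.

(** * The weighted cosine sum of a triangle *)

Section CosineSum.
Context (R : realType) (phi : R -> R) (s : R).
Hypothesis s0 : 0 < s.
Hypothesis s1 : s < 1.
Hypothesis Phi : PhiClass phi.
Hypothesis concave_phi : concave_halfline phi.
Hypothesis dbl : doubling s phi.

Let phigt0 := phi_gt0 Phi.
Let phile := phi_le Phi.

(* The cosine at the vertex between sides [p], [q], opposite to the side [r]. *)
Definition cosine (p q r : R) := (p ^+ 2 + q ^+ 2 - r ^+ 2) / (2 * p * q).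

Definition wcos (p q r : R) := cosine p q r / (phi p * phi q).

Lemma wcosC p q r : wcos p q r = wcos q p r.
Proof.
rewrite /wcos /cosine [phi q * _]mulrC (addrC (q ^+ 2)).
by rewrite -!mulrA (mulrC q p).
Qed.

Lemma two_powR_bounds : 1 < (2 : R) `^ s < 2.
Proof.
have l2 : 0 < ln (2 : R) by rewrite ln_gt0// ltr1n.
rewrite /powR gt_eqF//; apply/andP; split.
  by rewrite -[ltLHS]expR0 ltr_expR mulr_gt0.
by rewrite -[ltRHS]lnK ?posrE// ltr_expR gtr_pMl.
Qed.

(** Only the angle opposite the longest side [c] can be obtuse, and the angle opposite the shortest
    side [a] has cosine at least [1/2]. Cleared of denominators, the claim says that this cosine
    outweighs the negative one. *)
Let sorted_sum (a b c : R) : 0 < a -> a <= b -> b <= c -> c <= a + b ->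
  (2 - 2 `^ s) / 2 / phi c ^+ 2 <= wcos b c a + wcos a c b + wcos a b c.
Proof.
move=> a0 ab bc cab.
have b0 := lt_le_trans a0 ab; have c0 := lt_le_trans b0 bc.
have u0 := phigt0 a0; have v0 := phigt0 b0; have w0 := phigt0 c0.
have uv := phile (ltW a0) ab; have vw := phile (ltW b0) bc.
have inc := phi_increment concave_phi dbl a0 ab.
have wle : phi c <= phi b + (2 `^ s - 1) * phi a.
  by have := phile (ltW c0) cab; lra.
have x1 : 2^-1 <= cosine b c a.
  rewrite /cosine ler_pdivlMr ?mulr_gt0// -subr_ge0.
  rewrite (_ : _ - _ = (b - a) * (b + a) + c * (c - b)); last by field.
  by apply: addr_ge0; apply: mulr_ge0; lra.
have x2 : cosine b c a <= 1.
  rewrite /cosine ler_pdivrMr ?mulr_gt0// mul1r -subr_ge0.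
  rewrite (_ : _ - _ = (a + b - c) * (a + c - b)); last by ring.
  by rewrite mulr_ge0//; lra.
have y1 : 0 <= cosine a c b.
  by rewrite /cosine divr_ge0 ?mulr_ge0 ?ltW//; nra.
have y2 : cosine a c b <= 1.
  rewrite /cosine ler_pdivrMr ?mulr_gt0// mul1r -subr_ge0.
  rewrite (_ : _ - _ = (a + b - c) * (b + c - a)); last by ring.
  by rewrite mulr_ge0//; lra.
(* [cos C + cos A cos B = sin A sin B >= 0], by Heron's formula *)
have z1 : - (cosine b c a * cosine a c b) <= cosine a b c.
  rewrite -subr_ge0 opprK.
  rewrite (_ : _ + _ = (a + b + c) * (a + b - c) * (c + a - b) * (c + b - a) /
    (4 * a * b * c ^+ 2)); last by rewrite /cosine; field; rewrite !gt_eqF.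
  rewrite divr_ge0//; last by rewrite !mulr_ge0 ?sqr_ge0 ?ltW.
  by rewrite !mulr_ge0//; lra.
rewrite /wcos; move: (cosine b c a) (cosine a c b) (cosine a b c) x1 x2 y1 y2 z1.
move=> x y z x1 x2 y1 y2 z1.
move: (phi a) (phi b) (phi c) u0 v0 w0 uv vw wle => u v w u0 v0 w0 uv vw wle.
have [t1 t2] := andP two_powR_bounds; move: (2 `^ s) t1 t2 wle => t t1 t2 wle.
(* Inserting [z >= - x y] and [w <= v + (t - 1) u] leaves [u x (1 - (t - 1) y) + v y (1 - x)]. The
   second term is nonnegative, and [y <= 1], [x >= 1/2] bound the first. *)
have N : (2 - t) / 2 * u <= u * x + v * y + w * z.
  have h1 : - (w * (x * y)) <= w * z by rewrite -mulrN ler_wpM2l// ltW.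
  have xy0 : 0 <= x * y by rewrite mulr_ge0//; lra.
  have h2 := ler_wpM2r xy0 wle.
  have h3 : 0 <= v * y * (1 - x) by rewrite !mulr_ge0//; lra.
  have h4 : (2 - t) / 2 <= x * (1 - (t - 1) * y).
    have : x * ((t - 1) * y) <= x * (t - 1).
      by rewrite ler_wpM2l//; [lra|rewrite ler_piMr//; lra].
    have : 2^-1 * (2 - t) <= x * (2 - t) by rewrite ler_wpM2r//; lra.
    lra.
  have := ler_wpM2l (ltW u0) h4; lra.
have -> : x / (v * w) + y / (u * w) + z / (u * v) = (u * x + v * y + w * z) / (u * v * w).
  by field; rewrite !gt_eqF.
apply: (@le_trans _ _ ((2 - t) / 2 * u / (u * v * w))).
  rewrite (_ : (2 - t) / 2 * u / (u * v * w) = (2 - t) / 2 / (v * w)); last first.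
    by field; rewrite !gt_eqF.
  rewrite ler_wpM2l//; first by lra.
  by rewrite lef_pV2 ?posrE ?mulr_gt0 ?exprn_gt0// expr2 ler_wpM2r// ltW.
by rewrite ler_wpM2r// invr_ge0 !mulr_ge0// ltW.
Qed.

Let wcos_sum p q r := wcos p q r + wcos p r q + wcos q r p.

Let wcos_sum12 p q r : wcos_sum p q r = wcos_sum q p r.
Proof. by rewrite /wcos_sum (wcosC p q) addrAC. Qed.

Let wcos_sum23 p q r : wcos_sum p q r = wcos_sum p r q.
Proof. by rewrite /wcos_sum (wcosC q r) [in LHS](addrC (wcos p q r)). Qed.

Let kap : R := (2 - 2 `^ s) / 8.

(** The longest side may be the third one, but it is at most [2 m], so [phi L <= 2 * phi m].
    Squaring costs [4] and turns the denominator [2] into the [8] of [kap]. *)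
Let kap_bound (m L : R) : 0 < m -> 0 <= L -> L <= 2 * m ->
  kap / phi m ^+ 2 <= (2 - 2 `^ s) / 2 / phi L ^+ 2 \/ L = 0.
Proof.
move=> m0; rewrite le_eqVlt => /orP[/eqP <-|L0] Lm; [by right|left].
have pm := phigt0 m0; have pL := phigt0 L0.
have h : phi L <= 2 * phi m.
  apply: (le_trans (phile (ltW L0) Lm)); apply: (le_trans (dbl (ltW m0))).
  by apply: ler_wpM2r; [exact: ltW|case/andP: two_powR_bounds => _ /ltW].
have [_ t2] := andP two_powR_bounds.
rewrite /kap (_ : (2 - 2 `^ s) / 8 / phi m ^+ 2 =
   (2 - 2 `^ s) / 2 / (2 * phi m) ^+ 2); last by field; rewrite gt_eqF.
rewrite ler_wpM2l//; first by rewrite divr_ge0// subr_ge0 ltW.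
rewrite lef_pV2 ?posrE ?exprn_gt0 ?mulr_gt0// lerXn2r ?nnegrE//; first exact: ltW.
by rewrite mulr_ge0// ltW.
Qed.

Let wcos_sum_ge (p q r : R) : 0 < p -> 0 < q -> 0 < r ->
  p <= q + r -> q <= p + r -> r <= p + q ->
  kap / phi (Num.max p q) ^+ 2 <= wcos_sum p q r.
Proof.
move=> p0 q0 r0 pqr qpr rpq.
have m0 : 0 < Num.max p q by rewrite lt_max p0.
have pm : p <= Num.max p q by rewrite le_max lexx.
have qm : q <= Num.max p q by rewrite le_max lexx orbT.
move: (Num.max p q) m0 pm qm => m m0 pm qm.
have sorted (a b c : R) : 0 < a -> a <= b -> b <= c -> c <= a + b ->
    c <= 2 * m -> kap / phi (m) ^+ 2 <= wcos_sum a b c.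
  move=> a0 ab bc cab cm; have c0 := lt_le_trans (lt_le_trans a0 ab) bc.
  have [h|c00] := kap_bound m0 (ltW c0) cm; last by rewrite c00 ltxx in c0.
  apply: (le_trans h); apply: le_trans (sorted_sum a0 ab bc cab) _.
  by rewrite /wcos_sum; lra.
have [pq|/ltW qp] := leP p q; have [qr|/ltW rq] := leP q r;
  have [pr|/ltW rp] := leP p r.
- by apply: sorted => //; lra.
- by apply: sorted => //; lra.
- by rewrite wcos_sum23; apply: sorted => //; lra.
- by rewrite wcos_sum23 wcos_sum12; apply: sorted => //; lra.
- by rewrite wcos_sum12; apply: sorted => //; lra.
- by rewrite wcos_sum12 wcos_sum23; apply: sorted => //; lra.
- by rewrite wcos_sum12 wcos_sum23 wcos_sum12; apply: sorted => //; lra.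
- by rewrite wcos_sum23 wcos_sum12 wcos_sum23; apply: sorted => //; lra.
Qed.

Context (e : R).
Hypothesis e0 : 0 < e.

Definition tcos p q r := if (e < p) && (e < q) then wcos p q r else 0.

(** Truncation never leaves a negative term: with one side at most [e] only the angle opposite it
    survives, which is acute since an adjacent side is longer; with two such sides nothing
    survives. *)
Lemma tcos_sum_ge (p q r : R) : 0 <= p -> 0 <= q -> 0 <= r ->
  p <= q + r -> q <= p + r -> r <= p + q ->
  (if [&& e < p, e < q & e < r] then (2 - 2 `^ s) / 8 / phi (Num.max p q) ^+ 2 else 0) <=
  tcos p q r + tcos p r q + tcos q r p.
Proof.
move=> p0 q0 r0 pqr qpr rpq.
have acute (a b c : R) : e < a -> e < b -> 0 <= c -> c <= e -> 0 <= wcos a b c.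
  move=> ea eb c0 ce; have a0 := lt_trans e0 ea; have b0 := lt_trans e0 eb.
  apply: divr_ge0; last by rewrite mulr_ge0// ltW// phigt0.
  apply: divr_ge0; last by rewrite !mulr_ge0// ltW.
  have : c ^+ 2 <= a ^+ 2 by rewrite lerXn2r ?nnegrE//; [exact: ltW|exact: le_trans (ltW ea)].
  by have := sqr_ge0 b; lra.
rewrite /tcos.
have [pe|pe] := ltP e p; have [qe|qe] := ltP e q; have [re|re] := ltP e r => /=;
  rewrite ?addr0 ?add0r ?lexx// ?acute//.
by apply: wcos_sum_ge => //; exact: lt_trans e0 _.
Qed.

End CosineSum.

(** * The vector kernel on Euclidean space *)

Section SecondMoment.
Context (R : realType) d (T : measurableType d).
Variable mu : {finite_measure set T -> \bar R}.
Context (k : T -> T -> R).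
Hypothesis bk : bm2 k.
Hypothesis ak : forall x y, k x y = - k y x.

Local Notation one := (fun=> 1 : R).
Local Notation I := (wint mu one).

(** Cotlar's identity for [f = 1], integrated: skewness turns its term [2 K (K 1)] into [-2] times
    the second moment, whence the factor [3]. *)
Lemma kop1_second_moment :
  3 * I (fun x => kop mu k one one x ^+ 2) =
  I (fun x => I (fun y => I (fun z => ksym k x y z))).
Proof.
have aux (a b : R) : a = 2 * - a + b -> 3 * a = b by lra.
have b1 : bm (one : T -> R) by exact: bm_cst.
have bK : bm (kop mu k one one) := bm_kop mu bk b1 b1.
have b11 : bm (fun y => one y * kop mu k one one y) by bmt.
have bKK := bm_kop mu bk b1 b11.
have e1 : I (fun x => kop mu k one one x ^+ 2) =
    2 * I (kop mu k one (fun y => one y * kop mu k one one y)) +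
    I (fun x => I (fun y => I (fun z => ksym k x y z * (one y * one z)))).
  rewrite (eq_wint _ _ (fun x => kop_sqr mu bk ak b1 x b1)).
  rewrite wintD; [|by []|by bmt|by rewrite /ksym; bmt].
  by rewrite wintZ; [|by []|by bmt].
have e2 : I (kop mu k one (fun y => one y * kop mu k one one y)) =
    - I (fun x => kop mu k one one x ^+ 2).
  transitivity (I (fun x => kop mu k one (fun y => one y * kop mu k one one y) x * one x)).
    by apply: eq_wint => x; rewrite mulr1.
  rewrite (kop_skew mu bk ak b1 b11 b1); congr (- _).
  by apply: eq_wint => x; rewrite mul1r expr2.
have e3 : I (fun x => I (fun y => I (fun z => ksym k x y z * (one y * one z)))) =
    I (fun x => I (fun y => I (fun z => ksym k x y z))).
  apply: eq_wint => x; apply: eq_wint => y; apply: eq_wint => z.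
  by rewrite !mulr1.
by move: e1; rewrite e2 e3; exact: aux.
Qed.

End SecondMoment.

(** * The Euclidean norm and its measurability *)

Section EuclideanNorm.
Context (R : realType) (d : nat).
Local Notation T := (borelType 'rV[R]_d).
Implicit Types (x y z u v : 'rV[R]_d).

Lemma enorm_ge0 x : 0 <= enorm x. Proof. exact: sqrtr_ge0. Qed.

Lemma enorm_sqr x : enorm x ^+ 2 = \sum_j x ord0 j ^+ 2.
Proof. by rewrite sqr_sqrtr// sumr_ge0// => j _; exact: sqr_ge0. Qed.

Lemma enorm_sub x y : enorm (x - y) = enorm (y - x).
Proof.
rewrite /enorm; congr Num.sqrt; apply: eq_bigr => j _.
by rewrite !mxE -sqrrN opprB.
Qed.

Lemma enorm0 : enorm (0 : 'rV[R]_d) = 0.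
Proof. by rewrite /enorm big1 ?sqrtr0// => j _; rewrite mxE expr0n. Qed.

Lemma enorm_eq0 x : enorm x = 0 -> x = 0.
Proof.
move=> /(congr1 (fun t => t ^+ 2)); rewrite enorm_sqr expr0n /= => /eqP.
rewrite psumr_eq0 => [/allP h|j _]; last exact: sqr_ge0.
apply/rowP => j; have := h j; rewrite mem_index_enum sqrf_eq0 => /(_ isT)/eqP ->.
by rewrite mxE.
Qed.

Lemma dot_enorm u v : \sum_j u ord0 j * v ord0 j =
  (enorm u ^+ 2 + enorm v ^+ 2 - enorm (v - u) ^+ 2) / 2.
Proof.
rewrite !enorm_sqr -big_split /= -sumrB mulr_suml; apply: eq_bigr => j _.
by rewrite !mxE; field.
Qed.

Lemma dot_le_enorm u v : \sum_j u ord0 j * v ord0 j <= enorm u * enorm v.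
Proof.
have := enorm_ge0 u; rewrite le_eqVlt => /orP[/eqP/esym/enorm_eq0 ->|u0].
  by rewrite enorm0 mul0r big1// => j _; rewrite mxE mul0r.
have := enorm_ge0 v; rewrite le_eqVlt => /orP[/eqP/esym/enorm_eq0 ->|v0].
  by rewrite enorm0 mulr0 big1// => j _; rewrite mxE mulr0.
(* This sum equals [2 |u| |v| (|u| |v| - u.v)], so Cauchy-Schwarz follows by dividing by
   [2 |u| |v|]. *)
have : 0 <= \sum_j (enorm v * u ord0 j - enorm u * v ord0 j) ^+ 2.
  by apply: sumr_ge0 => j _; exact: sqr_ge0.
have -> : \sum_j (enorm v * u ord0 j - enorm u * v ord0 j) ^+ 2 =
    enorm v ^+ 2 * (\sum_j u ord0 j ^+ 2) + enorm u ^+ 2 * (\sum_j v ord0 j ^+ 2) -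
    2 * (enorm u * enorm v) * \sum_j u ord0 j * v ord0 j.
  by rewrite !mulr_sumr -big_split /= -sumrB; apply: eq_bigr => j _; ring.
rewrite -!enorm_sqr (_ : _ - _ = 2 * (enorm u * enorm v) *
  (enorm u * enorm v - \sum_j u ord0 j * v ord0 j)); last by ring.
by rewrite pmulr_rge0 ?mulr_gt0// subr_ge0.
Qed.

Lemma enorm_triangle x y z : enorm (z - x) <= enorm (y - x) + enorm (z - y).
Proof.
have h : enorm (z - x) ^+ 2 =
    enorm (y - x) ^+ 2 + enorm (z - y) ^+ 2 +
    2 * \sum_j (y - x) ord0 j * (z - y) ord0 j.
  rewrite !enorm_sqr mulr_sumr -!big_split /=; apply: eq_bigr => j _.
  by rewrite !mxE; ring.
have : enorm (z - x) ^+ 2 <= (enorm (y - x) + enorm (z - y)) ^+ 2.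
  by rewrite h sqrrD; have := dot_le_enorm (y - x) (z - y); lra.
by rewrite ler_sqr ?nnegrE ?addr_ge0 ?enorm_ge0.
Qed.

Lemma measurable_coord j : measurable_fun setT (fun x : T => x ord0 j : R).
Proof.
apply: measurable_fun_rays => a; apply: sub_sigma_algebra.
apply: (open_comp (f := fun x : 'rV[R]_d => x ord0 j) (D := [set t | a < t])).
  by move=> x _; exact: coord_continuous.
exact: open_gt.
Qed.

Lemma measurable_enorm_sub :
  measurable_fun setT (fun p : T * T => enorm ((p.2 : 'rV[R]_d) - p.1)).
Proof.
apply: (measurableT_comp (f := @Num.sqrt R)).
  by apply: continuous_measurable_fun; exact: sqrt_continuous.
apply: measurable_sum => j; apply: measurable_funX.
rewrite (_ : (fun p => _) = fun p : T * T => p.2 ord0 j - p.1 ord0 j); last first.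
  by apply/funext => p; rewrite !mxE.
apply: measurable_funB; apply: (measurableT_comp (measurable_coord j)); msr.
Qed.

Lemma measurable_enorm_subl x : measurable_fun setT (fun y : T => enorm ((y : 'rV[R]_d) - x)).
Proof.
apply: (measurableT_comp measurable_enorm_sub (g := fun y : T => (x : T, y))).
by apply: measurable_fun_pair; msr.
Qed.

Lemma measurable_eball x r : measurable (eball x r : set T).
Proof.
rewrite -[X in measurable X]setTI.
exact: (measurable_fun_ltr (measurable_enorm_subl x) (measurable_cst r))
  measurableT [set true] _.
Qed.

End EuclideanNorm.

(** * Components of the vector kernel *)

Section VectorKernel.
Context (R : realType) (d : nat) (phi : R -> R) (s e : R).
Local Notation T := (borelType 'rV[R]_d).
Variable mu : {finite_measure set T -> \bar R}.
Hypothesis s0 : 0 < s.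
Hypothesis s1 : s < 1.
Hypothesis Phi : PhiClass phi.
Hypothesis concave_phi : concave_halfline phi.
Hypothesis dbl : doubling s phi.
Hypothesis e0 : 0 < e.

Local Notation dist x y := (enorm (y - x)).

Lemma measurable_funV d' (U : measurableType d') (f : U -> R) :
  measurable_fun setT f -> measurable_fun setT (fun x => (f x)^-1).
Proof.
move=> mf; have -> : (fun x => (f x)^-1) = fun x => f x * (f x ^+ 2) `^ (-1).
  apply/funext => x; rewrite powR_inv1 ?sqr_ge0//.
  have [->|fx] := eqVneq (f x) 0; first by rewrite invr0 mul0r.
  by field.
apply: measurable_funM => //; apply: (measurableT_comp (@measurable_powR R (-1))).
exact: measurable_funX.
Qed.

(** [phi] is monotone on the half-line only and arbitrary elsewhere, so it is first replaced by its
    constant extension to negative arguments. *)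
Lemma measurable_phi_comp d' (U : measurableType d') (f : U -> R) :
  measurable_fun setT f -> (forall x, 0 <= f x) ->
  measurable_fun setT (fun x => phi (f x)).
Proof.
move=> mf f0; have -> : (fun x => phi (f x)) = (fun t => phi (Num.max t 0)) \o f.
  by apply/funext => x /=; rewrite max_l.
apply: measurableT_comp mf; apply: nondecreasing_measurable => // a b ab.
apply: (phi_le Phi); first by rewrite le_max lexx orbT.
by rewrite ge_max !le_max ab lexx orbT.
Qed.

Definition rkernel (j : 'I_d) (x y : 'rV[R]_d) : R :=
  if e < dist x y then (y - x) ord0 j / dist x y * (phi (dist x y))^-1 else 0.

Lemma rkernel_skew j x y : rkernel j x y = - rkernel j y x.
Proof.
rewrite /rkernel (enorm_sub x y); case: ifP => _; last by rewrite oppr0.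
by rewrite -!mulNr; congr (_ / _ * _); rewrite !mxE opprB.
Qed.

Lemma bm2_rkernel j : bm2 (rkernel j : T -> T -> R).
Proof.
have mn := @measurable_enorm_sub R d.
have mphi := measurable_phi_comp mn (fun p => enorm_ge0 _).
have mc : measurable_fun setT (fun p : T * T => ((p.2 : 'rV[R]_d) - p.1) ord0 j).
  rewrite (_ : (fun p => _) = fun p : T * T => p.2 ord0 j - p.1 ord0 j); last first.
    by apply/funext => p; rewrite !mxE.
  apply: measurable_funB; apply: (measurableT_comp (measurable_coord j)); msr.
apply: (@bm_le _ _ _ _ (phi e)^-1).
  apply: measurable_fun_ifT.
  - exact: measurable_fun_ltr.
  - by apply: measurable_funM; [apply: measurable_funM|]; try exact: measurable_funV.
  - exact: measurable_cst.
move=> [x y] /=; rewrite /rkernel; have p0 := phi_gt0 Phi e0.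
case: ifP => [exy|_]; last by rewrite normr0 invr_ge0 ltW.
have d0 := lt_trans e0 exy; rewrite normrM normrM !normfV.
rewrite (ger0_norm (enorm_ge0 _)) (gtr0_norm (phi_gt0 Phi d0)).
rewrite -[leRHS]mul1r; apply: ler_pM.
- by rewrite divr_ge0 ?enorm_ge0.
- by rewrite invr_ge0 ltW// phi_gt0.
- rewrite ler_pdivrMr// mul1r -ler_sqr ?nnegrE ?enorm_ge0//.
  rewrite enorm_sqr real_normK ?num_real// (bigD1 j)//= lerDl.
  by apply: sumr_ge0 => i _; exact: sqr_ge0.
- have pd := phi_gt0 Phi d0; rewrite lef_pV2 ?posrE//.
  exact: (phi_le Phi (ltW e0) (ltW exy)).
Qed.

(** The law of cosines at the vertex [x]. Summing over components is what turns the symmetrization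
    into weighted cosines. *)
Lemma rkernel_dot x y z :
  \sum_j rkernel j x y * rkernel j x z = tcos phi e (dist x y) (dist x z) (dist y z).
Proof.
rewrite /tcos /rkernel; have [xy|_] := ltP e (dist x y); last first.
  by rewrite big1// => j _; rewrite mul0r.
have [xz|_] := ltP e (dist x z); last by rewrite big1// => j _; rewrite mulr0.
have p0 := lt_trans e0 xy; have q0 := lt_trans e0 xz.
have fp := phi_gt0 Phi p0; have fq := phi_gt0 Phi q0.
rewrite /= /wcos /cosine.
have -> : dist y z = enorm ((z - x) - (y - x)) by congr enorm; rewrite opprB addrA subrK.
transitivity ((\sum_j (y - x) ord0 j * (z - x) ord0 j) /
    (dist x y * dist x z * (phi (dist x y) * phi (dist x z)))).
  rewrite mulr_suml; apply: eq_bigr => j _.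
  move: (dist x y) (dist x z) p0 q0 fp fq => p q p0 q0 fp fq.
  by field; rewrite !gt_eqF.
rewrite dot_enorm.
move: (dist x y) (dist x z) p0 q0 fp fq => p q p0 q0 fp fq.
by field; rewrite !gt_eqF.
Qed.

(** The factor [1/2] is that of [weight_tail], so that in the limit of no truncation this dominates
    [pair_energy]. *)
Definition triple_weight (x y z : 'rV[R]_d) : R :=
  if [&& e < dist x y, e < dist x z & e < dist y z]
  then 2^-1 / phi (Num.max (dist x y) (dist x z)) ^+ 2 else 0.

Lemma triple_weight_ge0 x y z : 0 <= triple_weight x y z.
Proof.
rewrite /triple_weight; case: ifP => // _.
by rewrite divr_ge0 ?sqr_ge0.
Qed.

Lemma triple_weight_le x y z :
  (2 - 2 `^ s) / 4 * triple_weight x y z <= \sum_j ksym (rkernel j) x y z.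
Proof.
have -> : (2 - 2 `^ s) / 4 * triple_weight x y z =
    if [&& e < dist x y, e < dist x z & e < dist y z]
    then (2 - 2 `^ s) / 8 / phi (Num.max (dist x y) (dist x z)) ^+ 2 else 0.
  rewrite /triple_weight; case: ifP => _; last by rewrite mulr0.
  by rewrite mulrA; congr (_ / _); field.
rewrite /ksym !big_split /= !rkernel_dot.
rewrite (enorm_sub x y) (enorm_sub x z) (enorm_sub y z).
apply: (tcos_sum_ge s0 s1 Phi concave_phi dbl e0); rewrite ?enorm_ge0//.
- by rewrite (enorm_sub z y); exact: enorm_triangle.
- exact: enorm_triangle.
- by rewrite (enorm_sub y x); exact: enorm_triangle.
Qed.

Lemma bm3_triple_weight : bm3 (triple_weight : T -> T -> T -> R).
Proof.
have mn := @measurable_enorm_sub R d.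
have m1 : measurable_fun setT (fun p : T * T * T => dist (p.1.1 : 'rV[R]_d) p.1.2).
  by apply: (measurableT_comp mn); msr.
have m2 : measurable_fun setT (fun p : T * T * T => dist (p.1.1 : 'rV[R]_d) p.2).
  apply: (measurableT_comp mn (g := fun p : T * T * T => (p.1.1, p.2))).
  by apply: measurable_fun_pair; msr.
have m3 : measurable_fun setT (fun p : T * T * T => dist (p.1.2 : 'rV[R]_d) p.2).
  apply: (measurableT_comp mn (g := fun p : T * T * T => (p.1.2, p.2))).
  by apply: measurable_fun_pair; msr.
have p0 := phi_gt0 Phi e0.
apply: (@bm_le _ _ _ _ (2^-1 / phi e ^+ 2)).
  apply: measurable_fun_ifT.
  - by apply: measurable_and; [|apply: measurable_and]; exact: measurable_fun_ltr.
  - apply: measurable_funM => //; apply: measurable_funV; apply: measurable_funX.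
    apply: measurable_phi_comp; first exact: measurable_maxr.
    by move=> p; rewrite le_max enorm_ge0.
  - exact: measurable_cst.
move=> [[x y] z] /=; rewrite ger0_norm ?triple_weight_ge0// /triple_weight.
case: ifP => [/and3P[xy _ _]|_]; last by rewrite divr_ge0// sqr_ge0.
apply: ler_wpM2l => //.
have le_phi : phi e <= phi (Num.max (dist x y) (dist x z)).
  by apply: (phi_le Phi (ltW e0)); rewrite le_max ltW.
have m0 := lt_le_trans p0 le_phi.
rewrite lef_pV2 ?posrE ?exprn_gt0// lerXn2r ?nnegrE//; exact: ltW.
Qed.

Local Notation one := (fun=> 1 : R).
Local Notation I := (wint mu one).

Lemma triple_weight_moment :
  (2 - 2 `^ s) / 4 * I (fun x => I (fun y => I (fun z => triple_weight x y z))) <=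
  3 * \sum_j I (fun x => kop mu (rkernel j : T -> T -> R) one one x ^+ 2).
Proof.
have bG := bm3_triple_weight.
have b1 : bm (one : T -> R) by exact: bm_cst.
have o0 (x : T) : 0 <= one x :> R by exact: ler01.
have bk j := bm2_rkernel j.
have bS1 x y j : bm (ksym (rkernel j : T -> T -> R) x y).
  by have b := bk j; rewrite /ksym; bmt.
have bS2 x j : bm (fun y => I (ksym (rkernel j : T -> T -> R) x y)).
  by have b := bk j; rewrite /ksym; bmt.
have bS3 j : bm (fun x => I (fun y => I (ksym (rkernel j : T -> T -> R) x y))).
  by have b := bk j; rewrite /ksym; bmt.
rewrite mulr_sumr; under eq_bigr => j _ do
  rewrite (kop1_second_moment mu (bk j) (rkernel_skew j)).
rewrite -wintZ -?wint_sum; [|by move=> j; exact: bS3|by []|by bmt].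
apply: le_wint => //; [by bmt|by apply: bm_sum => j; exact: bS3|move=> x].
rewrite -wintZ -?wint_sum; [|by move=> j; exact: bS2|by []|by bmt].
apply: le_wint => //; [by bmt|by apply: bm_sum => j; exact: bS2|move=> y].
rewrite -wintZ -?wint_sum; [|by move=> j; exact: bS1|by []|by bmt].
apply: le_wint => //; [by bmt|by apply: bm_sum => j; exact: bS1|move=> z].
exact: triple_weight_le.
Qed.

End VectorKernel.

(** * Monotone limits under the integral *)

Section MonotoneLimit.
Context (R : realType) d (T : measurableType d).

(** The integral of a nonnegative function is a supremum over simple functions below it. The lemma
    serves integrands such as [Wphi], whose measurability is not established. *)
Lemma le_nonneg_integral (mu : {measure set T -> \bar R}) (f g : T -> \bar R) :
  (forall x, 0 <= f x)%E -> (forall x, f x <= g x)%E ->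
  (\int[mu]_x f x <= \int[mu]_x g x)%E.
Proof.
move=> f0 fg; have g0 x : (0 <= g x)%E by exact: le_trans (f0 x) (fg x).
rewrite !ge0_integralTE//; apply: ereal_sup_le => _ [u uf <-].
by exists u => // x; exact: le_trans (uf x) (fg x).
Qed.

Variable mu : {finite_measure set T -> \bar R}.

Lemma le_integral_sup (h : T -> \bar R) (f : nat -> T -> R) :
  (forall x, 0 <= h x)%E -> (forall n, bm (f n)) -> (forall n x, 0 <= f n x) ->
  (forall x, nondecreasing_seq (f ^~ x)) ->
  {ae mu, forall x, (h x <= ereal_sup (range (fun n => (f n x)%:E)))%E} ->
  (\int[mu]_x h x <= ereal_sup (range (fun n => (wint mu (fun=> 1%R) (f n))%:E)))%E.
Proof.
move=> h0 bf f0 ndf [N [mN muN hN]].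
have intf n : (\int[mu]_x (f n x)%:E = (wint mu (fun=> 1%R) (f n))%:E)%E.
  by rewrite wintE /Rintegral fineK// integrable_fin_num//; exact: bm_integrable.
pose F n x := (f n x)%:E.
have mF n : measurable_fun setT (F n) by apply/measurable_EFinP; have [] := bf n.
have ndF x : nondecreasing_seq (F ^~ x) by move=> m n mn; rewrite lee_fin; exact: ndf.
pose g x := ereal_sup (range (F ^~ x)).
have Fg x : F ^~ x @ \oo --> g x by exact: ereal_nondecreasing_cvgn.
have mg : measurable_fun setT g.
  exact: (@emeasurable_fun_cvg _ _ _ setT F g mF (fun x _ => Fg x)).
have g0 x : (0 <= g x)%E.
  by apply: le_ereal_sup_tmp; exists (F 0%N x); [exists 0%N|rewrite lee_fin].
have intg : (\int[mu]_x g x = ereal_sup (range (fun n => (wint mu (fun=> 1%R) (f n))%:E)))%E.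
  have -> : (\int[mu]_x g x = \int[mu]_x limn (F ^~ x))%E.
    by apply: eq_integral => x _; apply/esym/cvg_lim => //; exact: Fg.
  rewrite monotone_convergence//; last first.
  - by move=> n x _; rewrite lee_fin.
  under eq_fun do rewrite intf.
  apply/cvg_lim => //; apply: ereal_nondecreasing_cvgn => m n mn.
  rewrite lee_fin; apply: le_wint => // [|x]; last exact: ndf.
  exact: bm_cst.
rewrite -intg.
(* Adding [+oo] on the null set makes [h <= g'] hold everywhere and leaves the integral unchanged,
   so the comparison with [h] is pointwise. *)
pose g' x := (g x + (+oo * (\1_N x)%:E))%E.
apply: (@le_trans _ _ (\int[mu]_x g' x)%E).
  apply: le_nonneg_integral => // x; rewrite /g' indicE.
  have [xN|xN] := boolP (x \in N).
    by rewrite mule1 addey ?leey// gt_eqF// (lt_le_trans _ (g0 x)).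
  rewrite mule0 adde0; apply: contrapT => hgx; move/negP: xN; apply.
  by rewrite inE; apply: hN.
rewrite le_eqVlt; apply/orP; left; apply/eqP.
apply: ge0_ae_eq_integral => //.
- apply: emeasurable_funD => //; apply: emeasurable_funM => //.
  by apply/measurable_EFinP; exact: measurable_indic.
- by move=> x _; rewrite adde_ge0// mule_ge0// lee_fin indicE.
- exists N; split => // x /= hx; apply: contrapT => xN; apply: hx => _.
  by rewrite /g' indicE memNset// mule0 adde0.
Qed.

End MonotoneLimit.

(** * The Wolff energy as a triple integral *)

Section WolffEnergy.
Context (R : realType) (d : nat) (phi : R -> R).
Local Notation T := (borelType 'rV[R]_d).
Variable mu : {finite_measure set T -> \bar R}.
Hypothesis Phi : PhiClass phi.
Hypothesis no_atom : forall x : 'rV[R]_d, mu (eball x t) @[t --> 0^'+] --> 0%E.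

Local Notation dist x y := (enorm (y - x)).
Local Notation leb := (@lebesgue_measure R).

Let measurable_set1_euclid (x : 'rV[R]_d) : measurable ([set x] : set T).
Proof.
rewrite (_ : [set x] = [set y : T | enorm ((y : 'rV[R]_d) - x) <= 0]).
  have h : measurable_fun setT (fun y : T => enorm ((y : 'rV[R]_d) - x) <= 0).
    by apply: measurable_fun_ler => //; exact: measurable_enorm_subl.
  by rewrite -[X in measurable X]setTI; exact: (h measurableT [set true]).
apply/seteqP; split => y /= => [->|yx]; first by rewrite subrr enorm0.
apply/eqP; rewrite -subr_eq0; apply/eqP/enorm_eq0/le_anti.
by rewrite yx enorm_ge0.
Qed.

Lemma ae_neq (x : 'rV[R]_d) : {ae mu, forall y : T, y != x}.
Proof.
exists [set x]; split; first exact: measurable_set1_euclid.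
  apply/le_anti; rewrite measure_ge0 andbT.
  apply: (cvge_to_ge (no_atom x)); near=> t.
  apply: le_measure; rewrite ?inE; [exact: measurable_set1_euclid| |].
    exact: measurable_eball.
  by move=> y ->; rewrite /eball /= subrr enorm0.
by move=> y /= /negP; rewrite negbK => /eqP.
Unshelve. all: by end_near. Qed.

Let m (x : 'rV[R]_d) (t : R) : R := fine (mu (eball x t)).

Let m_ge0 x t : 0 <= m x t. Proof. exact: fine_ge0. Qed.

Let mE x t : mu (eball x t) = (m x t)%:E.
Proof. by rewrite /m fineK// fin_num_measure//; exact: measurable_eball. Qed.

Let measurable_m x : measurable_fun setT (m x).
Proof.
apply: nondecreasing_measurable => // a b ab.
rewrite -lee_fin -!mE; apply: le_measure; rewrite ?inE; try exact: measurable_eball.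
by move=> y /= /lt_le_trans; apply.
Qed.

Let ball_tonelli x (u : R -> R) : measurable_fun setT u -> (forall t, 0 <= u t) ->
  (\int[leb]_t (m x t * u t)%:E =
   \int[mu]_y \int[leb]_t (if dist x y < t then u t else 0)%:E)%E.
Proof.
move=> mu_ u0.
transitivity (\int[leb]_t \int[mu]_y (if dist x y < t then u t else 0)%:E)%E.
  apply: eq_integral => t _.
  transitivity (\int[mu]_y ((u t)%:E * (\1_(eball x t) y)%:E))%E; last first.
    apply: eq_integral => y _; rewrite indicE -EFinM /eball; congr (_%:E).
    have [yx|yx] := boolP (dist x y < t); first by rewrite mem_set// mulr1.
    by rewrite memNset ?mulr0//=; exact/negP.
  have mB := measurable_eball x t.
  rewrite ge0_integralZl_EFin//; last first.
    by apply/measurable_EFinP; exact: measurable_indic.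
  rewrite integral_indic// setIT [X in (_ * X)%E](_ : _ = (m x t)%:E); last exact: mE.
  by rewrite -EFinM mulrC.
pose f (p : R * T) : \bar R := (if dist x p.2 < p.1 then u p.1 else 0)%:E.
rewrite (@fubini_tonelli _ _ _ _ _ leb mu f)//.
  apply/measurable_EFinP; apply: measurable_fun_ifT.
  - apply: measurable_fun_ltr; last exact: measurable_fst.
    by apply: (measurableT_comp (measurable_enorm_subl x)); exact: measurable_snd.
  - by apply: (measurableT_comp mu_); exact: measurable_fst.
  - exact: measurable_cst.
by move=> p; rewrite /f lee_fin; case: ifP.
Qed.

(** The density of [dphi / phi^3], set to zero off the half-line so that Tonelli runs over the whole
    line. *)
Let w (t : R) : R := if 0 < t then derive1 phi t / phi t ^+ 3 else 0.

Let w_ge0 t : 0 <= w t.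
Proof.
rewrite /w; case: ifP => // t0.
by rewrite divr_ge0 ?(dphi_ge0 Phi)// exprn_ge0// ltW// (phi_gt0 Phi).
Qed.

Let measurable_w : measurable_fun setT w.
Proof.
apply: measurable_fun_if => //; first exact: measurable_fun_ltr.
  rewrite setTI (_ : _ @^-1` _ = `]0, +oo[%classic); last first.
    by apply/seteqP; split => t /=; rewrite in_itv /= andbT.
  apply: open_continuous_measurable_fun; first exact: interval_open.
by move=> t; rewrite inE /= in_itv /= andbT; exact: weight_continuous.
Qed.

Definition pair_energy (x y z : 'rV[R]_d) : \bar R :=
  \int[leb]_t (if dist x z < t then if dist x y < t then w t else 0 else 0)%:E.

(** Tonelli is applied to the two factors of the squared ball mass in turn; the factor not yet
    opened stays in the weight. *)
Lemma Wphi_pair_energy (x : 'rV[R]_d) :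
  (Wphi mu phi x = \int[mu]_y \int[mu]_z pair_energy x y z)%E.
Proof.
transitivity (\int[leb]_t (m x t * (m x t * w t))%:E)%E.
  rewrite /Wphi integral_mkcond; apply: eq_integral => t _.
  rewrite patchE /w; case: ifPn => [|]; last first.
    rewrite notin_setE /= in_itv /= andbT => /negP/negbTE ->.
    by rewrite !mulr0.
  rewrite inE /= in_itv /= andbT => t0; rewrite t0; congr (_%:E).
  have p0 := phi_gt0 Phi t0; rewrite -/(m x t).
  by field; rewrite gt_eqF.
have mw : measurable_fun setT (fun t => m x t * w t) 
  by apply: measurable_funM; [exact: measurable_m|exact: measurable_w].
rewrite ball_tonelli//; last by move=> t; exact: mulr_ge0.
apply: eq_integral => y _.
rewrite (_ : (\int[leb]_t _)%E =
    (\int[leb]_t (m x t * (if dist x y < t then w t else 0))%:E)%E).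
  apply: ball_tonelli; last by move=> t; case: ifP.
  apply: measurable_fun_ifT => //; exact: measurable_fun_ltr.
by apply: eq_integral => t _; case: ifP; rewrite ?mulr0.
Qed.

(** The integrand lives beyond the larger distance, where it is the weight of [weight_tail];
    [y != x] keeps that lower end positive. *)
Lemma pair_energy_le (x y z : 'rV[R]_d) : y != x ->
  (pair_energy x y z <= (2^-1 / phi (Num.max (dist x y) (dist x z)) ^+ 2)%:E)%E.
Proof.
move=> yx; set M := Num.max _ _.
have M0 : 0 < M.
  rewrite /M lt_max lt_neqAle enorm_ge0 andbT; apply/orP; left.
  by apply: contraNN yx => /eqP/esym/enorm_eq0/eqP; rewrite subr_eq0.
rewrite -(weight_tail Phi M0) [leRHS]integral_mkcond.
apply: le_nonneg_integral => t; first by rewrite lee_fin; case: ifP => // _; case: ifP.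
rewrite patchE; have [tM|Mt] := ltP t M.
  rewrite memNset; last by rewrite /= in_itv /= andbT; apply/negP; rewrite -ltNge.
  rewrite lee_fin; case: ifP => // zt; case: ifP => // yt.
  by move: tM; rewrite /M lt_max => /orP[] h; [have := lt_trans h yt|have := lt_trans h zt];
    rewrite ltxx.
rewrite mem_set; last by rewrite /= in_itv /= Mt.
have t0 := lt_le_trans M0 Mt; have := w_ge0 t.
by rewrite lee_fin /w t0; case: ifP => // _; case: ifP.
Qed.

Let en (n : nat) : R := n.+1%:R^-1.
Let en0 n : 0 < en n. Proof. by rewrite invr_gt0. Qed.

Local Notation tw n := (triple_weight phi (en n)).

Let tw_nd (x y z : 'rV[R]_d) : nondecreasing_seq (fun n => tw n x y z).
Proof.
move=> a b ab; have ba : en b <= en a by rewrite lef_pV2 ?posrE// ler_nat.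
rewrite {1}/triple_weight; case: ifP => [/and3P[h1 h2 h3]|_]; last exact: triple_weight_ge0.
by rewrite /triple_weight !(le_lt_trans ba).
Qed.

Let pair_energy_sup (x y z : 'rV[R]_d) : y != x -> z != x -> z != y ->
  (pair_energy x y z <= ereal_sup (range (fun n => (tw n x y z)%:E)))%E.
Proof.
move=> yx zx zy; apply: (le_trans (pair_energy_le z yx)).
have dpos (a b : 'rV[R]_d) : b != a -> 0 < dist a b.
  move=> ba; rewrite lt_neqAle enorm_ge0 andbT.
  by apply: contraNN ba => /eqP/esym/enorm_eq0/eqP; rewrite subr_eq0.
have r0 : 0 < Num.min (dist x y) (Num.min (dist x z) (dist y z)).
  by rewrite !lt_min !dpos.
have [n _ hn] := near_infty_natSinv_lt (PosNum r0).
apply: le_ereal_sup_tmp; exists (tw n x y z)%:E; first by exists n.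
have := hn n (leqnn n); rewrite /= !lt_min => /and3P[h1 h2 h3].
by rewrite /triple_weight /en h1 h2 h3.
Qed.

Local Notation one := (fun=> 1 : R).
Local Notation I := (wint mu one).

(** The limit of vanishing truncation is taken one variable at a time, innermost last. Coincident
    points, where the truncated weight stays zero, are excluded almost everywhere by the absence of
    atoms. *)
Lemma Wphi_le_sup : (\int[mu]_x Wphi mu phi x <= ereal_sup (range (fun n =>
  (I (fun x => I (fun y => I (fun z => tw n x y z))))%:E)))%E.
Proof.
have bt n := bm3_triple_weight d Phi (en0 n).
have b1 : bm (one : T -> R) by exact: bm_cst.
have o0 (x : T) : 0 <= one x :> R by exact: ler01.
have tw0 n (x y z : 'rV[R]_d) : 0 <= tw n x y z by exact: triple_weight_ge0.
have bz n (x y : T) : bm (fun z : T => tw n x y z) by have b := bt n; bmt.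
have by_ n (x : T) : bm (fun y : T => I (fun z => tw n x y z)) by have b := bt n; bmt.
have bx n : bm (fun x : T => I (fun y => I (fun z => tw n x y z))).
  by have b := bt n; bmt.
have Pge0 (x y z : 'rV[R]_d) : (0 <= pair_energy x y z)%E.
  by apply: integral_ge0 => t _; rewrite lee_fin; case: ifP => // _; case: ifP.
have F := ae_filter_ringOfSetsType mu.
apply: le_integral_sup => //.
- move=> x; apply: integral_ge0 => t; rewrite /= in_itv /= andbT => t0; rewrite lee_fin.
  rewrite mulr_ge0 ?sqr_ge0// divr_ge0 ?(dphi_ge0 Phi)// ltW//.
  exact: (phi_gt0 Phi).
- by move=> n x; apply: wint_ge0 => // y; exact: wint_ge0.
- move=> x a b ab; apply: le_wint => // y; apply: le_wint => // z; exact: tw_nd.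
apply: aeW => x; rewrite Wphi_pair_energy.
apply: le_integral_sup => //.
- by move=> y; apply: integral_ge0.
- by move=> n y; exact: wint_ge0.
- by move=> y a b ab; apply: le_wint => // z; exact: tw_nd.
apply: (filterS _ (ae_neq x)) => y yx.
apply: le_integral_sup => //.
apply: (filterS _ (filterI (ae_neq x) (ae_neq y))) => z [zx zy].
exact: pair_energy_sup.
Qed.

End WolffEnergy.

Lemma le1_of_sqr1 (R : realType) (x : \bar R) : (0 <= x -> x ^+ 2 = 1 -> x <= 1)%E.
Proof.
case: x => [r||]//.
rewrite -EFin_expe !lee_fin => r0 [] r1.
by rewrite -ler_sqr ?nnegrE// r1 expr1n.
Qed.

(** * Testing the vector operator on a constant *)

Section VectorTruncation.
Context (R : realType) (d : nat) (phi : R -> R) (e : R).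
Local Notation T := (borelType 'rV[R]_d).
Variable mu : {finite_measure set T -> \bar R}.
Hypothesis Phi : PhiClass phi.
Hypothesis e0 : 0 < e.
Hypothesis mu0 : mu setT != 0%E.

Let M := fine (mu setT).

Lemma mass_gt0 : 0 < M.
Proof.
rewrite fine_gt0// lt0e mu0 measure_ge0 /=.
by rewrite ltey_eq fin_num_measure.
Qed.

Local Notation one := (fun=> 1 : R).

(** The constant of unit norm; its normalization is the source of the factor [1 / M] in the lower
    bound. *)
Let f0 : T -> R[i] := fun=> ((Num.sqrt M)^-1)%:C.

Let normc_f0 x : Normc.normc (f0 x) ^+ 2 = M^-1.
Proof.
by rewrite normc_sqr /= expr0n addr0 exprVn sqr_sqrtr// ltW// mass_gt0.
Qed.

Let L2norm_f0 : (L2norm mu (@Normc.normc R) f0 <= 1)%E.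
Proof.
apply: le1_of_sqr1; first exact: Lnorm_ge0.
rewrite L2norm_sqr; under eq_integral do rewrite normc_f0.
rewrite integral_cst// [X in (_ * X)%E](_ : _ = M%:E); last first.
  by rewrite /M fineK// fin_num_measure.
by rewrite -EFinM mulVf// gt_eqF// mass_gt0.
Qed.

Let phi_truncE x : hnorm (phi_trunc mu phi e f0 x) ^+ 2 =
  M^-1 * \sum_j kop mu (rkernel phi e j : T -> T -> R) one one x ^+ 2.
Proof.
rewrite sqr_sqrtr; last by apply: sumr_ge0 => j _; exact: sqr_ge0.
rewrite mulr_sumr; apply: eq_bigr => j _; rewrite normc_sqr !mxE /=.
have -> : M^-1 = (Num.sqrt M)^-1 ^+ 2 by rewrite exprVn sqr_sqrtr// ltW// mass_gt0.
rewrite -exprMn [X in _ + X ^+ 2](_ : _ = 0); last first.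
  under eq_Rintegral do rewrite mulr0 mul0r addr0.
  by rewrite /Rintegral integral0.
rewrite expr0n addr0; congr (_ ^+ 2).
rewrite -wintZ; last 2 first.
- exact: bm_cst.
- have b := bm2_rkernel Phi e0 j; bmt.
rewrite wintE [LHS]Rintegral_mkcond; apply: eq_Rintegral => y _.
rewrite patchE /rkernel /=; have [exy|exy] := ltP e (enorm (y - x)).
  by rewrite mem_set// mul0r subr0 mulr1 mulrC.
by rewrite memNset ?mul0r ?mulr0//=; apply/negP; rewrite -leNgt.
Qed.

Lemma phi_trunc_lower :
  ((M^-1 * \sum_j wint mu one (fun x => kop mu (rkernel phi e j : T -> T -> R) one one x ^+ 2))%:E
   <= L2opnorm mu (@hnorm R d) (phi_trunc mu phi e) ^+ 2)%E.
Proof.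
have b j := bm2_rkernel Phi e0 j.
have b1 : bm (one : T -> R) by exact: bm_cst.
have bK j : bm (fun x => kop mu (rkernel phi e j : T -> T -> R) one one x ^+ 2).
  by apply: bmX; exact: bm_kop.
apply: (@le_trans _ _ (L2norm mu (@hnorm R d) (phi_trunc mu phi e f0) ^+ 2)%E).
  rewrite L2norm_sqr; under eq_integral do rewrite phi_truncE.
  have bS : bm (fun x => M^-1 * \sum_j kop mu (rkernel phi e j : T -> T -> R) one one x ^+ 2).
    by apply: bmM; [exact: bm_cst|exact: bm_sum].
  rewrite -[leRHS]fineK; last exact: integrable_fin_num (bm_integrable mu bS).
  rewrite lee_fin -[fine _]/(\int[mu]_x _) -wintE.
  rewrite wintZ; [|by []|exact: bm_sum].
  by rewrite wint_sum.
have ge0 : (0 <= L2norm mu (@hnorm R d) (phi_trunc mu phi e f0))%E by exact: Lnorm_ge0.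
have le_op : (L2norm mu (@hnorm R d) (phi_trunc mu phi e f0) <=
    L2opnorm mu (@hnorm R d) (phi_trunc mu phi e))%E.
  apply: ereal_sup_ubound; exists f0 => //=; split=> //; split.
  - exact: measurable_cst.
  - exact: measurable_cst.
  - exact: le_lt_trans L2norm_f0 (ltry _).
by rewrite !expe2; apply: lee_pmul.
Qed.

End VectorTruncation.

Lemma vector_lower_bound (R : realType) (s : R) : 0 < s -> s < 1 ->
  exists2 c : R, 0 < c &
  forall (d : nat)
    (mu : {finite_measure set (borelType 'rV[R]_d) -> \bar R})
    (phi : R -> R),
  (0 < d)%N ->
  mu setT != 0%E ->
  (forall x : 'rV[R]_d, mu (eball x t) @[t --> 0^'+] --> 0%E) ->
  PhiClass phi ->
  concave_halfline phi ->
  doubling s phi ->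
  ((c / fine (mu setT))%:E * \int[mu]_x Wphi mu phi x
   <= ereal_sup [set L2opnorm mu (@hnorm R d) (phi_trunc mu phi eps) ^+ 2
                | eps in `]0%R, +oo[])%E.
Proof.
move=> s0 s1; have [_ t2] := andP (two_powR_bounds s0 s1).
have rescale (a i k : R) : (2 - a) / 4 * i <= 3 * k -> i * ((2 - a) / 12) <= k by lra.
(* The constant [(2 - 2^s) / 4] of [triple_weight_moment], divided by the [3] of the second moment
   identity. *)
pose c : R := (2 - 2 `^ s) / 12.
have c0 : 0 < c by rewrite divr_gt0// subr_gt0.
exists c => // d mu phi _ mu0 no_atom Phi concave_phi dbl.
set S := ereal_sup _; have M0 := mass_gt0 mu0; set M := fine _ in M0 *.
have SE e : 0 < e -> (L2opnorm mu (@hnorm R d) (phi_trunc mu phi e) ^+ 2 <= S)%E.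
  by move=> e0; apply: ereal_sup_ubound; exists e => //=; rewrite in_itv /= e0.
have W : (\int[mu]_x Wphi mu phi x <= (M / c)%:E * S)%E.
  apply: (le_trans (Wphi_le_sup Phi no_atom)).
  apply: ge_ereal_sup => _ [n _ <-].
  have e0 : 0 < n.+1%:R^-1 :> R by rewrite invr_gt0.
  have h1 := triple_weight_moment mu s0 s1 Phi concave_phi dbl e0.
  have h2 := le_trans (phi_trunc_lower Phi e0 mu0) (SE _ e0).
  move: h1 h2; set I3 := wint _ _ _; set K := \sum_j _ => h1 h2.
  have Mc : 0 < M / c by exact: divr_gt0.
  apply: (@le_trans _ _ ((M / c)%:E * (M^-1 * K)%:E)%E); last first.
    by apply: lee_wpmul2l => //; rewrite lee_fin ltW.
  rewrite -EFinM lee_fin mulrA (_ : M / c * M^-1 = c^-1); last first.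
    by field; rewrite !gt_eqF.
  rewrite mulrC ler_pdivlMr//; exact: rescale h1.
have cM : (0 <= (c / M)%:E)%E by rewrite lee_fin ltW// divr_gt0.
apply: (le_trans (lee_wpmul2l cM W)).
rewrite muleA -EFinM (_ : c / M * (M / c) = 1) ?mul1e//.
by field; rewrite !gt_eqF.
Qed.

Theorem theorem2p5 (R : realType) :
  (forall A s delta : R, 0 < A -> 0 < s -> 0 < delta -> delta <= 1 ->
   exists2 C : R, 0 < C &
   forall (X : pmetricType R)
     (mu : {finite_measure set (borelType X) -> \bar R})
     (K : X -> X -> R[i]),
   separable_space X ->
   antisymmetric_kernel K ->
   CZ_kernel A s delta K ->
   (ereal_sup [set L2opnorm mu (@Normc.normc R) (CZtrunc mu K eps) ^+ 2
              | eps in `]0%R, +oo[]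
    <= C%:E * nneg_sup [set Wpot mu s x | x in msupport mu])%E)
  /\
  (forall s : R, 0 < s -> s < 1 ->
   exists2 c : R, 0 < c &
   forall (d : nat)
     (mu : {finite_measure set (borelType 'rV[R]_d) -> \bar R})
     (phi : R -> R),
   (0 < d)%N ->
   mu setT != 0%E ->
   (forall x : 'rV[R]_d, mu (eball x t) @[t --> 0^'+] --> 0%E) ->
   PhiClass phi ->
   concave_halfline phi ->
   doubling s phi ->
   ((c / fine (mu setT))%:E * \int[mu]_x Wphi mu phi x
    <= ereal_sup [set L2opnorm mu (@hnorm R d) (phi_trunc mu phi eps) ^+ 2
                 | eps in `]0%R, +oo[])%E).
Proof.
split=> [A s delta A0 s0 delta0 delta1|s s0 s1]; first exact: CZ_upper_bound.
exact: vector_lower_bound.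
Qed.
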